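(* Let $F:\mathbb{C}\to\mathbb{R}$ be a $\mathcal{C}^\infty$-smooth subharmonic function that vanishes to infinite order at $0\in\mathbb{C}$ and is radial, i.e., $F(z)=F(|z|)$ for all $z\in\mathbb{C}$. Suppose the boundary of the domain $\Omega_F:=\{(z,w)\in\mathbb{C}^2:\operatorname{Im} w>F(z)\}$ is not Levi-flat around $(0,0)$. Let $f:[0,\infty)\to\mathbb{R}$ be given by $f(|z|)=F(z)$ for all $z\in\mathbb{C}$, and assume that there exists a constant $R\in(0,f^{-1}(1))$ such that $\Lambda_f|_{[0,R]}$ satisfies a doubling condition. Then there exists a constant $C_2>0$ and, for each $\alpha>0$ and each positive integer $N$, there exists a constant $\tau(\alpha,N)>0$ such that $$\frac{1}{C_2}\Big(\big(f^{-1}(\operatorname{Im} w)\big)^{-2}|\xi_1|^2+|\operatorname{Im} w|^{-2}|\xi_2|^2\Big)\le ds^2_F(z,w;\xi)\le C_2\Big(\big(f^{-1}(\operatorname{Im} w)\big)^{-2}|\xi_1|^2+|\operatorname{Im} w|^{-2}|\xi_2|^2\Big)$$ for all $(z,w)\in\mathscr{A}_{\alpha,N}\cap\{(z,w):\operatorname{Im} w<\tau(\alpha,N)\}$ and all $\xi=(\xi_1,\xi_2)\in\mathbb{C}^2$, where $$\mathscr{A}_{\alpha,N}:=\Big\{(z,w)\in\Omega_F:\sqrt{|z|^2+|\operatorname{Re} w|^2}<\alpha(\operatorname{Im} w)^{1/N}\Big\}.$$ (The constant $C_2$ does not depend on $\alpha$ or $N$.)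
   Context: Vanishing to infinite order: for a radial $F$ with $F(z)=f(|z|)$, this means that $f\in\mathcal{C}^\infty([0,\infty))$, $f^{(n)}(0)=0$ and $\lim_{x\to0^+}f(x)/x^n=0$ for every $n\in\mathbb{N}$ (in particular $f(0)=0$). Levi-flat around $(0,0)$: the Levi form of $\partial\Omega_F$ vanishes identically on some neighbourhood of $(0,0)$ in $\partial\Omega_F$. Under the stated hypotheses on $F$ (before the doubling assumption), $f$ is strictly increasing on $[0,\infty)$ and $\lim_{r\to\infty}f(r)=+\infty$, so $f^{-1}:[0,\infty)\to[0,\infty)$ is defined. Doubling condition: an increasing function $g:[0,R]\to\mathbb{R}$ satisfies a doubling condition if $g(0)=0$ and there is a constant $\sigma>1$ (a doubling constant for $g$) such that $2g(x)\le g(\sigma x)$ for all $x\in[0,R/\sigma]$. The function $\Lambda_f$: for $f:[0,\infty)\to\mathbb{R}$ strictly increasing with $f(0)=0$, $\Lambda_f(x):=-1/\log(f(x))$ if $0<x<f^{-1}(1)$, and $\Lambda_f(0):=0$. Bergman metric: for a domain $\Omega\subset\mathbb{C}^2$, let $A^2(\Omega):=\mathbb{L}^2(\Omega,\mathbb{C})\cap\mathcal{O}(\Omega)$ be the space of square-integrable (with respect to Lebesgue measure) holomorphic functions on $\Omega$, let $B_\Omega$ be its reproducing (Bergman) kernel, and let $K_\Omega(z,w):=B_\Omega((z,w),(z,w))$. The Bergman metric is given (where $K_\Omega>0$) by the Hermitian form with coefficients $\partial_j\overline{\partial}_k\log K_\Omega$, where $\partial_1=\partial/\partial z$ and $\partial_2=\partial/\partial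 w$. Identify $T^{1,0}\Omega_F$ with $\Omega_F\times\mathbb{C}^2$ via $\xi=\xi_1(\partial/\partial z|_p)+\xi_2(\partial/\partial w|_p)\leftrightarrow(p;\xi_1,\xi_2)$. Then $ds^2_F(p;\xi):=\sum_{j,k=1}^2\big(\partial_j\overline{\partial}_k\log K_{\Omega_F}\big)(p)\,\xi_j\overline{\xi_k}$, i.e., the square of the Bergman norm of $\xi\in T^{1,0}_p\Omega_F$. *)

(* Defs.v *)
From HB Require Import structures.
From mathcomp Require Import all_boot all_order all_algebra.
From mathcomp Require Import all_classical all_reals all_analysis.
From mathcomp Require Import complex.

Set Implicit Arguments.
Unset Strict Implicit.
Unset Printing Implicit Defensive.

Import Order.TTheory GRing.Theory Num.Theory.
Import numFieldNormedType.Exports.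
Import ComplexField.Normc.

Local Open Scope classical_set_scope.
Local Open Scope ring_scope.
Local Open Scope complex_scope.

(* The regular module [R[i]^o] is what carries the topology and the structure
   of normed module over [R[i]]; so differentiability on [C2 R] below is
   complex differentiability. *)
Definition C2 (R : realType) : normedModType R[i] := (R[i]^o * R[i]^o)%type.

Section RealVariable.
Context {R : realType}.

(* [g'] is the derivative of [g] on [0, +oo[, one-sided at 0. *)
Definition is_derivative_on_halfline (g g' : R -> R) :=
  forall x : R, 0 <= x ->
    (g y - g x) / (y - x) @[y --> within [set y | 0 <= y] x^'] --> g' x.

(* [D n] is the n-th derivative of [f] on [0, +oo[. *)
Definition vanishes_to_infinite_order (f : R -> R) :=
  exists D : nat -> R -> R,
    [/\ forall x, 0 <= x -> D 0%N x = f x,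
        forall n, is_derivative_on_halfline (D n) (D n.+1),
        forall n, D n 0 = 0
      & forall n, f x / x ^+ n @[x --> 0^'+] --> (0 : R)].

Definition halfline_inverse (f : R -> R) : R -> R :=
  'pinv_(fun=> 0) [set x | 0 <= x] f.

Definition Lambda (f : R -> R) (x : R) : R :=
  if 0 < x then - 1 / ln (f x) else 0.

Definition doubling (r : R) (g : R -> R) :=
  [/\ {in `[0, r] &, {homo g : x y / x <= y}},
      g 0 = 0
    & exists2 sigma : R, 1 < sigma &
        forall x, 0 <= x <= r / sigma -> 2 * g x <= g (sigma * x)].

End RealVariable.

Section FunctionsOnC.
Context {R : realType}.

Definition radial (F : R[i] -> R) := forall z, F z = F (normc z)%:C.

Fixpoint iterated_derivative (s : seq (R * R)) (g : R * R -> R) : R * R -> R :=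
  if s is v :: s' then 'D_v (iterated_derivative s' g) else g.

(* Smoothness is in the real sense: every iterated directional derivative is
   (real-)differentiable at every point. *)
Definition smooth (F : R[i] -> R) :=
  forall (s : seq (R * R)) (p : R * R),
    differentiable
      (iterated_derivative s (fun q : R * R => F (q.1 +i* q.2))) p.

(* Upper semicontinuity and the sub-mean value inequality on circles; the
   integral is extended-real valued, so no integrability is presupposed. *)
Definition subharmonic (F : R[i] -> R) :=
  (forall (z : R[i]^o) (a : R), F z < a -> \forall y \near z, F y < a) /\
  (forall (z : R[i]) (r : R), 0 < r ->
     ((F z)%:E <= ((2 * pi)^-1)%:E *
        \int[lebesgue_measure]_(t in `[0%R, (2 * pi)%R])
          (F (z + (r * cos t +i* (r * sin t))))%:E)%E).

End FunctionsOnC.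

Section TwoComplexVariables.
Context {R : realType}.
Implicit Types (Om : set (C2 R)) (p xi : C2 R).

Definition coordinate p (j : 'I_2) : R[i] := if j == ord0 then p.1 else p.2.

Definition basis_vector (j : 'I_2) : C2 R :=
  if j == ord0 then (1, 0) else (0, 1).

(* Derivative along [v] with respect to a real parameter. *)
Definition real_derivative (v : C2 R) (g : C2 R -> R[i]) (p : C2 R) : R[i] :=
  derive1 (fun t : R => complex.Re (g (p + t%:C *: v))) 0 +i*
  derive1 (fun t : R => complex.Im (g (p + t%:C *: v))) 0.

(* The Wirtinger derivatives (d/dx - i d/dy)/2 and (d/dx + i d/dy)/2 in the
   j-th complex variable x + i y. *)
Definition wirtinger (j : 'I_2) (g : C2 R -> R[i]) (p : C2 R) : R[i] :=
  (real_derivative (basis_vector j) g p -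
   'i * real_derivative ('i *: basis_vector j) g p) / 2.

Definition wirtinger_bar (j : 'I_2) (g : C2 R -> R[i]) (p : C2 R) : R[i] :=
  (real_derivative (basis_vector j) g p +
   'i * real_derivative ('i *: basis_vector j) g p) / 2.

(* The sum is real for real-valued [u] of class C^2, its coefficient matrix
   being then Hermitian. *)
Definition complex_hessian (u : C2 R -> R) p xi : R :=
  complex.Re (\sum_(j < 2) \sum_(k < 2)
    wirtinger j (wirtinger_bar k (fun q => (u q)%:C)) p *
    coordinate xi j * (coordinate xi k)^*).

Definition holomorphic_tangent (rho : C2 R -> R) p xi :=
  \sum_(j < 2) wirtinger j (fun q => (rho q)%:C) p * coordinate xi j = 0.

(* [rho] is a defining function of [Om]; the Levi form is the restriction of
   its complex Hessian to the holomorphic tangent space of the boundary. *)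
Definition levi_flat_around Om (rho : C2 R -> R) (p0 : C2 R) :=
  \forall p \near p0, (closure Om `\` interior Om) p ->
    forall xi, holomorphic_tangent rho p xi -> complex_hessian rho p xi = 0.

Local Notation mu := (@lebesgue_measure R).

(* Lebesgue measure on R^4; with this nesting every right factor is
   [lebesgue_measure], whose sigma-finiteness is inferred. *)
Local Notation lebesgue_measure4 := (((mu \x mu) \x mu) \x mu)%E.

Definition of_coordinates (x : R * R * R * R) : C2 R :=
  let: (x1, y1, x2, y2) := x in (x1 +i* y1, x2 +i* y2).

Definition holomorphic_on Om (h : C2 R -> R[i]^o) :=
  forall p, Om p -> differentiable h p.

Definition square_integrable_on Om (h : C2 R -> R[i]) :=
  lebesgue_measure4.-integrable (of_coordinates @^-1` Om)
    (fun x => (normc (h (of_coordinates x)) ^+ 2)%:E).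

Definition A2 Om : set (C2 R -> R[i]) :=
  [set h | square_integrable_on Om h /\ holomorphic_on Om h].

Definition L2_inner Om (h k : C2 R -> R[i]) : R[i] :=
  let integrand x := h (of_coordinates x) * (k (of_coordinates x))^* in
  (\int[lebesgue_measure4]_(x in of_coordinates @^-1` Om)
     complex.Re (integrand x)) +i*
  (\int[lebesgue_measure4]_(x in of_coordinates @^-1` Om)
     complex.Im (integrand x)).

(* [bergman_kernel Om p q] is B_Om(p, q): as a function of [p] it is the
   element of A2(Om), unique on [Om], that represents evaluation at [q]. *)
Definition bergman_kernel Om p q : R[i] :=
  xget (fun=> 0) [set k | A2 Om k /\ forall h, A2 Om h -> h q = L2_inner Om h k] p.

Definition bergman_diagonal Om p : R := complex.Re (bergman_kernel Om p p).

(* [ln] is total: this is the Bergman metric only where [bergman_diagonal Om]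
   is positive. *)
Definition bergman_metric Om p xi : R :=
  complex_hessian (fun q => ln (bergman_diagonal Om q)) p xi.

Definition Omega (F : R[i] -> R) : set (C2 R) :=
  [set p | F p.1 < complex.Im p.2].

Definition defining_function (F : R[i] -> R) (p : C2 R) : R :=
  F p.1 - complex.Im p.2.

Definition approach_region (F : R[i] -> R) (alpha : R) (N : nat) : set (C2 R) :=
  [set p | Omega F p /\
     Num.sqrt (normc p.1 ^+ 2 + `|complex.Re p.2| ^+ 2) <
       alpha * (complex.Im p.2) `^ (N%:R^-1)].

Definition model_metric (f : R -> R) p xi : R :=
  (halfline_inverse f (complex.Im p.2)) ^- 2 * normc xi.1 ^+ 2 +
  `|complex.Im p.2| ^- 2 * normc xi.2 ^+ 2.

End TwoComplexVariables.

(* Main.v *)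
From HB Require Import structures.
From mathcomp Require Import all_boot all_order all_algebra.
From mathcomp Require Import all_classical all_reals all_analysis.
From mathcomp Require Import measurable_realfun.
From mathcomp Require Import complex ring lra.
Require Import Defs.

Set Implicit Arguments.
Unset Strict Implicit.
Unset Printing Implicit Defensive.

Import Order.TTheory GRing.Theory Num.Theory.
Import numFieldNormedType.Exports.
Import ComplexField.Normc.

Local Open Scope classical_set_scope.
Local Open Scope ring_scope.
Local Open Scope complex_scope.

(** The Bergman kernel and metric at [p = (z0, w0)] are determined by extremal
    problems in the Bergman space: [K p] is the largest [|h p|^2] for [h] of norm 1,
    and [K p] times the metric is the largest [|xi h (p)|^2] for [h] of norm 1 that
    vanish at [p].  So it suffices to bound evaluations and derivatives from above
    for all [h], and from below for well chosen [h].  With [y = Im w0] and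
    [s = f^-1 y], both bounds have the size of those of a product of discs of radii
    [s] and [y], for which the metric is [|xi_1|^2 / s^2 + |xi_2|^2 / y^2].

    Subharmonicity makes [r f'(r)] nondecreasing ([laplacian_ge0],
    [slope_nondecreasing]).  If [f'] had a positive zero, [f] would vanish near 0 and
    the boundary would be Levi-flat ([zero_slope], [levi_flat_of_zero]); hence [f] is
    strictly increasing and grows at least like a logarithm ([profile_log]).  The
    doubling condition says that [f (x) <= f (sigma x)^2] ([doubling_sqr]): dividing
    the radius by [sigma] squares the height.  Thus [f (s / sigma) <= y^2] and
    [f (sigma s) >= sqrt y].  In the approach region [|z0|] is small compared with
    [s] once [y] is small, because [f] vanishes to infinite order.

    Upper bounds for evaluations.  A box of sides comparable with [s] and [y] about
    [p] lies in the domain, since there [F <= y^2] ([box_Omega]); Cauchy estimates on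
    it bound [h] and its derivatives by the norm ([A2_eval], [cpartial0_le]).

    Lower bounds.  The functions [k = exp (i t0 w) / (w - conj w0)^3], [(z - z0) k]
    and [(w - w0) k / (w - conj w0)] have norms of the same size as if they lived on
    that box ([test0], [test1], [test2]): where [|z| <= sigma s] the integral over
    [z] contributes the area, and where [|z| > sigma s] the domain lies above the
    height [sqrt y], so that the contribution is of lower order ([weight_le]).

    What precedes this is the theory of the Bergman metric itself.  One variable
    complex analysis is derived from Goursat's theorem for rectangles; it gives the
    area mean bound [normc2_le_integral4] and Taylor bounds with sup norm constants
    ([taylor2]).  From these the Bergman space is complete ([A2_complete]), and
    evaluations and derivatives have representing elements ([A2_riesz], [reprP]),
    which are differentiable in norm as functions of the base point
    ([repr_taylor]).  The complex Hessian of [ln K] is then an expression in inner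
    products of representing elements ([bergman_metricE]), and the extremal
    characterization follows ([bergman_metric_le], [bergman_metric_ge]). *)

(** * Norm and topology of the complex plane *)

Section ComplexPlane.
Context {R : realType}.
Implicit Types (z w c : R[i]) (x y a b : R).

Lemma normcE' z : normc z = Num.sqrt ((complex.Re z) ^+ 2 + (complex.Im z) ^+ 2).
Proof. by case: z. Qed.

Lemma norm_normc z : `|z : R[i]^o| = (normc z)%:C.
Proof. by case: z. Qed.

Lemma normc_ge0 z : 0 <= normc z.
Proof. by rewrite normcE' sqrtr_ge0. Qed.

Lemma normc_gt0 z : (0 < normc z) = (z != 0).
Proof.
rewrite lt_def normc_ge0 andbT; apply/idP/idP; apply: contra => /eqP.
  by move=> ->; rewrite normc0.
by move/eq0_normc ->.
Qed.

Lemma normc_sqrE z : normc z ^+ 2 = (complex.Re z) ^+ 2 + (complex.Im z) ^+ 2.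
Proof. by rewrite normcE' sqr_sqrtr // addr_ge0 // sqr_ge0. Qed.

Lemma normc_ge_absRe z : `|complex.Re z| <= normc z.
Proof.
by rewrite -(@ler_pXn2r _ 2) ?nnegrE ?normc_ge0 // normc_sqrE real_normK ?num_real // lerDl sqr_ge0.
Qed.

Lemma normc_ge_absIm z : `|complex.Im z| <= normc z.
Proof.
by rewrite -(@ler_pXn2r _ 2) ?nnegrE ?normc_ge0 // normc_sqrE real_normK ?num_real // lerDr sqr_ge0.
Qed.

Lemma normc_real x : normc x%:C = `|x|.
Proof. by rewrite normcE' /= expr0n addr0 sqrtr_sqr. Qed.

Lemma normci : normc ('i : R[i]) = 1.
Proof. by rewrite /normc /= expr0n/= add0r expr1n sqrtr1. Qed.

Lemma ComplexE x y : x +i* y = x%:C + 'i * y%:C :> R[i].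
Proof. exact: (complexE (x +i* y)). Qed.

Lemma normc_le_ReIm z : normc z <= `|complex.Re z| + `|complex.Im z|.
Proof.
rewrite [X in normc X]complexE (le_trans (le_normcD _ _))// normcM normci mul1r.
by rewrite !normc_real.
Qed.

Lemma normcB z w : normc (z - w) = normc (w - z).
Proof. by rewrite -normcN opprB. Qed.

Lemma ler_normcB z w : normc (z - w) <= normc z + normc w.
Proof. by rewrite (le_trans (le_normcD _ _))// normcN. Qed.

Lemma ler_dist_normc z w : `|normc z - normc w| <= normc (z - w).
Proof.
have := le_normcD (z - w) w; have := le_normcD (w - z) z.
rewrite !subrK -[normc (w - z)]normcB ler_norml; lra.
Qed.

Lemma normc_conj z : normc (conjc z) = normc z.
Proof. by rewrite !normcE'; case: z => x y /=; rewrite sqrrN. Qed.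

Lemma normcX z n : normc (z ^+ n) = normc z ^+ n.
Proof. by elim: n => [|n IH]; rewrite ?expr0 ?normc1 // !exprS normcM IH. Qed.

Lemma nbhs_normcP c (P : R[i] -> Prop) :
  (\forall z \near (c : R[i]^o), P z) <->
  exists2 r : R, 0 < r & forall z, normc (z - c) < r -> P z.
Proof.
split.
  move/nbhs_ballP => [[e e']] /= /[!ltcE] /= /andP[/eqP -> e0] H.
  exists e => // z zc; apply: H; rewrite /ball /= norm_normc ltcR.
  by rewrite normcB.
move=> [r r0 H]; apply/nbhs_ballP; exists r%:C; first by rewrite /= ltcR.
move=> z; rewrite /ball /= norm_normc ltcR => zc; apply: H.
by rewrite normcB.
Qed.

Lemma cvg_normcP {T} (F : set_system T) {FF : Filter F} (g : T -> R[i]) (l : R[i]) :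
  (g x @[x --> F] --> (l : R[i]^o)) <->
  forall e : R, 0 < e -> \forall x \near F, normc (g x - l) < e.
Proof.
split.
  by move=> H e e0; apply: (H [set z | normc (z - l) < e]); apply/nbhs_normcP; exists e.
move=> H A /nbhs_normcP [r r0 rA].
by near=> x => /=; apply: rA; near: x; apply: H.
Unshelve. all: by end_near. Qed.

Lemma continuous_Re : continuous (@complex.Re R : R[i]^o -> R).
Proof.
move=> c; apply/(@cvgrPdist_lt _ _ _ (nbhs (c : R[i]^o))) => e e0; apply/nbhs_normcP; exists e => // z.
by apply: le_lt_trans; rewrite normcB -raddfB normc_ge_absRe.
Qed.

Lemma continuous_Im : continuous (@complex.Im R : R[i]^o -> R).
Proof.
move=> c; apply/(@cvgrPdist_lt _ _ _ (nbhs (c : R[i]^o))) => e e0; apply/nbhs_normcP; exists e => // z.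
by apply: le_lt_trans; rewrite normcB -raddfB normc_ge_absIm.
Qed.

Lemma continuous_normc : continuous (@normc R : R[i]^o -> R).
Proof.
move=> c; apply/(@cvgrPdist_lt _ _ _ (nbhs (c : R[i]^o))) => e e0; apply/nbhs_normcP; exists e => // z.
by apply: le_lt_trans; rewrite normcB ler_dist_normc.
Qed.

Lemma continuous_Complex {T : topologicalType} (u v : T -> R) t :
  {for t, continuous u} -> {for t, continuous v} ->
  {for t, continuous (fun t => (u t +i* v t) : R[i]^o)}.
Proof.
move=> cu cv; apply/cvg_normcP => e e0.
have e2 : 0 < e / 2 by rewrite divr_gt0.
move: cu cv => /cvgrPdist_lt/(_ _ e2) us /cvgrPdist_lt/(_ _ e2) vs.
apply: filterS2 us vs => s us vs; apply: (le_lt_trans (normc_le_ReIm _)).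
by rewrite /= [X in X + _]distrC [X in _ + X]distrC; lra.
Qed.

End ComplexPlane.

Arguments normc : simpl never.

(** * Integrals of complex functions over segments and boundaries of rectangles *)

Section ComplexIntegral.
Context {R : realType}.
Implicit Types (a b c d x y : R) (phi psi : R -> R[i]).
Local Notation mu := (@lebesgue_measure R).

Definition cint a b phi : R[i] :=
  (\int[mu]_(x in `[a, b]) complex.Re (phi x)) +i*
  (\int[mu]_(x in `[a, b]) complex.Im (phi x)).

Definition continuous_on a b phi :=
  forall x, a <= x <= b -> {for x, continuous (phi : R -> R[i]^o)}.

Lemma continuous_onB a b phi psi : continuous_on a b phi ->
  continuous_on a b psi -> continuous_on a b (fun x => phi x - psi x).
Proof. by move=> f g x xab; apply: continuousB; [exact: f|exact: g]. Qed.

Lemma sub_continuous_on a b a' b' phi : a <= a' -> b' <= b ->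
  continuous_on a b phi -> continuous_on a' b' phi.
Proof.
move=> aa' bb' H x /andP[ax xb]; apply: H.
by rewrite (le_trans aa' ax) (le_trans xb bb').
Qed.

Lemma integrable_real a b (f : R -> R) :
  (forall x, a <= x <= b -> {for x, continuous f}) ->
  mu.-integrable `[a, b] (EFin \o f).
Proof.
move=> H; apply: continuous_compact_integrable; first exact: segment_compact.
by apply: continuous_in_subspaceT => x; rewrite inE/= in_itv/= => /H.
Qed.

Lemma integrable_Re a b phi : continuous_on a b phi ->
  mu.-integrable `[a, b] (EFin \o (fun x => complex.Re (phi x))).
Proof.
move=> H; apply: integrable_real => x xab.
apply: (@continuous_comp _ _ _ (phi : R -> R[i]^o) (@complex.Re R)); first exact: H.
exact: continuous_Re.
Qed.

Lemma integrable_Im a b phi : continuous_on a b phi ->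
  mu.-integrable `[a, b] (EFin \o (fun x => complex.Im (phi x))).
Proof.
move=> H; apply: integrable_real => x xab.
apply: (@continuous_comp _ _ _ (phi : R -> R[i]^o) (@complex.Im R)); first exact: H.
exact: continuous_Im.
Qed.

Lemma integrable_normc a b phi : continuous_on a b phi ->
  mu.-integrable `[a, b] (EFin \o (fun x => normc (phi x))).
Proof.
move=> H; apply: integrable_real => x xab.
apply: (@continuous_comp _ _ _ (phi : R -> R[i]^o) (@normc R)); first exact: H.
exact: continuous_normc.
Qed.

Lemma eq_cint a b phi psi : (forall x, a <= x <= b -> phi x = psi x) ->
  cint a b phi = cint a b psi.
Proof.
move=> H; rewrite /cint; congr (_ +i* _); apply: eq_Rintegral => x;
by rewrite inE/= in_itv/= => /H ->.
Qed.

Lemma cintD a b phi psi : continuous_on a b phi -> continuous_on a b psi ->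
  cint a b (fun x => phi x + psi x) = cint a b phi + cint a b psi.
Proof.
move=> f g; rewrite /cint; simpc; congr (_ +i* _).
  under eq_Rintegral do rewrite raddfD/=.
  by rewrite RintegralD //; exact: integrable_Re.
under eq_Rintegral do rewrite raddfD/=.
by rewrite RintegralD //; exact: integrable_Im.
Qed.

Lemma cintB a b phi psi : continuous_on a b phi -> continuous_on a b psi ->
  cint a b (fun x => phi x - psi x) = cint a b phi - cint a b psi.
Proof.
move=> f g; rewrite /cint; simpc; congr (_ +i* _).
  under eq_Rintegral do rewrite raddfB/=.
  by rewrite RintegralB //; exact: integrable_Re.
under eq_Rintegral do rewrite raddfB/=.
by rewrite RintegralB //; exact: integrable_Im.
Qed.

Lemma cint_cst a b (k : R[i]) : a <= b -> cint a b (fun=> k) = (b - a)%:C * k.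
Proof.
move=> ab; rewrite /cint !Rintegral_cst //= lebesgue_measure_itv /= lte_fin.
have [ab'|] := ltP a b.
  by rewrite /=; case: k => k1 k2; simpc; rewrite ![_ * (b - a)]mulrC.
by rewrite le_eqVlt ltNge ab orbF => /eqP ->; rewrite !mulr0 subrr mul0r.
Qed.

Lemma cint_split a m b phi : a <= m -> m <= b -> continuous_on a b phi ->
  cint a b phi = cint a m phi + cint m b phi.
Proof.
move=> am mb H; rewrite /cint; simpc.
have S f : mu.-integrable `[a, b] (EFin \o f) -> \int[mu]_(x in `[a, b]) f x =
    \int[mu]_(x in `[a, m]) f x + \int[mu]_(x in `[m, b]) f x.
  move=> If; rewrite -(@Rintegral_itv_obnd_cbnd _ m).
    rewrite -(@Rintegral_itvB _ f (BLeft a) (BRight b) m) ?bnd_simp//.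
    by rewrite addrC subrK.
  apply: integrableS If => //; apply: subset_itvr.
  by rewrite bnd_simp.
by congr (_ +i* _); apply: S; [exact: integrable_Re|exact: integrable_Im].
Qed.

Lemma normc_cint_le_int a b phi : continuous_on a b phi ->
  normc (cint a b phi) <= 2 * \int[mu]_(x in `[a, b]) normc (phi x).
Proof.
move=> H; apply: (le_trans (normc_le_ReIm _)).
rewrite mulr_natl mulr2n; apply: lerD.
  apply: le_trans (le_normr_Rintegral _ (integrable_Re H)) _ => //.
  apply: le_Rintegral => //; first exact: integrable_abse (integrable_Re H).
    exact: integrable_normc.
  by move=> x _; exact: normc_ge_absRe.
apply: le_trans (le_normr_Rintegral _ (integrable_Im H)) _ => //.
apply: le_Rintegral => //; first exact: integrable_abse (integrable_Im H).
  exact: integrable_normc.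
by move=> x _; exact: normc_ge_absIm.
Qed.

Lemma normc_cint_le a b phi M : a <= b -> continuous_on a b phi ->
  (forall x, a <= x <= b -> normc (phi x) <= M) ->
  normc (cint a b phi) <= 2 * M * (b - a).
Proof.
move=> ab H HM; apply: (le_trans (normc_cint_le_int H)).
rewrite -mulrA ler_pM2l//.
have -> : M * (b - a) = \int[mu]_(x in `[a, b]) M.
  rewrite Rintegral_cst //= lebesgue_measure_itv /= lte_fin.
  by case: ltP => // ba; congr (_ * _); apply/eqP; rewrite subr_eq0 eq_le ba ab.
apply: le_Rintegral => //; first exact: integrable_normc.
  by apply: integrable_real => x _; exact: cvg_cst.
Qed.

End ComplexIntegral.

Arguments cint : simpl never.

Section RectangleIntegral.
Context {R : realType}.
Implicit Types (a b c d x y : R) (G H : R[i] -> R[i]).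

(** The boundary integral in the positive direction. *)
Definition rectint G a b c d : R[i] :=
  cint a b (fun x => G (x +i* c) - G (x +i* d)) +
  'i * cint c d (fun y => G (b +i* y) - G (a +i* y)).

Definition holomorphic_at G (z : R[i]) := differentiable (G : R[i]^o -> R[i]^o) (z : R[i]^o).

Definition continuous_rect G a b c d := forall x y, a <= x <= b -> c <= y <= d ->
  {for (x +i* y : R[i]^o), continuous (G : R[i]^o -> R[i]^o)}.

Definition continuous_edges G a b c d := forall x y, a <= x <= b -> c <= y <= d ->
  [|| x == a, x == b, y == c | y == d] ->
  {for (x +i* y : R[i]^o), continuous (G : R[i]^o -> R[i]^o)}.

Lemma continuous_rect_edges G a b c d :
  continuous_rect G a b c d -> continuous_edges G a b c d.
Proof. by move=> cG x y xab ycd _; exact: cG. Qed.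

Definition holomorphic_rect G a b c d := forall x y, a <= x <= b -> c <= y <= d ->
  holomorphic_at G (x +i* y).

Lemma holomorphic_continuous_rect G a b c d :
  holomorphic_rect G a b c d -> continuous_rect G a b c d.
Proof. by move=> H x y xab ycd; apply: differentiable_continuous; exact: H. Qed.

Lemma continuous_on_hor G a b c d y : continuous_rect G a b c d -> c <= y <= d ->
  continuous_on a b (fun x => G (x +i* y)).
Proof.
move=> cG ycd x xab.
apply: (@continuous_comp _ _ _ (fun x : R => (x +i* y) : R[i]^o) (G : R[i]^o -> R[i]^o)); last exact: cG.
by apply: continuous_Complex; [exact: cvg_id|exact: cvg_cst].
Qed.

Lemma continuous_on_ver G a b c d x : continuous_rect G a b c d -> a <= x <= b ->
  continuous_on c d (fun y => G (x +i* y)).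
Proof.
move=> cG xab y ycd.
apply: (@continuous_comp _ _ _ (fun y : R => (x +i* y) : R[i]^o) (G : R[i]^o -> R[i]^o)); last exact: cG.
by apply: continuous_Complex; [exact: cvg_cst|exact: cvg_id].
Qed.

Lemma sub_continuous_rect G a b c d a' b' c' d' :
  a <= a' -> b' <= b -> c <= c' -> d' <= d ->
  continuous_rect G a b c d -> continuous_rect G a' b' c' d'.
Proof.
move=> aa bb cc dd H x y /andP[x1 x2] /andP[y1 y2]; apply: H.
  by rewrite (le_trans aa x1) (le_trans x2 bb).
by rewrite (le_trans cc y1) (le_trans y2 dd).
Qed.

Lemma continuous_on_hor_edge G a b c d y : c <= d -> continuous_edges G a b c d ->
  (y == c) || (y == d) -> continuous_on a b (fun x => G (x +i* y)).
Proof.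
move=> cd cG ycd x xab.
apply: (@continuous_comp _ _ _ (fun x : R => (x +i* y) : R[i]^o) (G : R[i]^o -> R[i]^o)).
  by apply: continuous_Complex; [exact: cvg_id|exact: cvg_cst].
by apply: cG => //; [case/orP: ycd => /eqP ->; rewrite lexx cd|rewrite ycd !orbT].
Qed.

Lemma continuous_on_ver_edge G a b c d x : a <= b -> continuous_edges G a b c d ->
  (x == a) || (x == b) -> continuous_on c d (fun y => G (x +i* y)).
Proof.
move=> ab cG xab y ycd.
apply: (@continuous_comp _ _ _ (fun y : R => (x +i* y) : R[i]^o) (G : R[i]^o -> R[i]^o)).
  by apply: continuous_Complex; [exact: cvg_cst|exact: cvg_id].
apply: cG => //; first by case/orP: xab => /eqP ->; rewrite lexx ab.
by rewrite !orbA xab.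
Qed.

Lemma continuous_on_horB G a b c d : c <= d -> continuous_edges G a b c d ->
  continuous_on a b (fun x => G (x +i* c) - G (x +i* d)).
Proof.
move=> cd cG.
by apply: continuous_onB; apply: (continuous_on_hor_edge cd cG); rewrite eqxx ?orbT.
Qed.

Lemma continuous_on_verB G a b c d : a <= b -> continuous_edges G a b c d ->
  continuous_on c d (fun y => G (b +i* y) - G (a +i* y)).
Proof.
move=> ab cG.
by apply: continuous_onB; apply: (continuous_on_ver_edge ab cG); rewrite eqxx ?orbT.
Qed.

Lemma rectint_splitx G a m b c d : a <= m -> m <= b -> c <= d ->
  continuous_rect G a b c d ->
  rectint G a b c d = rectint G a m c d + rectint G m b c d.
Proof.
move=> am mb cd cG.
have ab := le_trans am mb.
have Ha y : c <= y <= d -> continuous_on a b (fun x => G (x +i* y)).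
  by move=> ?; apply: continuous_on_hor; eauto.
have Hb x : a <= x <= b -> continuous_on c d (fun y => G (x +i* y)).
  by move=> ?; apply: continuous_on_ver; eauto.
rewrite /rectint (@cint_split _ a m b)//; last first.
  by apply: continuous_onB; apply: Ha; rewrite ?lexx ?cd.
rewrite -!addrA; congr (_ + _); rewrite addrCA; congr (_ + _).
rewrite -mulrDr; congr (_ * _); rewrite -cintD; last 2 first.
- by apply: continuous_onB; apply: Hb; rewrite ?lexx ?am ?mb ?ab.
- by apply: continuous_onB; apply: Hb; rewrite ?lexx ?am ?mb ?ab.
by apply: eq_cint => y _; ring.
Qed.

Lemma rectint_splity G a b c m d : a <= b -> c <= m -> m <= d ->
  continuous_rect G a b c d ->
  rectint G a b c d = rectint G a b c m + rectint G a b m d.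
Proof.
move=> ab cm md cG.
have cd := le_trans cm md.
have Ha y : c <= y <= d -> continuous_on a b (fun x => G (x +i* y)).
  by move=> ?; apply: continuous_on_hor; eauto.
have Hb x : a <= x <= b -> continuous_on c d (fun y => G (x +i* y)).
  by move=> ?; apply: continuous_on_ver; eauto.
rewrite /rectint (@cint_split _ c m d)//; last first.
  by apply: continuous_onB; apply: Hb; rewrite ?lexx ?ab.
rewrite mulrDr addrA [RHS]addrACA addrA; congr (_ + _); congr (_ + _).
rewrite -cintD; last 2 first.
- by apply: continuous_onB; apply: Ha; rewrite ?lexx ?cm ?md ?cd.
- by apply: continuous_onB; apply: Ha; rewrite ?lexx ?cm ?md ?cd.
by apply: eq_cint => y _; ring.
Qed.

Lemma rectint_affine (k l : R[i]) a b c d : a <= b -> c <= d ->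
  rectint (fun z => k + l * z) a b c d = 0.
Proof.
move=> ab cd; rewrite /rectint.
rewrite (@eq_cint _ _ _ _ (fun=> l * ('i * (c - d)%:C))); last first.
  move=> x _; rewrite !ComplexE rmorphB; ring.
rewrite (@eq_cint _ c d _ (fun=> l * (b - a)%:C)); last first.
  move=> y _; rewrite !ComplexE rmorphB; ring.
by rewrite !cint_cst// !rmorphB; ring.
Qed.

Lemma rectintB G H a b c d : a <= b -> c <= d ->
  continuous_edges G a b c d -> continuous_edges H a b c d ->
  rectint (fun z => G z - H z) a b c d = rectint G a b c d - rectint H a b c d.
Proof.
move=> ab cd cG cH; rewrite /rectint opprD addrACA -mulrBr.
rewrite -(cintB (continuous_on_horB cd cG) (continuous_on_horB cd cH)).
rewrite -(cintB (continuous_on_verB ab cG) (continuous_on_verB ab cH)).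
by congr (_ + 'i * _); apply: eq_cint => x _; ring.
Qed.

Lemma normc_rectint_le G a b c d M : a <= b -> c <= d ->
  continuous_edges G a b c d ->
  (forall x y, a <= x <= b -> c <= y <= d ->
     [|| x == a, x == b, y == c | y == d] -> normc (G (x +i* y)) <= M) ->
  normc (rectint G a b c d) <= 4 * M * ((b - a) + (d - c)).
Proof.
move=> ab cd cG HM.
have cc : c <= c <= d by rewrite lexx.
have dd : c <= d <= d by rewrite lexx cd.
have aa : a <= a <= b by rewrite lexx.
have bb : a <= b <= b by rewrite lexx ab.
have E1 : normc (cint a b (fun x => G (x +i* c) - G (x +i* d))) <= 2 * (2 * M) * (b - a).
  apply: normc_cint_le => //; first exact: continuous_on_horB.
  move=> x xab; apply: (le_trans (ler_normcB _ _)).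
  have := HM x c xab cc; have := HM x d xab dd; rewrite !eqxx !orbT => /(_ isT) + /(_ isT).
  lra.
have E2 : normc (cint c d (fun y => G (b +i* y) - G (a +i* y))) <= 2 * (2 * M) * (d - c).
  apply: normc_cint_le => //; first exact: continuous_on_verB.
  move=> x xab; apply: (le_trans (ler_normcB _ _)).
  have := HM a x aa xab; have := HM b x bb xab; rewrite !eqxx !orbT => /(_ isT) + /(_ isT).
  lra.
apply: (le_trans (le_normcD _ _)); rewrite normcM normci mul1r.
lra.
Qed.

End RectangleIntegral.

Arguments rectint : simpl never.

(** * Goursat's theorem for rectangles *)

Section Goursat.
Context {R : realType}.
Implicit Types (a b c d x y : R) (G H : R[i] -> R[i]) (z w : R[i]).

Definition has_cderiv G z l := forall e : R, 0 < e -> exists2 r : R, 0 < r &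
  forall w, normc (w - z) < r -> normc (G w - G z - l * (w - z)) <= e * normc (w - z).

(** Complex differentiability of a function of one variable is used in this
    epsilon form, whose remainder can be integrated along a boundary and
    compared between functions. *)
Lemma holomorphic_atP G z : holomorphic_at G z <-> exists l, has_cderiv G z l.
Proof.
rewrite /holomorphic_at; split.
  move=> /derivable1_diffP /cvg_ex[l /cvg_normcP Hl]; exists l => e e0.
  have := Hl e e0; rewrite near_withinE => /nbhs_normcP [r r0 H0].
  have H h : normc h < r -> h != 0 -> normc (h^-1 * (G (h + z) - G z) - l) < e.
    have := H0 h; rewrite subr0 => /[apply] /[apply].
    by rewrite (_ : h%:A = h)//; exact: mulr1.
  exists r => // w wz; have [->|wz0] := eqVneq w z.
    by rewrite !subrr mulr0 subr0 normc0 mulr0.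
  have := H (w - z); rewrite subr_eq0 => /(_ wz wz0) /ltW; rewrite subrK => L.
  have wz0' : w - z != 0 by rewrite subr_eq0.
  have -> : G w - G z - l * (w - z) = ((w - z)^-1 * (G w - G z) - l) * (w - z).
    by field.
  by rewrite normcM ler_wpM2r // normc_ge0.
move=> [l Hl]; apply/derivable1_diffP/cvg_ex; exists l; apply/cvg_normcP => e e0.
rewrite near_withinE; apply/nbhs_normcP.
have e2 : 0 < e / 2 by rewrite divr_gt0.
have [r r0 H] := Hl _ e2; exists r => // h; rewrite subr0 => hr h0.
have := H (h + z); rewrite addrK => /(_ hr) L.
rewrite (_ : h%:A = h); last exact: mulr1.
rewrite -[X in X - l]/(h^-1 * (G (h + z) - G z)).
have hn : 0 < normc h by rewrite normc_gt0.
have -> : h^-1 * (G (h + z) - G z) - l = (G (h + z) - G z - l * h) / h by field.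
rewrite normcM normcV ltr_pdivrMr // (le_lt_trans L) // ltr_pM2r //.
by rewrite gtr_pMr // invf_lt1 // ltr1n.
Qed.

Lemma holomorphic_affine k l z : holomorphic_at (fun z => k + l * z) z.
Proof.
apply/holomorphic_atP; exists l => e e0; exists 1 => // w _.
have -> : k + l * w - (k + l * z) - l * (w - z) = 0 by ring.
by rewrite normc0 mulr_ge0 ?normc_ge0// ltW.
Qed.

(** The integrals over the four quarters add up to the integral over the
    rectangle, so one of them carries at least a quarter of it. *)
Lemma quarter_rect G a b c d : a <= b -> c <= d -> continuous_rect G a b c d ->
  exists q : R * R * R * R, let: (a', b', c', d') := q in
   [/\ a <= a' /\ b' <= b, c <= c' /\ d' <= d, b' - a' = (b - a) / 2,
     d' - c' = (d - c) / 2 &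
     normc (rectint G a b c d) <= 4 * normc (rectint G a' b' c' d')].
Proof.
move=> ab cd cG.
have mid u v : u <= v -> exists m : R,
    [/\ u <= m, m <= v, m - u = (v - u) / 2 & v - m = (v - u) / 2].
  by move=> uv; exists ((u + v) / 2); split; lra.
have [m [am mb ma bm]] := mid _ _ ab; have [n [cn nd nc dn]] := mid _ _ cd.
have E : rectint G a b c d = rectint G a m c n + rectint G a m n d +
    (rectint G m b c n + rectint G m b n d).
  rewrite (rectint_splitx am mb cd cG); congr (_ + _).
    by apply: rectint_splity => //; apply: sub_continuous_rect cG.
  by apply: rectint_splity => //; apply: sub_continuous_rect cG.
have T : normc (rectint G a b c d) <= normc (rectint G a m c n) +
    normc (rectint G a m n d) + (normc (rectint G m b c n) + normc (rectint G m b n d)).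
  by rewrite E (le_trans (le_normcD _ _))// lerD // le_normcD.
have [|l1] := leP (normc (rectint G a b c d)) (4 * normc (rectint G a m c n)).
  by exists (a, m, c, n); split.
have [|l2] := leP (normc (rectint G a b c d)) (4 * normc (rectint G a m n d)).
  by exists (a, m, n, d); split.
have [|l3] := leP (normc (rectint G a b c d)) (4 * normc (rectint G m b c n)).
  by exists (m, b, c, n); split.
exists (m, b, n, d); split => //.
have key (t p q r s : R) : t <= p + q + (r + s) -> 4 * p < t -> 4 * q < t ->
  4 * r < t -> t <= 4 * s by clear; lra.
exact: key T l1 l2 l3.
Qed.

(** The affine part of [G] has an integral over a closed path that vanishes;
    what remains is of first order in the diameter, on a path whose length is of
    the same order. *)
Lemma rectint_cderiv_le G a b c d x y l e : a <= x <= b -> c <= y <= d ->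
  continuous_rect G a b c d -> 0 < e ->
  (forall z, normc (z - (x +i* y)) <= (b - a) + (d - c) ->
    normc (G z - G (x +i* y) - l * (z - (x +i* y))) <= e * normc (z - (x +i* y))) ->
  normc (rectint G a b c d) <= 4 * e * ((b - a) + (d - c)) ^+ 2.
Proof.
move=> /andP[ax xb] /andP[cy yd] cG e0 H.
have ab := le_trans ax xb; have cd := le_trans cy yd.
pose aff z := (G (x +i* y) - l * (x +i* y)) + l * z.
have ca : continuous_rect aff a b c d.
  by move=> s t _ _; apply: differentiable_continuous; exact: holomorphic_affine.
have -> : rectint G a b c d = rectint (fun z => G z - aff z) a b c d.
  by rewrite rectintB ?rectint_affine ?subr0 //; exact: continuous_rect_edges.
have -> : 4 * e * ((b - a) + (d - c)) ^+ 2 =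
  4 * (e * ((b - a) + (d - c))) * ((b - a) + (d - c)) by ring.
apply: (@normc_rectint_le _ (fun z => G z - aff z) _ _ _ _ _ ab cd); first apply: continuous_rect_edges.
  by move=> s t sab tcd; apply: continuousB; [exact: cG|exact: ca].
move=> s t /andP[as_ sb] /andP[ct td] _.
have st : normc ((s +i* t) - (x +i* y)) <= (b - a) + (d - c).
  apply: (le_trans (normc_le_ReIm _)).
  by apply: lerD; rewrite /= ler_norml; apply/andP; split; lra.
have -> : G (s +i* t) - aff (s +i* t) =
   G (s +i* t) - G (x +i* y) - l * ((s +i* t) - (x +i* y)) by rewrite /aff; ring.
by apply: (le_trans (H _ st)); rewrite ler_pM2l.
Qed.

(** Bisection: quartering loses a factor 4 in the integral at each step, while
    the estimate near the common point of the nested rectangles gains the square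
    of the ratio of the sides, which is also 4, times an arbitrarily small [e]. *)
Theorem goursat G a b c d : a <= b -> c <= d -> holomorphic_rect G a b c d ->
  rectint G a b c d = 0.
Proof.
move=> ab cd hG.
pose valid (q : R * R * R * R) := let: (a', b', c', d') := q in
  [/\ a <= a', b' <= b, c <= c' & d' <= d] /\ a' <= b' /\ c' <= d'.
pose I (q : R * R * R * R) := let: (a', b', c', d') := q in rectint G a' b' c' d'.
pose next (q q' : R * R * R * R) :=
  [/\ q.1.1.1 <= q'.1.1.1 /\ q'.1.1.2 <= q.1.1.2, q.1.2 <= q'.1.2 /\ q'.2 <= q.2,
    q'.1.1.2 - q'.1.1.1 = (q.1.1.2 - q.1.1.1) / 2,
    q'.2 - q'.1.2 = (q.2 - q.1.2) / 2 & normc (I q) <= 4 * normc (I q')].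
have /choice[f Hf] : forall q, exists q', valid q -> next q q'.
  move=> [[[a1 b1] c1] d1]; have [v|nv] := pselect (valid (a1, b1, c1, d1)); last first.
    by exists (a1, b1, c1, d1).
  move: (v) => [[aa1 bb1 cc1 dd1] [ab1 cd1]].
  have cG : continuous_rect G a1 b1 c1 d1.
    apply: sub_continuous_rect (holomorphic_continuous_rect hG) => //.
  by have [[[[a2 b2] c2] d2] H] := quarter_rect ab1 cd1 cG; exists (a2, b2, c2, d2).
pose q n := iter n f (a, b, c, d).
have vq n : valid (q n).
  elim: n => [|n]; first by rewrite /q/= !lexx.
  rewrite /q iterS -/(q n) => v; have := Hf _ v; move: v.
  case: (q n) => [[[a1 b1] c1] d1]; case: (f _) => [[[a2 b2] c2] d2].
  rewrite /valid /next /= => -[[? ? ? ?] [? ?]] [[? ?] [? ?] ? ? _].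
  by split; [split|]; lra.
have nq n : next (q n) (q n.+1) by apply: Hf.
pose A n := (q n).1.1.1; pose B n := (q n).1.1.2.
pose C n := (q n).1.2; pose D n := (q n).2.
have qE n : q n = (A n, B n, C n, D n) by rewrite /A/B/C/D; case: (q n) => [[[]]].
have szAB n : B n - A n = (b - a) / 2 ^+ n.
  elim: n => [|n IH]; first by rewrite expr0 divr1.
  by have [_ _ -> _ _] := nq n; rewrite -/(A n) -/(B n) IH exprS; field.
have szCD n : D n - C n = (d - c) / 2 ^+ n.
  elim: n => [|n IH]; first by rewrite expr0 divr1.
  by have [_ _ _ -> _] := nq n; rewrite -/(C n) -/(D n) IH exprS; field.
have szI n : normc (rectint G a b c d) <= 4 ^+ n * normc (I (q n)).
  elim: n => [|n IH]; first by rewrite expr0 mul1r.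
  apply: (le_trans IH); rewrite exprSr -mulrA ler_pM2l ?exprn_gt0//.
  by have [] := nq n.
have AB n : A n <= B n by have := vq n; rewrite qE /= => -[_ []].
have CD n : C n <= D n by have := vq n; rewrite qE /= => -[_ []].
have nest (u v : nat -> R) : (forall n, u n <= u n.+1) -> (forall n, v n.+1 <= v n) ->
   (forall n, u n <= v n) -> exists x, forall n, u n <= x <= v n.
  move=> uS vS uv.
  have um m n : (m <= n)%N -> u m <= u n.
    by move/subnK <-; elim: (n - m)%N => // k IH; rewrite addSn (le_trans IH).
  have vm m n : (m <= n)%N -> v n <= v m.
    by move/subnK <-; elim: (n - m)%N => // k IH; rewrite addSn (le_trans _ IH).
  have ub n : ubound (range u) (v n).
    move=> _ [m _ <-]; apply: (le_trans (um _ _ (leq_maxl m n))).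
    by apply: (le_trans (uv _)); apply: vm; rewrite leq_maxr.
  exists (sup (range u)) => n; apply/andP; split.
    by apply: ub_le_sup; [exists (v 0%N); exact: ub|exists n].
  by apply: ge_sup => //; exists (u 0%N), 0%N.
have [x xAB] : exists x, forall n, A n <= x <= B n.
  by apply: nest => // n; have [[]] := nq n.
have [y yCD] : exists y, forall n, C n <= y <= D n.
  by apply: nest => // n; have [_ []] := nq n.
have /holomorphic_atP [l Hl] : holomorphic_at G (x +i* y).
  by apply: hG; [exact: (xAB 0%N)|exact: (yCD 0%N)].
pose L := (b - a) + (d - c).
have L0 : 0 <= L by rewrite /L; lra.
apply/eq0_normc/eqP; rewrite eq_le normc_ge0 andbT; apply/ler_addgt0Pr => eps eps0.
rewrite add0r.
pose e := eps / (4 * L ^+ 2 + 1).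
have K0 : 0 < 4 * L ^+ 2 + 1 by rewrite ltr_wpDl // mulr_ge0 // exprn_ge0.
have e0 : 0 < e by rewrite divr_gt0.
have [r r0 Hr] := Hl _ e0.
have [n Ln] : exists n, L / 2 ^+ n < r.
  have [n] : exists n, L / r < 2 ^+ n.
    exists (Num.bound (L / r)); apply: (lt_le_trans (archi_boundP _)).
      by rewrite divr_ge0 // ltW.
    by rewrite -natrX ler_nat ltnW // ltn_expl.
  move=> H; exists n; rewrite ltr_pdivrMr ?exprn_gt0// mulrC.
  by rewrite -ltr_pdivrMr.
apply: (le_trans (szI n)).
have Ls : L / 2 ^+ n = (B n - A n) + (D n - C n) by rewrite /L mulrDl szAB szCD.
have H : normc (I (q n)) <= 4 * e * (L / 2 ^+ n) ^+ 2.
  rewrite qE Ls.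
  apply: (@rectint_cderiv_le G (A n) (B n) (C n) (D n) x y l) => //.
    have := vq n; rewrite qE => -[[? ? ? ?] _].
    by apply: sub_continuous_rect (holomorphic_continuous_rect hG).
  by move=> z; rewrite -Ls => zL; apply/Hr/(le_lt_trans zL).
apply: le_trans (ler_wpM2l _ H) _; first by rewrite exprn_ge0.
have -> : (4 : R) ^+ n = 2 ^+ n * 2 ^+ n by rewrite -exprMn; congr (_ ^+ _); lra.
have P0 : (2 : R) ^+ n != 0 by rewrite expf_neq0.
have -> : 2 ^+ n * 2 ^+ n * (4 * e * (L / 2 ^+ n) ^+ 2) = e * (4 * L ^+ 2).
  by field.
rewrite /e mulrAC ler_pdivrMr //; apply: ler_wpM2l; first exact: ltW.
by rewrite lerDl.
Qed.

End Goursat.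

(** * Residues at simple poles *)

Section Residue.
Context {R : realType}.
Implicit Types (a b c d x y r e : R) (G H : R[i] -> R[i]) (z w : R[i]).

Lemma rectintZ (k : R[i]) G a b c d : a <= b -> c <= d -> continuous_edges G a b c d ->
  rectint (fun z => k * G z) a b c d = k * rectint G a b c d.
Proof.
move=> ab cd cG.
have L u v phi : continuous_on u v phi ->
    cint u v (fun x => k * phi x) = k * cint u v phi.
  move=> cp; have Ir := integrable_Re cp; have Ii := integrable_Im cp.
  have Z (f : R -> R) (t : R) : (@lebesgue_measure R).-integrable `[u, v] (EFin \o f) ->
    (@lebesgue_measure R).-integrable `[u, v] (EFin \o (fun x => t * f x)).
    by move=> If; apply: (integrableZl _ t If).
  case: k => k1 k2; rewrite /cint; simpc; congr (_ +i* _).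
    rewrite -!RintegralZl// -RintegralB//; try exact: Z.
    by apply: eq_Rintegral => x _ /=; case: (phi x).
  rewrite -!RintegralZl// -RintegralD//; try exact: Z.
  by apply: eq_Rintegral => x _ /=; case: (phi x).
rewrite /rectint mulrDr mulrCA -!L; [|exact: continuous_on_verB|exact: continuous_on_horB].
by congr (_ + 'i * _); apply: eq_cint => x _; rewrite mulrBr.
Qed.

Lemma rectint_edges G a b c d : a <= b -> c <= d -> continuous_edges G a b c d ->
  rectint G a b c d =
    cint a b (fun x => G (x +i* c)) - cint a b (fun x => G (x +i* d)) +
    'i * (cint c d (fun y => G (b +i* y)) - cint c d (fun y => G (a +i* y))).
Proof.
move=> ab cd cG; rewrite -!cintB //.
- by apply: (continuous_on_ver_edge ab cG); rewrite eqxx ?orbT.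
- by apply: (continuous_on_ver_edge ab cG); rewrite eqxx ?orbT.
- by apply: (continuous_on_hor_edge cd cG); rewrite eqxx ?orbT.
- by apply: (continuous_on_hor_edge cd cG); rewrite eqxx ?orbT.
Qed.

Definition inside (p : R[i]) a b c d :=
  [/\ a < complex.Re p, complex.Re p < b, c < complex.Im p & complex.Im p < d].

Definition holomorphic_punctured G (p : R[i]) a b c d := forall x y,
  a <= x <= b -> c <= y <= d -> (x +i* y) != p -> holomorphic_at G (x +i* y).

Lemma punctured_edges G p a b c d : inside p a b c d ->
  holomorphic_punctured G p a b c d -> continuous_edges G a b c d.
Proof.
move=> [ap pb cp pd] hG x y xr yr bd; apply: differentiable_continuous; apply: hG => //.
apply/eqP => E; move: ap pb cp pd; rewrite -E /= => ax xb cy yd.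
by move: bd; rewrite (gt_eqF ax) (lt_eqF xb) (gt_eqF cy) (lt_eqF yd).
Qed.

Lemma sub_holomorphic_punctured G p a b c d a' b' c' d' :
  a <= a' -> b' <= b -> c <= c' -> d' <= d ->
  holomorphic_punctured G p a b c d -> holomorphic_punctured G p a' b' c' d'.
Proof.
move=> aa bb cc dd H x y /andP[x1 x2] /andP[y1 y2]; apply: H.
  by rewrite (le_trans aa x1) (le_trans x2 bb).
by rewrite (le_trans cc y1) (le_trans y2 dd).
Qed.

(** The difference of the two boundaries bounds four rectangles that avoid
    [p], and Goursat applies to each. *)
Lemma rectint_annulus G p a b c d a' b' c' d' : inside p a' b' c' d' ->
  a <= a' -> b' <= b -> c <= c' -> d' <= d ->
  holomorphic_punctured G p a b c d ->
  rectint G a b c d = rectint G a' b' c' d'.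
Proof.
move=> ins aa bb cc dd hG; case: (ins) => ap pb cp pd.
have [ab' cd'] : a' <= b' /\ c' <= d' by split; lra.
have [ab cd] : a <= b /\ c <= d by split; lra.
have [ba' ab''] : a' <= b /\ a <= b' by split; lra.
have [dc' cd''] : c' <= d /\ c <= d' by split; lra.
have ins' : inside p a b c d by split; lra.
have offx x y : a <= x <= b -> c <= y <= d -> (x <= a') || (b' <= x) ->
    holomorphic_at G (x +i* y).
  move=> xr yr xs; apply: hG => //; apply/eqP => E; move: ap pb xs.
  by rewrite -E /= => ? ?; lra.
have offy x y : a <= x <= b -> c <= y <= d -> (y <= c') || (d' <= y) ->
    holomorphic_at G (x +i* y).
  move=> xr yr ys; apply: hG => //; apply/eqP => E; move: cp pd ys.
  by rewrite -E /= => ? ?; lra.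
have hT : holomorphic_rect G a b d' d.
  by move=> x y xx yy; apply: offy => //; clear -xx yy cd''; lra.
have hB : holomorphic_rect G a b c c'.
  by move=> x y xx yy; apply: offy => //; clear -xx yy dc'; lra.
have hL : holomorphic_rect G a a' c' d'.
  by move=> x y xx yy; apply: offx => //; clear -xx yy ba' cc dd; lra.
have hR : holomorphic_rect G b' b c' d'.
  by move=> x y xx yy; apply: offx => //; clear -xx yy ab'' cc dd; lra.
have := goursat ab dd hT; have := goursat ab cc hB.
have := goursat aa cd' hL; have := goursat bb cd' hR.
have cT := continuous_rect_edges (holomorphic_continuous_rect hT).
have cB := continuous_rect_edges (holomorphic_continuous_rect hB).
have cL := continuous_rect_edges (holomorphic_continuous_rect hL).
have cR := continuous_rect_edges (holomorphic_continuous_rect hR).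
have hG' := sub_holomorphic_punctured aa bb cc dd hG.
rewrite (rectint_edges ab dd cT) (rectint_edges ab cc cB).
rewrite (rectint_edges aa cd' cL) (rectint_edges bb cd' cR).
rewrite (rectint_edges ab cd (punctured_edges ins' hG)).
rewrite (rectint_edges ab' cd' (punctured_edges ins hG')).
have hd' : continuous_on a b (fun x => G (x +i* d')).
  by apply: (continuous_on_hor_edge dd cT); rewrite eqxx.
have hc' : continuous_on a b (fun x => G (x +i* c')).
  by apply: (continuous_on_hor_edge cc cB); rewrite eqxx orbT.
have va : continuous_on c d (fun y => G (a +i* y)).
  by apply: (continuous_on_ver_edge ab (punctured_edges ins' hG)); rewrite eqxx.
have vb : continuous_on c d (fun y => G (b +i* y)).
  by apply: (continuous_on_ver_edge ab (punctured_edges ins' hG)); rewrite eqxx orbT.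
have split3 (u u' v' v : R) phi : u <= u' -> u' <= v' -> v' <= v ->
    continuous_on u v phi ->
    cint u v phi = cint u u' phi + (cint u' v' phi + cint v' v phi).
  move=> uu uv vv cph; have vv' : u' <= v by lra.
  rewrite (cint_split uu vv' cph); congr (_ + _).
  by apply: cint_split => //; apply: sub_continuous_on cph.
rewrite (split3 a a' b' b _ aa ab' bb hd') (split3 a a' b' b _ aa ab' bb hc').
rewrite (split3 c c' d' d _ cc cd' dd va) (split3 c c' d' d _ cc cd' dd vb).
have sum4 (l1 l2 l3 l4 k l : R[i]) : l1 = 0 -> l2 = 0 -> l3 = 0 -> l4 = 0 ->
  k = l1 + l2 + l3 + l4 + l -> k = l by move=> -> -> -> -> ->; rewrite !addr0 add0r.
move=> E1 E2 E3 E4; apply: (sum4 _ _ _ _ _ _ E1 E2 E3 E4); ring.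
Qed.

(** The contour can be shrunk to a small square about [p], on which [G] is at
    most [e] divided by the side. *)
Lemma rectint_removable G p a b c d : inside p a b c d ->
  holomorphic_punctured G p a b c d ->
  (forall e, 0 < e -> exists2 s, 0 < s & forall z, z != p -> normc (z - p) < s ->
     normc ((z - p) * G z) <= e) -> rectint G a b c d = 0.
Proof.
move=> ins hG Gs; apply/eq0_normc/eqP; rewrite eq_le normc_ge0 andbT.
apply/ler_addgt0Pr => e e0; rewrite add0r.
have e16 : 0 < e / 16 by rewrite divr_gt0.
have [s s0 Hs] := Gs _ e16.
move: (p) ins hG Hs => [p1 p2] ins hG Hs; case: (ins) => /= ap pb cp pd.
have [t [t0 ts [t1 t2 t3 t4]]] : exists t, [/\ 0 < t, t <= s / 4 &
    [/\ a <= p1 - t, p1 + t <= b, c <= p2 - t & p2 + t <= d]].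
  pose t := Num.min (s / 4) (Num.min (Num.min (p1 - a) (b - p1)) (Num.min (p2 - c) (d - p2))).
  exists t; split.
  - by rewrite !lt_min divr_gt0//= !subr_gt0 ap pb cp pd.
  - by rewrite ge_min lexx.
  have [u1 u2 u3 u4] : [/\ t <= p1 - a, t <= b - p1, t <= p2 - c & t <= d - p2].
    by rewrite /t; split; rewrite !ge_min lexx ?orbT.
  by clearbody t; split; lra.
have ins' : inside (p1 +i* p2) (p1 - t) (p1 + t) (p2 - t) (p2 + t).
  by split => /=; rewrite ?gtrBl ?ltrDl.
rewrite (rectint_annulus ins' t1 t2 t3 t4 hG).
have -> : e = 4 * (e / 16 / t) * ((p1 + t - (p1 - t)) + (p2 + t - (p2 - t))).
  by field; rewrite gt_eqF.
have hG' := sub_holomorphic_punctured t1 t2 t3 t4 hG.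
have [q1 q2] : p1 - t <= p1 + t /\ p2 - t <= p2 + t by clear -t0; split; lra.
apply: (normc_rectint_le q1 q2); first exact: punctured_edges ins' hG'.
move=> x y xt yt bd.
have zE : (x +i* y) - (p1 +i* p2) = (x - p1) +i* (y - p2) by [].
have lt1 : t <= normc ((x +i* y) - (p1 +i* p2)).
  case/or4P: bd => /eqP E.
  - apply: le_trans (normc_ge_absRe _); rewrite zE /= E.
    by rewrite (_ : p1 - t - p1 = - t) ?normrN ?ger0_norm // ?ltW//; ring.
  - apply: le_trans (normc_ge_absRe _); rewrite zE /= E.
    by rewrite (_ : p1 + t - p1 = t) ?ger0_norm // ?ltW//; ring.
  - apply: le_trans (normc_ge_absIm _); rewrite zE /= E.
    by rewrite (_ : p2 - t - p2 = - t) ?normrN ?ger0_norm // ?ltW//; ring.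
  - apply: le_trans (normc_ge_absIm _); rewrite zE /= E.
    by rewrite (_ : p2 + t - p2 = t) ?ger0_norm // ?ltW//; ring.
have lt2 : normc ((x +i* y) - (p1 +i* p2)) < s.
  rewrite zE; apply: (le_lt_trans (normc_le_ReIm _)); rewrite /=.
  have : `|x - p1| <= t by rewrite ler_distlC; lra.
  have : `|y - p2| <= t by rewrite ler_distlC; lra.
  by move: s0 ts; clear; lra.
have z0 : x +i* y != p1 +i* p2 by rewrite -subr_eq0 -normc_gt0 (lt_le_trans t0).
rewrite ler_pdivlMr// mulrC; apply: le_trans (Hs _ z0 lt2).
by rewrite normcM ler_wpM2r ?normc_ge0.
Qed.

Lemma inside_square (p : R[i]) r : 0 < r ->
  inside p (complex.Re p - r) (complex.Re p + r) (complex.Im p - r) (complex.Im p + r).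
Proof. by move=> r0; split; rewrite ?gtrBl ?ltrDl. Qed.

Lemma holomorphic_inv_sub (p z : R[i]) : z != p -> holomorphic_at (fun z => (z - p)^-1) z.
Proof.
move=> zp; apply: (@differentiableV _ _ (fun z : R[i]^o => z - p)).
  by apply: differentiableB => //; exact: differentiable_cst.
by rewrite subr_eq0.
Qed.

(** Replacing the exact value [2 i pi] by the lower bound 4 avoids
    the arctangent: along each side the relevant part of [1 / (z - p)] is
    [r / (x^2 + r^2)], which is at least [1 / (2 r)]. *)
Lemma rectint_inv_square (p : R[i]) r : 0 < r ->
  4 <= normc (rectint (fun z => (z - p)^-1) (complex.Re p - r) (complex.Re p + r)
    (complex.Im p - r) (complex.Im p + r)).
Proof.
move=> r0; apply: le_trans (normc_ge_absIm _); apply: le_trans (ler_norm _).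
have hinv : holomorphic_punctured (fun z : R[i] => (z - p)^-1) p (complex.Re p - r)
   (complex.Re p + r) (complex.Im p - r) (complex.Im p + r).
  by move=> x y _ _ z0; exact: holomorphic_inv_sub.
have cE := punctured_edges (inside_square p r0) hinv.
move: p hinv cE => [p1 p2] /= hinv cE.
have rr q : q - r <= q + r by lra.
have I2 q : \int[lebesgue_measure]_(x in `[q - r, q + r]) (r^-1) = 2 :> R.
  rewrite Rintegral_cst //= lebesgue_measure_itv /= lte_fin.
  by rewrite (_ : (q - r < q + r) = true) /=; [field; rewrite gt_eqF|lra].
have Ic q : (@lebesgue_measure R).-integrable `[q - r, q + r] (EFin \o (fun=> r^-1)).
  by apply: integrable_real => x _; exact: cvg_cst.
have key q x : q - r <= x <= q + r ->
    r^-1 <= r / ((x - q) ^+ 2 + r ^+ 2) + r / ((x - q) ^+ 2 + r ^+ 2).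
  move=> xr; have x2 : (x - q) ^+ 2 <= r ^+ 2 by move: xr => /andP[? ?]; nra.
  rewrite -mulrDl ler_pdivlMr; last by rewrite ltr_wpDl ?sqr_ge0// exprn_gt0.
  rewrite ler_pdivrMl// ; nra.
have -> : (4 : R) = 2 + 2 by ring.
have e1 : p2 - r - p2 = - r by ring.
have e2 : p2 + r - p2 = r by ring.
have e3 : p1 - r - p1 = - r by ring.
have e4 : p1 + r - p1 = r by ring.
rewrite /rectint /= lerD //.
  rewrite -(I2 p1); apply: le_Rintegral => //.
    exact: integrable_Im (continuous_on_horB (rr p2) cE).
  move=> x /=; rewrite in_itv /= => /key.
  by rewrite e1 e2 sqrrN !mulNr !opprK.
rewrite mul0r add0r mul1r -(I2 p2); apply: le_Rintegral => //.
  exact: integrable_Re (continuous_on_verB (rr p1) cE).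
move=> x /=; rewrite in_itv /= => /key.
by rewrite e3 e4 sqrrN mulNr opprK [(x - _) ^+ 2 + _]addrC.
Qed.

Lemma rectint_inv (p : R[i]) a b c d : inside p a b c d ->
  4 <= normc (rectint (fun z => (z - p)^-1) a b c d).
Proof.
move=> [ap pb cp pd].
pose r := Num.min (Num.min (complex.Re p - a) (b - complex.Re p))
   (Num.min (complex.Im p - c) (d - complex.Im p)).
have r0 : 0 < r by rewrite !lt_min !subr_gt0 ap pb cp pd.
have [u1 u2 u3 u4] : [/\ r <= complex.Re p - a, r <= b - complex.Re p,
    r <= complex.Im p - c & r <= d - complex.Im p].
  by rewrite /r; split; rewrite !ge_min lexx ?orbT.
rewrite (@rectint_annulus _ p _ _ _ _ (complex.Re p - r) (complex.Re p + r)
    (complex.Im p - r) (complex.Im p + r)).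
- exact: rectint_inv_square.
- exact: inside_square.
- by move: u1; clear; lra.
- by move: u2; clear; lra.
- by move: u3; clear; lra.
- by move: u4; clear; lra.
- by move=> x y _ _ z0; exact: holomorphic_inv_sub.
Qed.

(** Subtracting [A / (z - p)] leaves a removable singularity, so only the
    integral of [1 / (z - p)] matters.  An inequality in place of the residue
    formula costs a constant factor in the Cauchy estimates and nothing else. *)
Lemma residue_le G p a b c d (A : R[i]) : inside p a b c d ->
  holomorphic_punctured G p a b c d ->
  (forall e, 0 < e -> exists2 s, 0 < s & forall z, z != p -> normc (z - p) < s ->
     normc ((z - p) * G z - A) <= e) -> 4 * normc A <= normc (rectint G a b c d).
Proof.
move=> ins hG HA.
have [ab cd] : a <= b /\ c <= d by case: ins => ? ? ? ?; split; lra.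
have hinv : holomorphic_punctured (fun z : R[i] => (z - p)^-1) p a b c d.
  by move=> x y _ _ z0; exact: holomorphic_inv_sub.
have hAinv : holomorphic_punctured (fun z => A * (z - p)^-1) p a b c d.
  move=> x y xr yr z0; apply: (@differentiableM _ _ (fun=> A)).
    exact: differentiable_cst.
  exact: hinv.
have : rectint (fun z => G z - A * (z - p)^-1) a b c d = 0.
  apply: (rectint_removable ins).
    by move=> x y xr yr z0; apply: differentiableB; [exact: hG|exact: hAinv].
  move=> e e0; have [s s0 Hs] := HA _ e0; exists s => // z z0 zs.
  by rewrite mulrBr mulrCA divff ?mulr1 ?subr_eq0//; exact: Hs.
rewrite (rectintB ab cd (punctured_edges ins hG) (punctured_edges ins hAinv)).
move/eqP; rewrite subr_eq0 => /eqP ->.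
rewrite (rectintZ _ ab cd (punctured_edges ins hinv)).
by rewrite normcM mulrC ler_wpM2l ?normc_ge0//; exact: rectint_inv.
Qed.

End Residue.

(** * Cauchy estimates and Taylor bounds *)

Section CauchyEstimates.
Context {R : realType}.
Implicit Types (a b c d x y r e M : R) (G H : R[i] -> R[i]) (p z w : R[i]).

Lemma holomorphic_cst (k : R[i]) z : holomorphic_at (fun=> k) z.
Proof. exact: differentiable_cst. Qed.

Lemma holomorphicB G H z : holomorphic_at G z -> holomorphic_at H z ->
  holomorphic_at (fun z => G z - H z) z.
Proof. exact: (@differentiableB _ _ _ (G : R[i]^o -> R[i]^o)). Qed.

Lemma holomorphicM G H z : holomorphic_at G z -> holomorphic_at H z ->
  holomorphic_at (fun z => G z * H z) z.
Proof. exact: (@differentiableM _ _ (G : R[i]^o -> R[i]^o)). Qed.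

(** Together with [is_derive_eps] this moves between [is_derive] and the epsilon
    form in which the remainders are estimated. *)
Lemma real_is_derive (f : R -> R) (t d : R) :
  (forall e, 0 < e -> exists2 r, 0 < r & forall h, `|h| < r ->
    `|f (t + h) - f t - h * d| <= e * `|h|) ->
  is_derive t (1 : R) f d.
Proof.
move=> H.
have C : h^-1 *: ((f \o shift t) (h *: (1 : R)) - f t) @[h --> 0^'] --> d.
  apply/cvgrPdist_le => e e0; have [r r0 Hr] := H e e0.
  rewrite near_withinE; apply/nbhs_ballP; exists r => // h.
  rewrite /ball /= sub0r normrN => hr h0.
  have hn : 0 < `|h| by rewrite normr_gt0.
  rewrite -[h *: 1]/(h * 1) mulr1.
  rewrite [h + t]addrC.
  rewrite -(ler_pM2r hn) -normrM.
  have -> : (d - h^-1 *: (f (t + h) - f t)) * h = - (f (t + h) - f t - h * d).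
    by rewrite -[_ *: _]/(h^-1 * (f (t + h) - f t)); field.
  by rewrite normrN; exact: Hr.
by apply: DeriveDef; [apply/cvg_ex; exists d|exact/cvg_lim].
Qed.

Lemma has_cderiv_line G w v (t : R) l : has_cderiv G (w + t%:C * v) l ->
  forall e, 0 < e -> exists2 r, 0 < r & forall h, `|h| < r ->
    normc (G (w + (t + h)%:C * v) - G (w + t%:C * v) - h%:C * (l * v)) <= e * `|h|.
Proof.
move=> H e e0.
have v1 : 0 < normc v + 1 by rewrite ltr_wpDl ?normc_ge0.
have [r r0 Hr] := H (e / (normc v + 1)) (divr_gt0 e0 v1).
exists (r / (normc v + 1)); first by rewrite divr_gt0.
move=> h hr.
have E : w + (t + h)%:C * v - (w + t%:C * v) = h%:C * v by rewrite rmorphD; ring.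
have hv : `|h| * normc v <= `|h| * (normc v + 1) by rewrite ler_wpM2l// lerDl.
have := Hr (w + (t + h)%:C * v); rewrite E normcM normc_real => K.
have -> : h%:C * (l * v) = l * (h%:C * v) by ring.
apply: (le_trans (K _)).
  by apply: (le_lt_trans hv); rewrite -ltr_pdivlMr.
rewrite mulrAC ler_pdivrMr// -mulrA; apply: ler_wpM2l hv; exact: ltW.
Qed.

Lemma Re_is_derive G w v (t : R) l : has_cderiv G (w + t%:C * v) l ->
  is_derive t (1 : R) (fun t : R => complex.Re (G (w + t%:C * v))) (complex.Re (l * v)).
Proof.
move=> H; apply: real_is_derive => e e0.
have [r r0 Hr] := has_cderiv_line H e0; exists r => // h hr.
apply: le_trans (Hr h hr); apply: le_trans (normc_ge_absRe _).
by rewrite le_eqVlt; apply/orP; left; apply/eqP; congr `|_|;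
   case: (G _) => ? ?; case: (G _) => ? ?; case: (l * v) => ? ? /=; ring.
Qed.

Lemma Im_is_derive G w v (t : R) l : has_cderiv G (w + t%:C * v) l ->
  is_derive t (1 : R) (fun t : R => complex.Im (G (w + t%:C * v))) (complex.Im (l * v)).
Proof.
move=> H; apply: real_is_derive => e e0.
have [r r0 Hr] := has_cderiv_line H e0; exists r => // h hr.
apply: le_trans (Hr h hr); apply: le_trans (normc_ge_absIm _).
by rewrite le_eqVlt; apply/orP; left; apply/eqP; congr `|_|;
   case: (G _) => ? ?; case: (G _) => ? ?; case: (l * v) => ? ? /=; ring.
Qed.

(** The mean value theorem holds for the real and the imaginary parts
    separately, at different points; hence the factor 2. *)
Lemma complex_mvt G w v K :
  (forall t : R, 0 <= t <= 1 -> exists2 l, has_cderiv G (w + t%:C * v) l & normc l <= K) ->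
  normc (G (w + v) - G w) <= 2 * K * normc v.
Proof.
move=> H.
have main (P : R[i] -> R) (PB : forall z w, P (z - w) = P z - P w)
    (Pn : forall z, `|P z| <= normc z)
    (Pd : forall t l, has_cderiv G (w + t%:C * v) l ->
       is_derive t (1 : R) (fun t : R => P (G (w + t%:C * v))) (P (l * v))) :
    `|P (G (w + v) - G w)| <= K * normc v.
  have /choice[l Hl] : forall t : R, exists l, 0 <= t <= 1 ->
      has_cderiv G (w + t%:C * v) l /\ normc l <= K.
    move=> t; have [t01|nt] := boolP (0 <= t <= 1); last by exists 0.
    by have [l ? ?] := H t t01; exists l.
  have D (t : R) : t \in `]0, 1[ -> is_derive t (1 : R) (fun t : R => P (G (w + t%:C * v)))
      (P (l t * v)).
    rewrite in_itv /= => /andP[t0 t1]; apply: Pd.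
    by apply: (Hl t _).1; rewrite !ltW.
  have C : {within `[0 : R, 1 : R], continuous (fun t : R => P (G (w + t%:C * v)))}.
    apply: continuous_in_subspaceT => t; rewrite inE/= in_itv/= => t01.
    apply: differentiable_continuous; apply/derivable1_diffP.
    by have [/Pd] := Hl t t01.
  have [c /[!in_itv]/= /andP[c0 c1]] := MVT ltr01 D C.
  rewrite rmorph1 mul1r rmorph0 mul0r addr0 subr0 mulr1 PB => ->.
  apply: (le_trans (Pn _)); rewrite normcM ler_wpM2r ?normc_ge0//.
  by apply: (Hl c _).2; rewrite !ltW.
apply: (le_trans (normc_le_ReIm _)).
have -> : 2 * K * normc v = K * normc v + K * normc v by ring.
apply: lerD; apply: main.
- by move=> [? ?] [? ?].
- exact: normc_ge_absRe.
- by move=> t l; exact: Re_is_derive.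
- by move=> [? ?] [? ?].
- exact: normc_ge_absIm.
- by move=> t l; exact: Im_is_derive.
Qed.

(** Squares, rather than discs, are the neighbourhoods here: boundary and area
    integrals over them are iterated integrals. *)
Definition insq p r z := (`|complex.Re (z - p)| <= r) && (`|complex.Im (z - p)| <= r).

Lemma insqE p r x y : insq p r (x +i* y) =
  (complex.Re p - r <= x <= complex.Re p + r) && (complex.Im p - r <= y <= complex.Im p + r).
Proof. by case: p => p1 p2; rewrite /insq /= !ler_distl. Qed.

Lemma insq_center p r : 0 <= r -> insq p r p.
Proof. by move=> r0; rewrite /insq subrr /= normr0 r0. Qed.

Lemma insqD p r s z w : insq p r z -> insq z s w -> insq p (r + s) w.
Proof.
move=> /andP[a b] /andP[c d].
rewrite /insq; have -> : w - p = (z - p) + (w - z) by ring.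
move: (z - p) (w - z) a b c d => [x y] [x' y'] /= a b c d.
by apply/andP; split; apply: (le_trans (ler_normD _ _)); rewrite lerD.
Qed.

Lemma insq_norm p r z : normc (z - p) <= r -> insq p r z.
Proof.
move=> H; rewrite /insq (le_trans (normc_ge_absRe _) H).
by rewrite (le_trans (normc_ge_absIm _) H).
Qed.

Lemma insq_le p r s z : r <= s -> insq p r z -> insq p s z.
Proof. by move=> rs /andP[a b]; rewrite /insq (le_trans a rs) (le_trans b rs). Qed.

Lemma insq_seg p r z (t : R) : 0 <= t <= 1 -> insq p r z -> insq p r (p + t%:C * (z - p)).
Proof.
move=> /andP[t0 t1]; rewrite /insq [p + _]addrC addrK.
case: (z - p) => x y /= /andP[xr yr]; rewrite !mul0r subr0 addr0 !normrM ger0_norm//.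
by apply/andP; split; [apply: le_trans xr|apply: le_trans yr]; rewrite ler_piMl.
Qed.

(** [l] is the residue of [(G z - G p) / (z - p)^2] at [p], and
    the boundary of the square stays at distance [r] from [p]. *)
Lemma cauchy_derivative_le G p r M l : 0 < r ->
  (forall z, insq p r z -> holomorphic_at G z) ->
  (forall z, insq p r z -> normc (G z) <= M) ->
  has_cderiv G p l -> normc l <= 8 * M / r.
Proof.
move=> r0 hG GM Hl.
pose a := complex.Re p - r; pose b := complex.Re p + r.
pose c := complex.Im p - r; pose d := complex.Im p + r.
have ins : inside p a b c d := inside_square p r0.
(* A simple pole with residue [l]. *)
pose Q z := (G z - G p) * ((z - p)^-1 * (z - p)^-1).
have sq x y : a <= x <= b -> c <= y <= d -> insq p r (x +i* y).
  by move=> xab ycd; rewrite insqE xab.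
have hQ : holomorphic_punctured Q p a b c d.
  move=> x y xab ycd z0.
  apply: holomorphicM.
    by apply: holomorphicB; [exact: hG (sq _ _ xab ycd)|exact: holomorphic_cst].
  by apply: holomorphicM; exact: holomorphic_inv_sub.
have : 4 * normc l <= normc (rectint Q a b c d).
  apply: (residue_le ins hQ) => e e0; have [s s0 Hs] := Hl e e0; exists s => // z zp zs.
  have zp0 : z - p != 0 by rewrite subr_eq0.
  have -> : (z - p) * Q z - l = (G z - G p - l * (z - p)) * (z - p)^-1.
    by rewrite /Q; field.
  by rewrite normcM normcV ler_pdivrMr ?normc_gt0//; exact: Hs.
move=> H; rewrite -(@ler_pM2l _ 4)//; apply: (le_trans H).
have -> : 4 * (8 * M / r) = 4 * (2 * M / r ^+ 2) * ((b - a) + (d - c)).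
  by rewrite /a /b /c /d; field; rewrite gt_eqF.
have [ab cd] : a <= b /\ c <= d by case: ins => ? ? ? ?; split; lra.
apply: (normc_rectint_le ab cd (punctured_edges ins hQ)) => x y xab ycd bd.
have rz : r <= normc ((x +i* y) - p).
  rewrite /a /b /c /d in bd; move: bd; case: (p) => p1 p2 /= bd.
  case/or4P: bd => /eqP E.
  - apply: le_trans (normc_ge_absRe _); rewrite /= E.
    by rewrite (_ : p1 - r - p1 = - r) ?normrN ?ger0_norm // ?ltW//; ring.
  - apply: le_trans (normc_ge_absRe _); rewrite /= E.
    by rewrite (_ : p1 + r - p1 = r) ?ger0_norm // ?ltW//; ring.
  - apply: le_trans (normc_ge_absIm _); rewrite /= E.
    by rewrite (_ : p2 - r - p2 = - r) ?normrN ?ger0_norm // ?ltW//; ring.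
  - apply: le_trans (normc_ge_absIm _); rewrite /= E.
    by rewrite (_ : p2 + r - p2 = r) ?ger0_norm // ?ltW//; ring.
have nz : 0 < normc ((x +i* y) - p) := lt_le_trans r0 rz.
rewrite /Q !normcM normcV; apply: ler_pM; rewrite ?normc_ge0//.
- by rewrite mulr_ge0 ?invr_ge0 ?normc_ge0.
- rewrite mulr_natl mulr2n; apply: (le_trans (ler_normcB _ _)).
  by apply: lerD; apply: GM; [exact: sq|apply: insq_center; exact: ltW].
- rewrite -invfM lef_pV2.
  + by rewrite expr2; apply: (ler_pM _ _ rz rz); exact: ltW.
  + by rewrite posrE mulr_gt0.
  + by rewrite posrE exprn_gt0.
Qed.

Lemma lipschitz_holomorphic G p r s M z : 0 < s -> 0 <= r ->
  (forall z, insq p (r + s) z -> holomorphic_at G z) ->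
  (forall z, insq p (r + s) z -> normc (G z) <= M) ->
  insq p r z -> normc (G z - G p) <= 16 * M / s * normc (z - p).
Proof.
move=> s0 r0 hG GM zr.
have -> : 16 * M / s = 2 * (8 * M / s) by field; rewrite gt_eqF.
have := @complex_mvt G p (z - p) (8 * M / s); rewrite [p + (z - p)]addrC subrK; apply.
move=> t t01; have zt := insq_seg t01 zr.
have pt := insqD zt (insq_center _ (ltW s0)).
have /holomorphic_atP[l Hl] := hG _ pt; exists l => //.
apply: (cauchy_derivative_le s0 _ _ Hl) => u us; first by apply: hG; exact: insqD zt us.
by apply: GM; exact: insqD zt us.
Qed.

Lemma has_cderivB G H z l m : has_cderiv G z l -> has_cderiv H z m ->
  has_cderiv (fun z => G z - H z) z (l - m).
Proof.
move=> hG hH e e0; have e2 : 0 < e / 2 by rewrite divr_gt0.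
have [r r0 Hr] := hG _ e2; have [s s0 Hs] := hH _ e2.
exists (Num.min r s); first by rewrite lt_min r0.
move=> w; rewrite lt_min => /andP[/Hr A /Hs B].
have -> : G w - H w - (G z - H z) - (l - m) * (w - z) =
  (G w - G z - l * (w - z)) - (H w - H z - m * (w - z)) by ring.
have -> : e = e / 2 + e / 2 by field.
by apply: (le_trans (ler_normcB _ _)); rewrite mulrDl lerD.
Qed.

Lemma has_cderiv_lin (k z : R[i]) : has_cderiv (fun z => k * z) z k.
Proof.
move=> e e0; exists 1 => // w _; have -> : k * w - k * z - k * (w - z) = 0 by ring.
by rewrite normc0 mulr_ge0 ?normc_ge0// ltW.
Qed.

Lemma has_cderiv_shift G (v z l : R[i]) : has_cderiv G (z + v) l ->
  has_cderiv (fun z => G (z + v)) z l.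
Proof.
move=> H e e0; have [r r0 Hr] := H e e0; exists r => // w wz.
have E : w - z = (w + v) - (z + v) by ring.
by rewrite E; apply: Hr; rewrite -E.
Qed.

Lemma holomorphic_shift G (v z : R[i]) : holomorphic_at G (z + v) ->
  holomorphic_at (fun z => G (z + v)) z.
Proof.
by move=> /holomorphic_atP[l] /has_cderiv_shift H; apply/holomorphic_atP; exists l.
Qed.

(** The derivative of the difference [u |-> G (u + (z - p)) - G u] is
    bounded by the Cauchy estimate, and the difference itself by the Lipschitz
    bound; second derivatives are thereby avoided. *)
Lemma cderiv_lipschitz G p r M z l m : 0 < r ->
  (forall z, insq p (3 * r) z -> holomorphic_at G z) ->
  (forall z, insq p (3 * r) z -> normc (G z) <= M) ->
  insq p r z -> has_cderiv G p l -> has_cderiv G z m ->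
  normc (m - l) <= 128 * M / r ^+ 2 * normc (z - p).
Proof.
move=> r0 hG GM zr Hl Hm.
have -> : 128 * M / r ^+ 2 * normc (z - p) = 8 * (16 * M / r * normc (z - p)) / r.
  by field; rewrite gt_eqF.
pose D u := G (u + (z - p)) - G u.
have sh u : insq p r u -> insq p (2 * r) (u + (z - p)).
  move=> ur; have -> : 2 * r = r + r by ring.
  by apply: (insqD ur); move: zr; rewrite /insq [u + _]addrC addrK.
have [r2 r3] : 2 * r <= 3 * r /\ r <= 3 * r by split; lra.
apply: (@cauchy_derivative_le D p r _ _ r0).
- move=> u ur; apply: holomorphicB; last by apply: hG; exact: insq_le ur.
  by apply: holomorphic_shift; apply: hG; apply: insq_le r2 _; exact: sh.
- move=> u ur; have := @lipschitz_holomorphic G u r r M (u + (z - p)) r0 (ltW r0).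
  rewrite [_ - u]addrAC subrr add0r; apply.
  + move=> v uv; apply: hG; have -> : 3 * r = r + (r + r) by ring.
    exact: insqD uv.
  + move=> v uv; apply: GM; have -> : 3 * r = r + (r + r) by ring.
    exact: insqD uv.
  + by move: zr; rewrite /insq [u + _]addrC addrK.
- apply: has_cderivB => //; apply: has_cderiv_shift.
  by rewrite addrC subrK.
Qed.

Lemma cderiv_taylor G p r M z l : 0 < r ->
  (forall z, insq p (3 * r) z -> holomorphic_at G z) ->
  (forall z, insq p (3 * r) z -> normc (G z) <= M) ->
  insq p r z -> has_cderiv G p l ->
  normc (G z - G p - l * (z - p)) <= 256 * M / r ^+ 2 * normc (z - p) ^+ 2.
Proof.
move=> r0 hG GM zr Hl.
have M0 : 0 <= M.
  apply: le_trans (GM p _); first exact: normc_ge0.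
  by apply: insq_center; rewrite mulr_ge0// ltW.
have -> : 256 * M / r ^+ 2 * normc (z - p) ^+ 2 =
    2 * (128 * M / r ^+ 2 * normc (z - p)) * normc (z - p).
  by field; rewrite gt_eqF.
pose D u := G u - l * u.
have := @complex_mvt D p (z - p) (128 * M / r ^+ 2 * normc (z - p)).
rewrite [p + (z - p)]addrC subrK /D.
have -> : G z - l * z - (G p - l * p) = G z - G p - l * (z - p) by ring.
apply=> t t01; have tr := insq_seg t01 zr.
have r3 : r <= 3 * r by lra.
have /holomorphic_atP[m Hm] := hG _ (insq_le r3 tr); exists (m - l).
  by apply: has_cderivB Hm _; exact: has_cderiv_lin.
apply: (le_trans (cderiv_lipschitz r0 hG GM tr Hl Hm)).
rewrite [p + _]addrC addrK normcM normc_real.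
apply: ler_wpM2l; first by rewrite divr_ge0 ?mulr_ge0 ?exprn_ge0// ltW.
by move: t01 => /andP[t0 t1]; rewrite ger0_norm// ler_piMl// normc_ge0.
Qed.

End CauchyEstimates.

Section TwoVariables.
Context {R : realType}.
Implicit Types (r s e M : R) (h : R[i] -> R[i] -> R[i]) (p q z w a b : R[i]).

Definition separately_holomorphic h p q r := forall z w, insq p r z -> insq q r w ->
  holomorphic_at (fun z => h z w) z /\ holomorphic_at (h z) w.

(** Expansion in [z] at fixed [w], then in [w]; the change of the first
    coefficient with [w] is controlled by the Cauchy estimate for
    [h z w - h z q].  Only separate holomorphy is used, which is what survives in
    limits. *)
Lemma taylor2 h p q r M l m z w : 0 < r ->
  separately_holomorphic h p q (3 * r) ->
  (forall z w, insq p (3 * r) z -> insq q (3 * r) w -> normc (h z w) <= M) ->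
  has_cderiv (fun z => h z q) p l -> has_cderiv (h p) q m ->
  insq p r z -> insq q r w ->
  normc (h z w - h p q - l * (z - p) - m * (w - q)) <=
    256 * M / r ^+ 2 * (normc (z - p) + normc (w - q)) ^+ 2.
Proof.
move=> r0 hh hM Hl Hm zr wr.
have r3 : r <= 3 * r by lra.
have pr3 : insq p (3 * r) p by apply: insq_center; lra.
have qr3 : insq q (3 * r) q by apply: insq_center; lra.
have wr3 := insq_le r3 wr; have zr3 := insq_le r3 zr.
have M0 : 0 <= M by apply: le_trans (hM p q _ _) => //; exact: normc_ge0.
have /holomorphic_atP[l' Hl'] := (hh p w pr3 wr3).1.
have T1 : normc (h z w - h p w - l' * (z - p)) <= 256 * M / r ^+ 2 * normc (z - p) ^+ 2.
  apply: (@cderiv_taylor _ (fun z => h z w)) => // u ur; first exact: (hh u w _ _).1.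
  exact: hM.
have T2 : normc (h p w - h p q - m * (w - q)) <= 256 * M / r ^+ 2 * normc (w - q) ^+ 2.
  by apply: (@cderiv_taylor _ (h p)) => // u ur; [exact: (hh p u _ _).2|exact: hM].
have T3 : normc (l' - l) <= 8 * (16 * M / r * normc (w - q)) / r.
  apply: (@cauchy_derivative_le _ (fun z => h z w - h z q) p r _ _ r0).
  - by move=> u /(insq_le r3) ur; apply: holomorphicB; [exact: (hh u w _ _).1|exact: (hh u q _ _).1].
  - move=> u /(insq_le r3) ur.
    have rr : r + r <= 3 * r by lra.
    apply: (@lipschitz_holomorphic _ (h u) q r r) => //; first exact: ltW.
      by move=> v /(insq_le rr) vr; exact: (hh u v _ _).2.
    by move=> v /(insq_le rr) vr; exact: hM.
  - exact: has_cderivB.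
have -> : h z w - h p q - l * (z - p) - m * (w - q) =
   (h z w - h p w - l' * (z - p)) + (l' - l) * (z - p) + (h p w - h p q - m * (w - q)).
  by ring.
apply: (le_trans (le_normcD _ _)); apply: (le_trans (lerD (le_normcD _ _) T2)).
rewrite normcM.
move: T1 T3; move: (normc _) => t1 T1; move: (normc (l' - l)) => t3 T3.
have := normc_ge0 (z - p); have := normc_ge0 (w - q).
move: (normc (z - p)) (normc (w - q)) T1 T3 => u v T1 T3 v0 u0.
have T3u : t3 * u <= 256 * M / r ^+ 2 * (2 * u * v).
  apply: (le_trans (ler_wpM2r u0 T3)).
  have -> : 8 * (16 * M / r * v) / r * u = 128 * M / r ^+ 2 * (u * v) by field; rewrite gt_eqF.
  have : 0 <= M / r ^+ 2 * (u * v) by rewrite !mulr_ge0 ?invr_ge0 ?exprn_ge0// ltW.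
  have -> : 256 * M / r ^+ 2 * (2 * u * v) = 512 * (M / r ^+ 2 * (u * v)) by ring.
  have -> : 128 * M / r ^+ 2 * (u * v) = 128 * (M / r ^+ 2 * (u * v)) by ring.
  lra.
have -> : 256 * M / r ^+ 2 * (u + v) ^+ 2 = 256 * M / r ^+ 2 * u ^+ 2 +
   256 * M / r ^+ 2 * (2 * u * v) + 256 * M / r ^+ 2 * v ^+ 2 by ring.
by rewrite lerD2r lerD.
Qed.

End TwoVariables.

(** * Measurability and Tonelli in four real variables *)

Section CountableBase.

(** [nb x] plays the part of the neighbourhoods of [x], since the carriers of the
    sigma-algebras are not topological spaces. *)
Definition countable_base d (T : measurableType d) (nb : T -> set_system T) :=
  exists B : nat -> set T, (forall n, measurable (B n)) /\
    forall x A, nb x A -> exists n, B n x /\ B n `<=` A.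

Lemma countable_base_prod d1 d2 (T1 : measurableType d1) (T2 : measurableType d2)
    (nb1 : T1 -> set_system T1) (nb2 : T2 -> set_system T2) :
  countable_base nb1 -> countable_base nb2 ->
  @countable_base _ (T1 * T2)%type (fun p => filter_prod (nb1 p.1) (nb2 p.2)).
Proof.
move=> [B1 [mB1 H1]] [B2 [mB2 H2]].
exists (fun n => let p := odflt (0, 0)%N (unpickle n) in B1 p.1 `*` B2 p.2); split.
  by move=> n /=; apply: measurableX.
move=> [x y] A [[U V] /= [Ux Vy] UV].
have [n [Bn Un]] := H1 _ _ Ux; have [m [Bm Vm]] := H2 _ _ Vy.
exists (pickle (n, m)); rewrite pickleK /=; split => //.
by move=> [u v] [/= Bu Bv]; apply: UV; split => /=; [exact: Un|exact: Vm].
Qed.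

(** Product sigma-algebras see an open set only through a countable base of
    measurable boxes. *)
Lemma base_open_measurable d (T : measurableType d) (nb : T -> set_system T) (D U : set T) :
  countable_base nb -> measurable D ->
  (forall x, D x -> U x -> nb x U) -> measurable (D `&` U).
Proof.
move=> [B [mB HB]] mD HU.
have -> : D `&` U = D `&` \bigcup_(n in [set n | B n `<=` U]) B n.
  apply/seteqP; split => x [Dx].
    by move=> Ux; split => //; have [n [Bn nU]] := HB x U (HU _ Dx Ux); exists n.
  by move=> [n /= nU Bn]; split => //; exact: nU.
by apply: measurableI => //; apply: bigcup_measurable.
Qed.

Lemma base_continuous_measurable (R : realType) d (T : measurableType d)
    (nb : T -> set_system T) (D : set T) (f : T -> R) :
  countable_base nb -> measurable D ->
  (forall x, D x -> forall A, nbhs (f x) A -> nb x (f @^-1` A)) ->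
  measurable_fun D f.
Proof.
move=> cb mD cf _; apply: (measurability _ (measurable_realfun.RGenOpens.measurableE R)) => //.
move=> _ [_ [a [b ->] <-]]; apply: (base_open_measurable cb) => // x Dx fx.
by apply: cf => //; apply: open_nbhs_nbhs; split => //; exact: interval_open.
Qed.

Lemma countable_base_real (R : realType) :
  @countable_base _ (g_sigma_algebraType (R.-ocitv.-measurable)) (fun x => nbhs (x : R)).
Proof.
exists (fun n => let p := odflt (0, 0) (unpickle n) in
   [set x : R | ratr p.1 < x < ratr p.2]); split.
  move=> n /=; set p := odflt _ _.
  rewrite [X in measurable X](_ : _ = `](ratr p.1 : R), (ratr p.2 : R)[%classic).
    exact: measurable_itv.
  by apply/seteqP; split => x; rewrite /= in_itv.
move=> x A /nbhs_ballP[e /= e0 eA].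
have [|q1] := @rat_in_itvoo R (x - e) x; first by rewrite gtrBl.
have [|q2] := @rat_in_itvoo R x (x + e); first by rewrite ltrDl.
rewrite !in_itv /= => /andP[a1 a2] /andP[b1 b2].
exists (pickle (q1, q2)); rewrite pickleK /=; split; first by rewrite b2.
move=> y /andP[y1 y2]; apply: eA; rewrite /ball /= ltr_distlC; lra.
Qed.

End CountableBase.

Section ProductSigmaFinite.
Context e1 e2 (S1 : measurableType e1) (S2 : measurableType e2) (R : realType).
Variables (n1 : {sigma_finite_measure set S1 -> \bar R})
  (n2 : {sigma_finite_measure set S2 -> \bar R}).
Local Open Scope ereal_scope.

(** The product of two exhaustions by sets of finite measure is such an
    exhaustion.  The instance built from it lets Tonelli be iterated on nested
    products. *)
Lemma sigma_finite_product : sigma_finite setT (n1 \x n2).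
Proof.
have /sigma_finiteP[F [TF ndF Foo]] := sigma_finiteT n1.
have /sigma_finiteP[G [TG ndG Goo]] := sigma_finiteT n2.
exists (fun n => F n `*` G n).
  rewrite -setXTT TF TG predeqE => -[x y]; split.
    move=> [/= [n _ Fnx] [k _ Gky]]; exists (maxn n k) => //; split.
    - by move: x Fnx; exact/subsetPset/ndF/leq_maxl.
    - by move: y Gky; exact/subsetPset/ndG/leq_maxr.
  by move=> [n _ []/= ? ?]; split; exists n.
move=> k; have [? ?] := Foo k; have [? ?] := Goo k.
split; first exact: measurableX.
by rewrite product_measure1E// lte_mul_pinfty// ge0_fin_numE.
Qed.
Definition sigma_finite_prod : {sigma_finite_measure set (S1 * S2)%type -> \bar R} :=
 HB.pack (n1 \x n2) (Measure_isSigmaFinite.Build _ _ _ (n1 \x n2) sigma_finite_product).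

End ProductSigmaFinite.

Section Tonelli4.
Context d1 d2 d3 d4 (T1 : measurableType d1) (T2 : measurableType d2)
  (T3 : measurableType d3) (T4 : measurableType d4) (R : realType).
Variables (m1 : {sigma_finite_measure set T1 -> \bar R})
  (m2 : {sigma_finite_measure set T2 -> \bar R})
  (m3 : {sigma_finite_measure set T3 -> \bar R})
  (m4 : {sigma_finite_measure set T4 -> \bar R}).
Local Open Scope ereal_scope.

Definition inner_integral (Psi : T1 * T2 * T3 * T4 -> \bar R) (xy : T1 * T2) :=
  \int[m3]_u \int[m4]_v Psi (xy, u, v).

Lemma tonelli4 (Psi : T1 * T2 * T3 * T4 -> \bar R) : measurable_fun setT Psi ->
  (forall u, 0 <= Psi u) ->
  [/\ measurable_fun setT (inner_integral Psi), forall xy, 0 <= inner_integral Psi xy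
   & \int[((m1 \x m2) \x m3) \x m4]_x Psi x = \int[m1]_x \int[m2]_y inner_integral Psi (x, y)].
Proof.
move=> mPsi Psi0; pose F3 := fubini_F m4 Psi.
have mF3 : measurable_fun setT F3 by exact: measurable_fun_fubini_tonelli_F.
have F30 u : 0 <= F3 u by apply: integral_ge0.
have mF2 : measurable_fun setT (inner_integral Psi).
  exact: (measurable_fun_fubini_tonelli_F F3).
have F20 u : 0 <= inner_integral Psi u.
  by apply: integral_ge0 => x _; exact: (F30 (u, x)).
split; [exact: mF2|exact: F20|].
transitivity (\int[(m1 \x m2) \x m3]_x F3 x).
  exact: (@fubini_tonelli1 _ _ _ _ _ (sigma_finite_prod (sigma_finite_prod m1 m2) m3) m4 Psi mPsi Psi0).
transitivity (\int[m1 \x m2]_x inner_integral Psi x).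
  exact: (@fubini_tonelli1 _ _ _ _ _ (sigma_finite_prod m1 m2) m3 F3 mF3 F30).
exact: (fubini_tonelli1 (inner_integral Psi) mF2 F20).
Qed.

End Tonelli4.

(** * Mean value bounds by area integrals *)

Section PlaneIntegrals.
Context {R : realType}.
Local Notation mu := (@lebesgue_measure R).
Local Notation TR := (g_sigma_algebraType (R.-ocitv.-measurable)).

Definition nbhs4 (p : R * R * R * R) :=
  filter_prod (filter_prod (filter_prod (nbhs p.1.1.1) (nbhs p.1.1.2)) (nbhs p.1.2)) (nbhs p.2).

Lemma countable_base4 : @countable_base _ (TR * TR * TR * TR)%type nbhs4.
Proof.
have c1 := countable_base_real R; have c2 := countable_base_prod c1 c1.
have c3 := countable_base_prod c2 c1; exact: countable_base_prod c3 c1.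
Qed.

Local Open Scope ereal_scope.

(** A function cannot exceed its average everywhere.  The margin [e] covers
    the case where the average is zero. *)
Lemma exists_le_average (N : TR -> \bar R) (a b S : R) : (a < b)%R ->
  measurable_fun setT N -> (forall t, 0 <= N t) -> \int[mu]_t N t <= S%:E ->
  forall e : R, (0 < e)%R ->
  exists2 t, (a <= t <= b)%R & N t <= ((S + e) / (b - a))%:E.
Proof.
move=> ab mN N0 NS e e0; apply: contrapT => H.
have ba : (0 < b - a)%R by rewrite subr_gt0.
have S0 : (0 <= S)%R by rewrite -lee_fin; apply: le_trans NS; exact: integral_ge0.
have G t : (a <= t <= b)%R -> ((S + e) / (b - a))%:E <= N t.
  move=> tab; rewrite leNgt; apply/negP => /ltW Nt; apply: H; by exists t.
suff : (S + e)%:E <= S%:E by rewrite lee_fin gerDl leNgt e0.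
apply: le_trans NS.
have -> : (S + e)%:E = \int[mu]_(t in `[a, b]) (cst ((S + e) / (b - a))%:E) t.
  rewrite integral_cst//= lebesgue_measure_itv /= lte_fin ab -EFinD -EFinM.
  by rewrite divfK// gt_eqF.
have mN' : measurable_fun `[a, b] N by exact: measurable_funTS.
apply: (@le_trans _ _ (\int[mu]_(t in `[a, b]) N t)).
  apply: ge0_le_integral => //.
  by move=> t _; rewrite /= lee_fin; apply: divr_ge0; [apply: addr_ge0 => //|]; exact: ltW.
by apply: ge0_subset_integral.
Qed.

Definition edgex (G : R[i] -> R[i]) (a b y : R) : R :=
  (\int[mu]_(x in `[a, b]) normc (G (x +i* y)))%R.

Definition edgey (G : R[i] -> R[i]) (c d x : R) : R :=
  (\int[mu]_(y in `[c, d]) normc (G (x +i* y)))%R.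

(** [G p] is the residue of [G z / (z - p)] at [p]. *)
Lemma rectint_mean_le (G : R[i] -> R[i]) p (a b c d r : R) : (0 < r)%R ->
  holomorphic_rect G a b c d ->
  (a <= complex.Re p - r)%R -> (complex.Re p + r <= b)%R ->
  (c <= complex.Im p - r)%R -> (complex.Im p + r <= d)%R ->
  (2 * r * normc (G p) <= edgex G a b c + edgex G a b d + (edgey G c d a + edgey G c d b))%R.
Proof.
move=> r0 hG ap pb cp pd.
pose edge_x := edgex G a b; pose edge_y := edgey G c d.
rewrite -/(edge_x c) -/(edge_x d) -/(edge_y a) -/(edge_y b).
have ins : inside p a b c d by split; move: r0 ap pb cp pd; clear; lra.
have [ab cd] : (a <= b)%R /\ (c <= d)%R.
  by split; move: r0 ap pb cp pd; clear; lra.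
pose Q z := (G z * (z - p)^-1)%R.
have hQ : holomorphic_punctured Q p a b c d.
  move=> x y xab ycd z0; apply: holomorphicM; first exact: hG.
  exact: holomorphic_inv_sub.
have L : (4 * normc (G p) <= normc (rectint Q a b c d))%R.
  apply: (residue_le ins hQ) => e e0.
  have : {for (p : R[i]^o), continuous (G : R[i]^o -> R[i]^o)}.
    apply: differentiable_continuous; move: ins => [? ? ? ?].
    by rewrite [p]complexE -ComplexE; apply: hG; rewrite !ltW.
  move/cvg_normcP => /(_ e e0) /nbhs_normcP[s s0 Hs]; exists s => // z zp zs.
  have zp0 : (z - p != 0)%R by rewrite subr_eq0.
  have -> : ((z - p) * Q z)%R = G z by rewrite /Q; field.
  by apply: ltW; exact: Hs.
have cQ := punctured_edges ins hQ.
have cG := continuous_rect_edges (holomorphic_continuous_rect hG).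
(* The pole is divided out: on the boundary [1 / (z - p)] is at most [1 / r]. *)
have dist x y : (a <= x <= b)%R -> (c <= y <= d)%R ->
    [|| x == a, x == b, y == c | y == d] ->
    (normc (Q (x +i* y)) <= r^-1 * normc (G (x +i* y)))%R.
  move=> xab ycd bd; rewrite /Q normcM mulrC normcV; apply: ler_wpM2r; first exact: normc_ge0.
  suff rz : (r <= normc ((x +i* y) - p))%R by rewrite lef_pV2 ?posrE// (lt_le_trans r0).
  have Rz : (`|x - complex.Re p| <= normc ((x +i* y) - p))%R.
    by apply: le_trans (normc_ge_absRe _); case: (p).
  have Iz : (`|y - complex.Im p| <= normc ((x +i* y) - p))%R.
    by apply: le_trans (normc_ge_absIm _); case: (p).
  case/or4P: bd => /eqP E.
  - apply: le_trans Rz; rewrite E distrC; apply: le_trans (ler_norm _); lra.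
  - apply: le_trans Rz; rewrite E; apply: le_trans (ler_norm _); lra.
  - apply: le_trans Iz; rewrite E distrC; apply: le_trans (ler_norm _); lra.
  - apply: le_trans Iz; rewrite E; apply: le_trans (ler_norm _); lra.
have edge u v (phi psi : R -> R[i]) : continuous_on u v phi -> continuous_on u v psi ->
   (forall x, u <= x <= v -> normc (phi x) <= r^-1 * normc (psi x))%R ->
   (normc (cint u v phi) <= 2 * (r^-1 * \int[mu]_(x in `[u, v]) normc (psi x)))%R.
  move=> cphi cpsi le; apply: (le_trans (normc_cint_le_int cphi)).
  rewrite ler_pM2l// -RintegralZl//; last exact: integrable_normc.
  apply: le_Rintegral => //.
  - exact: integrable_normc.
  - exact: (integrableZl _ (r^-1)%R (integrable_normc cpsi)).
have hx H y : continuous_edges H a b c d -> (y == c) || (y == d) ->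
   continuous_on a b (fun x => H (x +i* y)).
  by move=> cH yy; exact: (continuous_on_hor_edge cd cH).
have hy H x : continuous_edges H a b c d -> (x == a) || (x == b) ->
   continuous_on c d (fun y => H (x +i* y)).
  by move=> cH xx; exact: (continuous_on_ver_edge ab cH).
have Ex y : (y == c) || (y == d) ->
    (normc (cint a b (fun x => Q (x +i* y))) <= 2 * (r^-1 * edge_x y))%R.
  move=> yy; apply: edge; [exact: hx|exact: hx|move=> x xab; apply: dist => //].
    by case/orP: yy => /eqP ->; rewrite lexx ?cd.
  by rewrite yy !orbT.
have Ey x : (x == a) || (x == b) ->
    (normc (cint c d (fun y => Q (x +i* y))) <= 2 * (r^-1 * edge_y x))%R.
  move=> xx; apply: edge; [exact: hy|exact: hy|move=> y ycd; apply: dist => //].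
    by case/orP: xx => /eqP ->; rewrite lexx ?ab.
  by rewrite !orbA xx.
move: L; rewrite (rectint_edges ab cd cQ).
have aa : (a == a) || (a == b) by rewrite eqxx.
have bb : (b == a) || (b == b) by rewrite eqxx orbT.
have cc : (c == c) || (c == d) by rewrite eqxx.
have dd : (d == c) || (d == d) by rewrite eqxx orbT.
move: (Ex c cc) (Ex d dd) (Ey a aa) (Ey b bb).
move: (cint _ _ _) => I1; move: (cint _ _ _) => I2.
move: (cint _ _ _) => I3; move: (cint _ _ _) => I4.
move=> H1 H2 H3 H4 L.
have T : (4 * normc (G p) <= normc I1 + normc I2 + (normc I4 + normc I3))%R.
  apply: (le_trans L); apply: (le_trans (le_normcD _ _)).
  by rewrite normcM normci mul1r lerD// ler_normcB.
have ri0 : (0 < r^-1)%R by rewrite invr_gt0.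
have rr : (r * r^-1 = 1)%R by rewrite divff// gt_eqF.
have : (r * (4 * normc (G p)) <= r * (2 * r^-1 * (edge_x c + edge_x d + (edge_y a + edge_y b))))%R.
  by rewrite ler_pM2l//; apply: (le_trans T); move: H1 H2 H3 H4; clear; lra.
have -> : (r * (2 * r^-1 * (edge_x c + edge_x d + (edge_y a + edge_y b))) =
  2 * (edge_x c + edge_x d + (edge_y a + edge_y b)))%R.
  by rewrite mulrA mulrCA rr mulr1.
clear; lra.
Qed.

(** The boundary integrals of [rectint_mean_le] are replaced by area integrals:
    each side of the contour may be chosen freely in a strip of width [r / 2], and
    some choice has a boundary integral below the average over the strip. *)
Lemma normc_le_integral (G : R[i] -> R[i]) p (r : R) (Phi : TR * TR -> \bar R) :
  (0 < r)%R -> (forall z, insq p r z -> holomorphic_at G z) ->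
  measurable_fun setT Phi -> (forall u, 0 <= Phi u) ->
  (forall x y, insq p r (x +i* y) -> (normc (G (x +i* y)))%:E <= Phi (x, y)) ->
  (normc (G p))%:E <= (8 / r ^+ 2)%:E * \int[mu]_x \int[mu]_y Phi (x, y).
Proof.
move=> r0 hG mPhi Phi0 GPhi.
have r20 : (0 < r ^+ 2)%R by rewrite exprn_gt0.
set S := \int[mu]_x \int[mu]_y Phi (x, y).
have S0 : 0 <= S by apply: integral_ge0 => x _; exact: integral_ge0.
pose N t := \int[mu]_x Phi (x, t); pose M s := \int[mu]_y Phi (s, y).
have mN : measurable_fun (setT : set TR) N.
  exact: (@measurable_fun_fubini_tonelli_G _ _ TR TR R mu Phi).
have mM : measurable_fun (setT : set TR) M.
  exact: (@measurable_fun_fubini_tonelli_F _ _ TR TR R mu Phi).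
have [SE|] := eqVneq S +oo; first by rewrite SE gt0_muley ?leey// lte_fin divr_gt0.
rewrite -ltey => Sy.
have Sfin : S \is a fin_num by rewrite ge0_fin_numE.
have NS : \int[mu]_t N t <= (fine S)%:E by rewrite fineK// /N -fubini_tonelli.
have MS : \int[mu]_s M s <= (fine S)%:E by rewrite fineK.
rewrite -(fineK Sfin) -EFinM lee_fin.
set s := fine S; have s0 : (0 <= s)%R by exact: fine_ge0.
apply/ler_addgt0Pr => e e0.
have e8 : (0 < e * (r ^+ 2 / 8))%R by rewrite mulr_gt0// divr_gt0.
move: (p) hG GPhi => [p1 p2] hG GPhi.
have N0 t : 0 <= N t by apply: integral_ge0.
have M0 t : 0 <= M t by apply: integral_ge0.
have hl q : (q - r < q - r / 2)%R by lra.
have hr q : (q + r / 2 < q + r)%R by lra.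
have [a aI Ma] := exists_le_average (hl p1) mM M0 MS e8.
have [b bI Mb] := exists_le_average (hr p1) mM M0 MS e8.
have [c cI Nc] := exists_le_average (hl p2) mN N0 NS e8.
have [d dI Nd] := exists_le_average (hr p2) mN N0 NS e8.
have EI : [/\ p1 - r / 2 - (p1 - r) = r / 2, p1 + r - (p1 + r / 2) = r / 2,
  p2 - r / 2 - (p2 - r) = r / 2 & p2 + r - (p2 + r / 2) = r / 2]%R by split; field.
(* The four sides lie in the outer strips of width [r / 2] of the square. *)
have [E1 E2 E3 E4] := EI; rewrite E1 in Ma; rewrite E2 in Mb; rewrite E3 in Nc; rewrite E4 in Nd.
have inr x y : (a <= x <= b)%R -> (c <= y <= d)%R -> insq (p1 +i* p2) r (x +i* y).
  move=> xab ycd; rewrite insqE /=; move: aI bI cI dI xab ycd r0; clear; lra.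
have hR : holomorphic_rect G a b c d.
  by move=> x y xab ycd; apply: hG; exact: inr.
have r2 : (0 < r / 2)%R by rewrite divr_gt0.
have [i1 i2] : (a <= p1 - r / 2)%R /\ (p1 + r / 2 <= b)%R.
  by move: aI bI => /andP[? ?] /andP[? ?].
have [i3 i4] : (c <= p2 - r / 2)%R /\ (p2 + r / 2 <= d)%R.
  by move: cI dI => /andP[? ?] /andP[? ?].
have [ab cd] : (a <= b)%R /\ (c <= d)%R by split; move: i1 i2 i3 i4 r2; clear; lra.
have cG := holomorphic_continuous_rect hR.
have Rle (phi : R -> R[i]) u v (Psi : TR -> \bar R) : continuous_on u v phi ->
    measurable_fun setT Psi -> (forall x, 0 <= Psi x) ->
    (forall x, (u <= x <= v)%R -> (normc (phi x))%:E <= Psi x) ->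
    ((\int[mu]_(x in `[u, v]) normc (phi x))%R)%:E <= \int[mu]_x Psi x.
  move=> cphi mPsi Psi0 le.
  have Iphi := integrable_normc cphi.
  rewrite /Rintegral fineK; last by apply: (integrable_fin_num _ Iphi).
  apply: (@le_trans _ _ (\int[mu]_(x in `[u, v]) Psi x)).
    apply: ge0_le_integral => //.
    - by move=> x _; rewrite lee_fin normc_ge0.
    - exact: (measurable_int mu Iphi).
    - exact: measurable_funTS.
  by apply: ge0_subset_integral.
have mx t : measurable_fun (setT : set TR) (fun x : TR => Phi (x, t)).
  exact: (measurableT_comp mPhi (pair2_measurable t)).
have my t : measurable_fun (setT : set TR) (fun y : TR => Phi (t, y)).
  exact: (measurableT_comp mPhi (pair1_measurable t)).
have hx y : (c <= y <= d)%R -> (edgex G a b y)%:E <= N y.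
  move=> ycd; apply: Rle => //; first exact: (continuous_on_hor cG).
  by move=> x xab; apply: GPhi; exact: inr.
have hy x : (a <= x <= b)%R -> (edgey G c d x)%:E <= M x.
  move=> xab; apply: Rle => //; first exact: (continuous_on_ver cG).
  by move=> y ycd; apply: GPhi; exact: inr.
have aa : (a <= a <= b)%R by rewrite lexx.
have bb : (a <= b <= b)%R by rewrite lexx ab.
have cc : (c <= c <= d)%R by rewrite lexx.
have dd : (c <= d <= d)%R by rewrite lexx cd.
have := le_trans (hx c cc) Nc; have := le_trans (hx d dd) Nd.
have := le_trans (hy a aa) Ma; have := le_trans (hy b bb) Mb; rewrite !lee_fin.
have := @rectint_mean_le G (p1 +i* p2) a b c d (r / 2)%R r2 hR i1 i2 i3 i4; rewrite -/s.
move: (edgex _ _ _ _) (edgex _ _ _ _) (edgey _ _ _ _) (edgey _ _ _ _) (normc _).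
move=> x1 x2 y1 y2 n.
have -> : (2 * (r / 2) * n = r * n)%R by field.
have -> : ((s + e * (r ^+ 2 / 8)) / (r / 2) = 2 / r * s + e * r / 4)%R by field; rewrite gt_eqF.
move=> H H1 H2 H3 H4; rewrite -(ler_pM2l r0).
have -> : (r * (8 / r ^+ 2 * s + e) = 4 * (2 / r * s + e * r / 4))%R.
  by field; rewrite gt_eqF.
move: H H1 H2 H3 H4; clear; lra.
Qed.

Local Notation mu4 := (((mu \x mu) \x mu) \x mu).

(** The area bound for the holomorphic function [h^2], used in each variable
    in turn. *)
Lemma normc2_le_integral4 (h : R[i] -> R[i] -> R[i]) p q (r s : R)
    (Psi : TR * TR * TR * TR -> \bar R) :
  (0 < r)%R -> (0 < s)%R ->
  (forall z w, insq p r z -> insq q s w ->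
     holomorphic_at (fun z => h z w) z /\ holomorphic_at (h z) w) ->
  measurable_fun setT Psi -> (forall u, 0 <= Psi u) ->
  (forall x y u v, insq p r (x +i* y) -> insq q s (u +i* v) ->
     (normc (h (x +i* y) (u +i* v)) ^+ 2)%:E <= Psi (x, y, u, v)) ->
  (normc (h p q) ^+ 2)%:E <= (8 / r ^+ 2 * (8 / s ^+ 2))%:E * \int[mu4]_x Psi x.
Proof.
move=> r0 s0 hh mPsi Psi0 hPsi.
have qs : insq q s q by apply: insq_center; exact: ltW.
have [mF2 F20 ->] := @tonelli4 _ _ _ _ TR TR TR TR R mu mu mu mu Psi mPsi Psi0.
set F2 := inner_integral mu mu Psi in mF2 F20 *.
have k0 (t : R) : (0 < t)%R -> (0 <= 8 / t ^+ 2)%R.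
  by move=> t0; rewrite divr_ge0// exprn_ge0// ltW.
pose Phi xy := (8 / s ^+ 2)%:E * F2 xy.
have mPhi : measurable_fun setT Phi by exact: measurable_funeM.
have -> : (8 / r ^+ 2 * (8 / s ^+ 2))%:E * \int[mu]_x \int[mu]_y F2 (x, y) =
    (8 / r ^+ 2)%:E * \int[mu]_x \int[mu]_y Phi (x, y).
  rewrite EFinM -muleA; congr (_ * _).
  under [RHS]eq_integral => x _.
    rewrite (@ge0_integralZl_EFin _ TR R mu setT _ (fun y => F2 (x, y))) ?k0//; last first.
      exact: (measurableT_comp mF2 (pair1_measurable x)).
    over.
  rewrite ge0_integralZl_EFin ?k0//; first by move=> x _; exact: integral_ge0.
  exact: (@measurable_fun_fubini_tonelli_F _ _ TR TR R mu F2).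
rewrite -normcX.
apply: (@normc_le_integral (fun z => h z q ^+ 2)%R p r Phi r0) => //.
- move=> z zr; have [H _] := hh z q zr qs; exact: holomorphicM.
- by move=> u; rewrite mule_ge0// lee_fin k0.
move=> x y xy; rewrite /Phi.
apply: (@normc_le_integral (fun w => h (x +i* y) w ^+ 2)%R q s (fun uv => Psi (x, y, uv.1, uv.2)) s0) => //.
- move=> w ws; have [_ H] := hh _ w xy ws; exact: holomorphicM.
- apply: (measurableT_comp mPsi).
  apply/measurable_fun_pairP; split; last exact: measurable_snd.
  apply/measurable_fun_pairP; split; last exact: measurable_fst.
  exact: measurable_cst.
by move=> u v uv; rewrite normcX; exact: hPsi.
Qed.

End PlaneIntegrals.

(** * Cauchy-Schwarz and Riesz representation in a complete space *)

Lemma quadratic_ge0_eq0 (R : realType) (c D : R) : 0 <= c ->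
  (forall t, 0 <= 2 * t * D + t ^+ 2 * c) -> D = 0.
Proof.
move=> c0 quad; apply/eqP/negPn/negP => D0.
have cp : 0 < c + 1 by rewrite ltr_wpDl.
have c1 : c + 1 != 0 by rewrite gt_eqF.
have D2 : 0 < D ^+ 2 by rewrite exprn_even_gt0.
have := quad (- D / (c + 1)).
have -> : 2 * (- D / (c + 1)) * D + (- D / (c + 1)) ^+ 2 * c =
   - (D ^+ 2 * (c + 2) / (c + 1) ^+ 2) by field.
by rewrite oppr_ge0 leNgt divr_gt0 ?exprn_gt0// mulr_gt0// ltr_wpDl.
Qed.

Section Hilbert.
Context {R : realType} (V : lmodType R[i]) (P : set V) (ip : V -> V -> R[i]).
Hypothesis P_comb : forall a u v, P u -> P v -> P (a *: u + v).
Hypothesis ip_comb : forall a u v w, P u -> P v -> P w ->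
  ip (a *: u + v) w = a * ip u w + ip v w.
Hypothesis ip_conj : forall u v, P u -> P v -> ip v u = conjc (ip u v).
Hypothesis ip_ge0 : forall u, P u -> 0 <= complex.Re (ip u u).
Hypothesis P0 : P 0.
Hypothesis complete : forall u : nat -> V, (forall n, P (u n)) ->
  (forall e : R, 0 < e -> exists N, forall m n, (N <= m)%N -> (N <= n)%N ->
     complex.Re (ip (u m - u n) (u m - u n)) <= e) ->
  exists2 l, P l & forall e : R, 0 < e -> exists N, forall n, (N <= n)%N ->
     complex.Re (ip (u n - l) (u n - l)) <= e.
Implicit Types (a : R[i]) (u v w h k : V).

Local Notation N u := (complex.Re (ip u u)).

Lemma P_add u v : P u -> P v -> P (u + v).
Proof. by move=> Pu Pv; rewrite -(scale1r u); exact: P_comb. Qed.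

Lemma P_scale a u : P u -> P (a *: u).
Proof. by move=> Pu; rewrite -[_ *: u]addr0; exact: P_comb. Qed.

Lemma P_sub u v : P u -> P v -> P (u - v).
Proof. by move=> Pu Pv; rewrite addrC -scaleN1r; exact: P_comb. Qed.

Lemma ip_add u v w : P u -> P v -> P w -> ip (u + v) w = ip u w + ip v w.
Proof. by move=> Pu Pv Pw; rewrite -{1}(scale1r u) ip_comb// mul1r. Qed.

Lemma ip_0l w : P w -> ip 0 w = 0.
Proof.
move=> Pw; have := ip_add P0 P0 Pw; rewrite addr0 => /eqP.
by rewrite -{1}[ip 0 w]addr0 eq_sym => /eqP /addrI.
Qed.

Lemma ip_scale a u w : P u -> P w -> ip (a *: u) w = a * ip u w.
Proof. by move=> Pu Pw; rewrite -[_ *: u]addr0 ip_comb// ip_0l// addr0. Qed.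

Lemma ip_sub u v w : P u -> P v -> P w -> ip (u - v) w = ip u w - ip v w.
Proof.
by move=> Pu Pv Pw; rewrite addrC -scaleN1r ip_comb// mulN1r addrC.
Qed.

Lemma ip_addr u v w : P u -> P v -> P w -> ip w (u + v) = ip w u + ip w v.
Proof.
move=> Pu Pv Pw; have Puv := P_add Pu Pv.
by rewrite (ip_conj Puv Pw) ip_add// rmorphD /= -!ip_conj.
Qed.

Lemma ip_scaler a u w : P u -> P w -> ip w (a *: u) = conjc a * ip w u.
Proof.
move=> Pu Pw; have Pa := P_scale a Pu.
by rewrite (ip_conj Pa Pw) ip_scale// rmorphM /= -ip_conj.
Qed.

Lemma ip_subr u v w : P u -> P v -> P w -> ip w (u - v) = ip w u - ip w v.
Proof.
move=> Pu Pv Pw; have Puv := P_sub Pu Pv.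
by rewrite (ip_conj Puv Pw) ip_sub// rmorphB /= -!ip_conj.
Qed.

Lemma ip_self u : P u -> ip u u = (N u)%:C.
Proof.
move=> Pu; have := ip_conj Pu Pu; case: (ip u u) => x y /= [] E.
by congr (_ +i* _); lra.
Qed.

Lemma Re_ip_sym u v : P u -> P v -> complex.Re (ip v u) = complex.Re (ip u v).
Proof. by move=> Pu Pv; rewrite (ip_conj Pu Pv); case: (ip u v). Qed.

Lemma N_comb (t : R) u v : P u -> P v ->
  N (u + t%:C *: v) = N u + 2 * t * complex.Re (ip u v) + t ^+ 2 * N v.
Proof.
move=> Pu Pv; have Pt := P_scale t%:C Pv.
rewrite ip_add// ?ip_addr//; last exact: P_add.
rewrite !ip_scale// !ip_scaler// (ip_conj Pu Pv) (ip_self Pu) (ip_self Pv).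
by move: (N u) (N v) => c d; case: (ip u v) => x y /=; ring.
Qed.

Lemma N_sub_add u v : P u -> P v -> N (u - v) + N (u + v) = 2 * N u + 2 * N v.
Proof.
move=> Pu Pv; have := N_comb 1 Pu Pv; have := N_comb (-1) Pu Pv.
by rewrite !rmorphN !rmorph1 scaleN1r scale1r => -> ->; ring.
Qed.

Lemma Re_cauchy_schwarz u v : P u -> P v ->
  complex.Re (ip u v) ^+ 2 <= N u * N v.
Proof.
move=> Pu Pv.
have H t : 0 <= N u + 2 * t * complex.Re (ip u v) + t ^+ 2 * N v.
  by rewrite -N_comb//; apply: ip_ge0; apply: P_add => //; exact: P_scale.
move: (complex.Re (ip u v)) (N u) (N v) H (ip_ge0 Pu) (ip_ge0 Pv) => b a c H a0 c0.
have [c00|cn0] := eqVneq c 0.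
  have [->|b0] := eqVneq b 0; first by rewrite expr0n /= mulr_ge0.
  have := H (- (a + 1) / (2 * b)); rewrite c00 mulr0 addr0.
  have -> : a + 2 * (- (a + 1) / (2 * b)) * b = -1 by field.
  by rewrite oppr_ge0 ler10.
have cp : 0 < c by rewrite lt_def cn0.
have := H (- b / c).
have -> : a + 2 * (- b / c) * b + (- b / c) ^+ 2 * c = (a * c - b ^+ 2) / c by field.
by rewrite ler_pdivlMr// mul0r subr_ge0.
Qed.

Lemma cauchy_schwarz u v : P u -> P v -> normc (ip u v) ^+ 2 <= N u * N v.
Proof.
move=> Pu Pv; have [->|c0] := eqVneq (ip u v) 0.
  by rewrite normc0 expr0n /= mulr_ge0 ?ip_ge0.
set c := ip u v in c0 *.
have n0 : 0 < normc c ^+ 2 by rewrite exprn_gt0// normc_gt0.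
have := Re_cauchy_schwarz (P_scale (conjc c) Pu) Pv.
rewrite !ip_scale//; last exact: P_scale.
rewrite ip_scaler// conjcK (ip_self Pu) -/c.
have E : conjc c * c = (normc c ^+ 2)%:C.
  by rewrite normc_sqrE; case: (c) => x y /=; simpc; congr (_ +i* _); ring.
rewrite mulrA E -rmorphM /= => H.
rewrite -(ler_pM2l n0) -expr2; apply: (le_trans H).
by rewrite mulrA.
Qed.

(** Minimizing [N u - 2 Re (lam u)]: by the parallelogram identity a minimizing
    sequence is Cauchy, and the vanishing of the first variation at the limit says
    that the real part of [lam] is represented.  The imaginary part follows on
    multiplying by ['i]. *)
Lemma riesz (lam : V -> R[i]) (C : R) :
  (forall a u v, P u -> P v -> lam (a *: u + v) = a * lam u + lam v) ->
  (forall u, P u -> normc (lam u) ^+ 2 <= C * N u) ->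
  exists2 k, P k & forall h, P h -> lam h = ip h k.
Proof.
move=> lamE lamC.
have lam0 : lam 0 = 0.
  have := lamE 1 0 0 P0 P0; rewrite scale1r mul1r addr0 => /eqP.
  by rewrite -{1}[lam 0]addr0 eq_sym => /eqP /addrI.
have lamD u v : P u -> P v -> lam (u + v) = lam u + lam v.
  by move=> Pu Pv; rewrite -{1}(scale1r u) lamE// mul1r.
have lamZ a u : P u -> lam (a *: u) = a * lam u.
  by move=> Pu; rewrite -[_ *: u]addr0 lamE// lam0 addr0.
pose J u := N u - 2 * complex.Re (lam u).
have J_lb u : P u -> - `|C| <= J u.
  move=> Pu; have Nu := ip_ge0 Pu; have := lamC u Pu.
  have := normc_ge_absRe (lam u); rewrite /J => L.
  have : C * N u <= `|C| * N u by rewrite ler_wpM2r// ler_norm.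
  have := normr_ge0 C; have : complex.Re (lam u) <= normc (lam u) := le_trans (ler_norm _) L.
  move: (normc_ge0 (lam u)) Nu; move: (N u) (normc (lam u)) (complex.Re (lam u)) (`|C|) (C * N u).
  clear => a b c d e b0 a0 cb d0 ed be.
  have : b * 2 <= a + d.
    rewrite -(@ler_pXn2r _ 2) ?nnegrE ?mulr_ge0 ?addr_ge0//.
    have := sqr_ge0 (a - d); nra.
  lra.
pose S := [set J u | u in P].
have hS : has_inf S by split; [exists (J 0), 0|exists (- `|C|) => _ [u Pu <-]; exact: J_lb].
pose m := inf S.
have mJ u : P u -> m <= J u by move=> Pu; apply: ge_inf => //; [exact: hS.2|exists u].
have /choice[u Hu] : forall n : nat, exists u, P u /\ J u <= m + n.+1%:R^-1.
  move=> n; have n0 : 0 < n.+1%:R^-1 :> R by rewrite invr_gt0.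
  by have [_ [v Pv <-] vm] := inf_adherent n0 hS; exists v; split => //; exact: ltW.
have Pu n : P (u n) by have [] := Hu n.
have uJ n : J (u n) <= m + n.+1%:R^-1 by have [] := Hu n.
have eps (e : R) : 0 < e -> exists n0 : nat, forall n, (n0 <= n)%N -> n.+1%:R^-1 <= e.
  move=> e0; exists (Num.truncn e^-1) => n nn.
  rewrite -[e]invrK lef_pV2 ?posrE ?invr_gt0//.
  by apply/ltW/(lt_le_trans (truncnS_gt _)); rewrite ler_nat ltnS.
have par v w : P v -> P w -> N (v - w) <= 2 * (J v - m) + 2 * (J w - m).
  move=> Pv Pw; have Pvw := P_add Pv Pw.
  have := mJ _ (P_scale (2^-1)%:C Pvw); have := N_sub_add Pv Pw.
  rewrite /J lamZ// lamD//.
  have := N_comb 2^-1 P0 Pvw; rewrite !add0r !ip_0l//= mulr0 !add0r => ->.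
  have -> : complex.Re ((2^-1)%:C * (lam v + lam w)) =
     (complex.Re (lam v) + complex.Re (lam w)) / 2.
    by case: (lam v) => ? ?; case: (lam w) => ? ? /=; ring.
  rewrite exprVn; lra.
have [k Pk Hk] : exists2 l, P l & forall e : R, 0 < e -> exists n0, forall n, (n0 <= n)%N ->
     N (u n - l) <= e.
  apply: complete => // e e0; have e4 : 0 < e / 4 by rewrite divr_gt0.
  have [n0 Hn] := eps _ e4; exists n0 => i j /Hn ei /Hn ej.
  apply: (le_trans (par _ _ (Pu i) (Pu j))).
  move: (uJ i) (uJ j) ei ej; move: (i.+1%:R^-1) (j.+1%:R^-1) (J (u i)) (J (u j)).
  by move=> *; lra.
have Rek h : P h -> complex.Re (lam h) = complex.Re (ip h k).
  move=> Ph; rewrite (Re_ip_sym Pk Ph).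
  pose D := complex.Re (ip k h) - complex.Re (lam h).
  have quad (t : R) : 0 <= 2 * t * D + t ^+ 2 * N h.
    apply/ler_addgt0Pl => e e0.
    pose T := 2 * `|t| + 1.
    have T0 : 0 < T by rewrite ltr_wpDl// mulr_ge0.
    have e2 : 0 < e / 2 by rewrite divr_gt0.
    pose d := (e / (2 * T)) ^+ 2 / (N h + 1).
    have Nh1 : 0 < N h + 1 by rewrite ltr_wpDl ?ip_ge0.
    have eT : 0 < e / (2 * T) by rewrite divr_gt0// mulr_gt0.
    have d0 : 0 < d by rewrite divr_gt0// exprn_gt0.
    have [n1 Hn1] := eps _ e2; have [n2 Hn2] := Hk _ d0.
    pose n := maxn n1 n2.
    have A1 := Hn1 n (leq_maxl _ _); have A2 := Hn2 n (leq_maxr _ _).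
    have CS := Re_cauchy_schwarz (P_sub (Pu n) Pk) Ph.
    have B : `|complex.Re (ip (u n - k) h)| <= e / (2 * T).
      rewrite -(@ler_pXn2r _ 2) ?nnegrE ?normr_ge0 ?(ltW eT)// real_normK ?num_real//.
      apply: (le_trans CS); apply: (@le_trans _ _ (d * (N h + 1))).
        by apply: ler_pM; rewrite ?ip_ge0 ?lerDl//; exact: P_sub.
      by rewrite /d divfK// gt_eqF.
    have := mJ _ (P_add (Pu n) (P_scale t%:C Ph)).
    rewrite /J N_comb// lamD//; last exact: P_scale.
    rewrite lamZ//.
    have -> : complex.Re (lam (u n) + t%:C * lam h) = complex.Re (lam (u n)) + t * complex.Re (lam h).
      by case: (lam (u n)) => ? ?; case: (lam h) => ? ? /=; ring.
    have := uJ n; rewrite /J.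
    have E : complex.Re (ip (u n) h) = complex.Re (ip k h) + complex.Re (ip (u n - k) h).
      by rewrite ip_sub//; case: (ip (u n) h) => ? ?; case: (ip k h) => ? ? /=; ring.
    rewrite E /D.
    have B2 : 2 * t * complex.Re (ip (u n - k) h) <= e / 2.
      apply: (le_trans (ler_norm _)); rewrite !normrM (ger0_norm (ler0n _ 2)).
      have : 2 * `|t| * `|complex.Re (ip (u n - k) h)| <= T * (e / (2 * T)).
        by apply: ler_pM => //; rewrite ?mulr_ge0// /T lerDl.
      have -> : T * (e / (2 * T)) = e / 2 by field; rewrite gt_eqF.
      by [].
    move: A1 B2; move: (complex.Re (ip (u n - k) h)) (complex.Re (ip k h)) (complex.Re (lam h)).
    move: (complex.Re (lam (u n))) (N (u n)) (N h) (n.+1%:R^-1).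
    move=> *; lra.
  suff : D = 0 by rewrite /D => /eqP; rewrite subr_eq0 => /eqP.
  exact: quadratic_ge0_eq0 (ip_ge0 Ph) quad.
exists k => // h Ph; have := Rek _ Ph; have := Rek _ (P_scale 'i Ph).
rewrite lamZ// ip_scale//; case: (lam h) => x y; case: (ip h k) => x' y' /=.
by rewrite !mul0r !mul1r => + ->; rewrite !sub0r => /oppr_inj ->.
Qed.

End Hilbert.

(** * Complex differentiability in two variables *)

Section TwoComplexVariables.
Context {R : realType}.
Implicit Types (p q : C2 R) (h : C2 R -> R[i]) (l m a b z w : R[i]) (e r : R).

Lemma ball_normc (c z : R[i]^o) e : ball c e%:C z <-> normc (z - c) < e.
Proof. by rewrite -ball_normE /ball_ normcB -ltcR -norm_normc. Qed.

Lemma nbhs_C2P p (P : C2 R -> Prop) :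
  (\forall q \near p, P q) <->
  exists2 r : R, 0 < r & forall q, normc (q.1 - p.1) < r -> normc (q.2 - p.2) < r -> P q.
Proof.
split.
  move/nbhs_ballP => [[e e']] /= /[!ltcE] /= /andP[/eqP -> e0] H.
  exists e => // q q1 q2; have {}H : ball p e%:C `<=` P := H.
  by apply: H; split; apply/ball_normc.
move=> [r r0 H]; apply/nbhs_ballP; exists r%:C; first by rewrite /= ltcR.
by move=> q [/ball_normc q1 /ball_normc q2]; apply: H.
Qed.

Lemma prod_normc q : `|q| = (Num.max (normc q.1) (normc q.2))%:C.
Proof.
rewrite prod_normE !norm_normc /Order.max ltcR.
by case: ifP.
Qed.

Lemma prod_norm_ge1 q : (normc q.1)%:C <= `|q|.
Proof. by rewrite prod_normc lecR le_max lexx. Qed.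

Lemma prod_norm_ge2 q : (normc q.2)%:C <= `|q|.
Proof. by rewrite prod_normc lecR le_max lexx orbT. Qed.

Lemma prod_norm_le q : `|q| <= (normc q.1 + normc q.2)%:C.
Proof. by rewrite prod_normc lecR ge_max lerDl lerDr !normc_ge0. Qed.

Definition has_cderiv2 h p l m := forall e : R, 0 < e -> exists2 r : R, 0 < r &
  forall q, normc (q.1 - p.1) < r -> normc (q.2 - p.2) < r ->
  normc (h q - h p - l * (q.1 - p.1) - m * (q.2 - p.2)) <=
    e * (normc (q.1 - p.1) + normc (q.2 - p.2)).

Definition cpartial (j : 'I_2) h p : R[i] := 'd (h : C2 R -> R[i]^o) p (basis_vector j).

Lemma differentiable_has_cderiv2 h p : differentiable (h : C2 R -> R[i]^o) p ->
  has_cderiv2 h p (cpartial 0 h p) (cpartial 1 h p).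
Proof.
  rewrite /cpartial /basis_vector /=.
  move=> /diff_locallyP [_ /eqaddoP H].
  move=> e e0.
  have /H/nbhs_C2P[r r0 Hr] : 0 < e%:C by rewrite ltcR.
  exists r => // q q1 q2.
  have := Hr (q - p); rewrite /= !subr0 => /(_ q1 q2).
  rewrite !fctE /= subrK.
  have -> : 'd (h : C2 R -> R[i]^o) p (q - p) =
      'd (h : C2 R -> R[i]^o) p (1, 0) * (q.1 - p.1) +
      'd (h : C2 R -> R[i]^o) p (0, 1) * (q.2 - p.2).
    have E (a b : R[i]) : ((a, b) : C2 R) = a *: ((1, 0) : C2 R) + b *: ((0, 1) : C2 R).
      congr (_, _).
        by transitivity (a * 1 + b * 0); [ring|].
      by transitivity (a * 0 + b * 1); [ring|].
    have {1}-> : q - p = (q.1 - p.1) *: ((1, 0) : C2 R) + (q.2 - p.2) *: ((0, 1) : C2 R).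
      by rewrite -E.
    by rewrite linearD !linearZ /= mulrC [X in _ + X]mulrC.
  rewrite opprD addrA opprD addrA norm_normc => L.
  have e0' : 0 <= e%:C by rewrite ler0c ltW.
  have := le_trans L (ler_wpM2l e0' (prod_norm_le (q - p))).
  by rewrite -rmorphM lecR.
Qed.

(** Separate epsilon estimates in the two coordinates give the
    little-o of the product norm, which is their maximum. *)
Lemma has_cderiv2_differentiable h p l m : has_cderiv2 h p l m ->
  differentiable (h : C2 R -> R[i]^o) p.
Proof.
move=> H.
pose df (q : C2 R) : R[i]^o := l * q.1 + m * q.2.
have df_lin : linear df.
  move=> a u v; rewrite /df /= -[a *: u.1]/(a * u.1) -[a *: u.2]/(a * u.2).
  by rewrite -[a *: _]/(a * _); ring.
pose dfM := GRing.isLinear.Build _ _ _ _ df df_lin.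
pose Df : {linear C2 R -> R[i]^o} := HB.pack df dfM.
have Dfc : continuous (Df : C2 R -> R[i]^o).
  move=> q; apply/cvg_normcP => e e0.
  pose K := normc l + normc m + 1.
  have K0 : 0 < K by rewrite ltr_wpDl// addr_ge0 ?normc_ge0.
  apply/nbhs_C2P; exists (e / K); first by rewrite divr_gt0.
  move=> x x1 x2; rewrite /= /df.
  have -> : l * x.1 + m * x.2 - (l * q.1 + m * q.2) = l * (x.1 - q.1) + m * (x.2 - q.2) by ring.
  apply: (le_lt_trans (le_normcD _ _)); rewrite !normcM.
  have B1 := ler_wpM2l (normc_ge0 l) (ltW x1).
  have B2 := ler_wpM2l (normc_ge0 m) (ltW x2).
  apply: (le_lt_trans (lerD B1 B2)); rewrite -mulrDl.
  by rewrite mulrA ltr_pdivrMr// mulrC ltr_pM2l// /K ltrDl.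
have E : (h : C2 R -> R[i]^o) \o shift p = cst (h p : R[i]^o) + Df +o_ 0 id.
  apply/eqaddoP => -[e e'] /= /[!ltcE] /= /andP[/eqP -> e0].
  have e2 : 0 < e / 2 by rewrite divr_gt0.
  have [r r0 Hr] := H _ e2; apply/nbhs_C2P; exists r => // q.
  rewrite /= !subr0 => q1 q2; have := Hr (q + p); rewrite /= !addrK => /(_ q1 q2).
  rewrite !fctE /= norm_normc => L.
  rewrite opprD addrA /df opprD addrA.
  apply: (@le_trans _ _ ((e / 2 * (normc q.1 + normc q.2))%:C)); first by rewrite lecR.
  rewrite rmorphM rmorphD /=.
  apply: (@le_trans _ _ ((e / 2)%:C * (`|q| + `|q|))).
    by apply: ler_wpM2l; [rewrite ler0c ltW|rewrite lerD ?prod_norm_ge1 ?prod_norm_ge2].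
  have -> : e +i* 0 = (e / 2)%:C + (e / 2)%:C by rewrite -rmorphD /= -splitr.
  by rewrite mulrDr mulrDl.
have D : 'd (h : C2 R -> R[i]^o) p = Df :> (C2 R -> R[i]^o) by apply: diff_unique.
by apply/diff_locallyP; rewrite D.
Qed.

Lemma has_cderiv2_fst h p l m : has_cderiv2 h p l m ->
  has_cderiv (fun z => h (z, p.2)) p.1 l.
Proof.
move=> H e e0; have [r r0 Hr] := H e e0; exists r => // z zp.
have := Hr (z, p.2); rewrite /= subrr normc0 mulr0 subr0 addr0 => /(_ zp r0).
by case: p {H Hr zp} => p1 p2.
Qed.

Lemma has_cderiv2_snd h p l m : has_cderiv2 h p l m ->
  has_cderiv (fun w => h (p.1, w)) p.2 m.
Proof.
move=> H e e0; have [r r0 Hr] := H e e0; exists r => // z zp.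
have := Hr (p.1, z); rewrite /= subrr normc0 mulr0 subr0 add0r => /(_ r0 zp).
by case: p {H Hr zp} => p1 p2.
Qed.

Lemma holomorphic_separately Om h p r : holomorphic_on Om h ->
  (forall q, insq p.1 r q.1 -> insq p.2 r q.2 -> Om q) ->
  separately_holomorphic (fun z w => h (z, w)) p.1 p.2 r.
Proof.
move=> hh box z w zr wr; have /hh/differentiable_has_cderiv2 H := box (z, w) zr wr.
split; apply/holomorphic_atP; eexists.
  exact: (has_cderiv2_fst H).
exact: (has_cderiv2_snd H).
Qed.

End TwoComplexVariables.

(** * Square integrable functions *)

Section SquareIntegrable.
Context d (T : measurableType d) {R : realType} (mu : {measure set T -> \bar R}).
Variables (D : set T) (mD : measurable D).
Implicit Types (f g k : T -> R[i]).

Definition L2 f := [/\ measurable_fun D (fun x => complex.Re (f x)),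
  measurable_fun D (fun x => complex.Im (f x)) &
  mu.-integrable D (fun x => (normc (f x) ^+ 2)%:E)].

Definition L2ip f g : R[i] :=
  (\int[mu]_(x in D) complex.Re (f x * conjc (g x))) +i*
  (\int[mu]_(x in D) complex.Im (f x * conjc (g x))).

Lemma measurable_normc2 f : measurable_fun D (fun x => complex.Re (f x)) ->
  measurable_fun D (fun x => complex.Im (f x)) ->
  measurable_fun D (fun x => normc (f x) ^+ 2).
Proof.
move=> mr mi; rewrite (_ : (fun x => normc (f x) ^+ 2) =
  (fun x => complex.Re (f x) * complex.Re (f x) + complex.Im (f x) * complex.Im (f x))).
  by apply: measurable_funD; exact: measurable_funM.
by apply/funext => x; rewrite normc_sqrE !expr2.
Qed.

Lemma L2_le f (G : T -> R) : measurable_fun D (fun x => complex.Re (f x)) ->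
  measurable_fun D (fun x => complex.Im (f x)) ->
  mu.-integrable D (EFin \o G) -> (forall x, D x -> normc (f x) ^+ 2 <= G x) -> L2 f.
Proof.
move=> mr mi iG fG; split => //; apply: le_integrable iG => //.
  by apply/measurable_EFinP; exact: measurable_normc2.
move=> x Dx; rewrite /= lee_fin ger0_norm ?sqr_ge0//.
by apply: (le_trans (fG x Dx)); exact: ler_norm.
Qed.

Lemma normc_sqrD (z w : R[i]) : normc (z + w) ^+ 2 <= 2 * normc z ^+ 2 + 2 * normc w ^+ 2.
Proof.
have h := le_normcD z w.
have := normc_ge0 (z + w); have := normc_ge0 z; have := normc_ge0 w.
move: h; move: (normc (z + w)) (normc z) (normc w); clear => a b c h c0 b0 a0.
have := sqr_ge0 (b - c); nra.
Qed.

Lemma L2_comb (a : R[i]) f g : L2 f -> L2 g -> L2 (fun x => a * f x + g x).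
Proof.
move=> [fr fi f2] [gr gi g2].
have mr : measurable_fun D (fun x => complex.Re (a * f x + g x)).
  rewrite (_ : (fun x => _) = (fun x => (complex.Re a * complex.Re (f x) -
     complex.Im a * complex.Im (f x)) + complex.Re (g x))).
    apply: measurable_funD => //; apply: measurable_funB; apply: measurable_funM => //.
  by apply/funext => x; case: (a) (f x) (g x) => ? ? [? ?] [? ?].
have mi : measurable_fun D (fun x => complex.Im (a * f x + g x)).
  rewrite (_ : (fun x => _) = (fun x => (complex.Re a * complex.Im (f x) +
     complex.Im a * complex.Re (f x)) + complex.Im (g x))).
    apply: measurable_funD => //; apply: measurable_funD; apply: measurable_funM => //.
  by apply/funext => x; case: (a) (f x) (g x) => ? ? [? ?] [? ?] /=.
apply: (@L2_le _ (fun x => 2 * normc a ^+ 2 * normc (f x) ^+ 2 + 2 * normc (g x) ^+ 2)) => //.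
  have I1 := integrableZl mD (2 * normc a ^+ 2) f2.
  have I2 := integrableZl mD 2 g2.
  exact: (integrableD mD I1 I2).
move=> x _; apply: (le_trans (normc_sqrD _ _)).
by rewrite normcM exprMn mulrA.
Qed.

Lemma L2_0 : L2 (fun=> 0).
Proof.
split => //.
rewrite (_ : (fun=> _) = cst 0); first exact: integrable0.
by apply/funext => x; rewrite normc0 expr0n.
Qed.

Lemma L2_mulJ_integrable f g : L2 f -> L2 g ->
  mu.-integrable D (EFin \o (fun x => complex.Re (f x * conjc (g x)))) /\
  mu.-integrable D (EFin \o (fun x => complex.Im (f x * conjc (g x)))).
Proof.
move=> [fr fi f2] [gr gi g2].
have I := integrableD mD f2 g2.
have B (z w : R[i]) : normc (z * conjc w) <= normc z ^+ 2 + normc w ^+ 2.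
  have -> : normc (z * conjc w) = normc z * normc w.
    by rewrite normcM normc_conj.
  have := sqr_ge0 (normc z - normc w); have := normc_ge0 z; have := normc_ge0 w.
  move: (normc z) (normc w) => a b; nra.
split; apply: (le_integrable mD _ _ I).
- apply/measurable_EFinP; rewrite (_ : (fun x => _) = (fun x =>
    complex.Re (f x) * complex.Re (g x) + complex.Im (f x) * complex.Im (g x))).
    by apply: measurable_funD; exact: measurable_funM.
  by apply/funext => x; case: (f x) (g x) => ? ? [? ?] /=; ring.
- move=> x _; rewrite /= lee_fin (ger0_norm (addr_ge0 _ _)) ?sqr_ge0//.
  exact: le_trans (normc_ge_absRe _) (B _ _).
- apply/measurable_EFinP; rewrite (_ : (fun x => _) = (fun x =>
    complex.Im (f x) * complex.Re (g x) - complex.Re (f x) * complex.Im (g x))).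
    by apply: measurable_funB; exact: measurable_funM.
  by apply/funext => x; case: (f x) (g x) => ? ? [? ?] /=; ring.
- move=> x _; rewrite /= lee_fin (ger0_norm (addr_ge0 _ _)) ?sqr_ge0//.
  exact: le_trans (normc_ge_absIm _) (B _ _).
Qed.

Lemma L2ip_comb (a : R[i]) f g k : L2 f -> L2 g -> L2 k ->
  L2ip (fun x => a * f x + g x) k = a * L2ip f k + L2ip g k.
Proof.
move=> Lf Lg Lk; have [fr fi] := L2_mulJ_integrable Lf Lk.
have [gr gi] := L2_mulJ_integrable Lg Lk.
have Z (t : R) (u : T -> R) : mu.-integrable D (EFin \o u) ->
   mu.-integrable D (EFin \o (fun x => t * u x)) by move=> iu; exact: (integrableZl mD t iu).
case: a => a1 a2; rewrite /L2ip; simpc; congr (_ +i* _).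
  rewrite -!RintegralZl// -RintegralB// -?RintegralD//; try exact: Z.
    by apply: eq_Rintegral => x _; case: (f x) (g x) (k x) => ? ? [? ?] [? ?] /=; ring.
  exact: (integrableB mD (Z _ _ fr) (Z _ _ fi)).
rewrite -!RintegralZl// -!RintegralD//; try exact: Z.
  by apply: eq_Rintegral => x _; case: (f x) (g x) (k x) => ? ? [? ?] [? ?] /=; ring.
exact: (integrableD mD (Z _ _ fi) (Z _ _ fr)).
Qed.

Lemma L2ip_conj f g : L2 f -> L2 g -> L2ip g f = conjc (L2ip f g).
Proof.
move=> Lf Lg; have [gr gi] := L2_mulJ_integrable Lf Lg.
rewrite /L2ip /=; congr (_ +i* _).
  by apply: eq_Rintegral => x _; case: (f x) (g x) => ? ? [? ?] /=; ring.
rewrite -[RHS]mulN1r -RintegralZl//.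
by apply: eq_Rintegral => x _; case: (f x) (g x) => ? ? [? ?] /=; ring.
Qed.

Lemma Re_L2ip f : complex.Re (L2ip f f) = \int[mu]_(x in D) (normc (f x) ^+ 2).
Proof.
rewrite /L2ip /=; apply: eq_Rintegral => x _; rewrite normc_sqrE.
by case: (f x) => ? ? /=; ring.
Qed.

Lemma Re_L2ipE f : L2 f ->
  (complex.Re (L2ip f f))%:E = (\int[mu]_(x in D) (normc (f x) ^+ 2)%:E)%E.
Proof.
by move=> [_ _ f2]; rewrite Re_L2ip /Rintegral fineK//; exact: integrable_fin_num.
Qed.

Lemma L2_sub f g : L2 f -> L2 g -> L2 (fun x => f x - g x).
Proof.
move=> Lf Lg; rewrite (_ : (fun x => f x - g x) = (fun x => -1 * g x + f x)).
  exact: L2_comb.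
by apply/funext => x; ring.
Qed.

(** The pointwise limit is known beforehand, so that Fatou's lemma for
    [|f m - f n|^2] as [m] grows suffices; no subsequence is extracted. *)
Lemma L2_complete (f : nat -> T -> R[i]) g : (forall n, L2 (f n)) ->
  (forall x, D x -> f n x @[n --> \oo] --> (g x : R[i]^o)) ->
  (forall e : R, 0 < e -> exists N, forall m n, (N <= m)%N -> (N <= n)%N ->
    complex.Re (L2ip (fun x => f m x - f n x) (fun x => f m x - f n x)) <= e) ->
  L2 g /\ (forall e : R, 0 < e -> exists N, forall n, (N <= n)%N ->
    complex.Re (L2ip (fun x => f n x - g x) (fun x => f n x - g x)) <= e).
Proof.
move=> Lf fg Cf.
have mr : measurable_fun D (fun x => complex.Re (g x)).
  apply: (@measurable_fun_cvg _ _ _ _ (fun n x => complex.Re (f n x))).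
    by move=> n; have [] := Lf n.
  move=> x Dx; exact: (cvg_comp _ _ (fg x Dx) (@continuous_Re R (g x))).
have mi : measurable_fun D (fun x => complex.Im (g x)).
  apply: (@measurable_fun_cvg _ _ _ _ (fun n x => complex.Im (f n x))).
    by move=> n; have [] := Lf n.
  move=> x Dx; exact: (cvg_comp _ _ (fg x Dx) (@continuous_Im R (g x))).
have key e n0 : (forall m n, (n0 <= m)%N -> (n0 <= n)%N ->
    complex.Re (L2ip (fun x => f m x - f n x) (fun x => f m x - f n x)) <= e) ->
    forall n, (n0 <= n)%N ->
    (\int[mu]_(x in D) (normc (f n x - g x) ^+ 2)%:E <= e%:E)%E.
  move=> H n nn0.
  pose u (m : nat) x : \bar R := (normc (f n x - f (m + n0)%N x) ^+ 2)%:E.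
  have mu_ m : measurable_fun D (u m).
    by have [? ? _] := L2_sub (Lf n) (Lf (m + n0)%N); apply/measurable_EFinP; exact: measurable_normc2.
  have u0 m x : D x -> (0 <= u m x)%E by move=> _; rewrite lee_fin sqr_ge0.
  have lim x : D x -> limn_einf (u ^~ x) = (normc (f n x - g x) ^+ 2)%:E.
    move=> Dx; suff : u m x @[m --> \oo] --> (normc (f n x - g x) ^+ 2)%:E.
      by move/cvg_limn_einf_sup => [-> _].
    apply: cvg_EFin; first by near=> m.
    have c1 : f (m + n0)%N x @[m --> \oo] --> (g x : R[i]^o).
      by rewrite (cvg_shiftn n0 (fun m => f m x : R[i]^o)); exact: fg.
    have c2 : (f n x - f (m + n0)%N x) @[m --> \oo] --> (f n x - g x : R[i]^o).
      apply/cvg_normcP => e' e'0; move/cvg_normcP: c1 => /(_ e' e'0).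
      apply: filterS => m; rewrite normcB.
      by congr (normc _ < _); ring.
    have c3 : normc (f n x - f (m + n0)%N x) @[m --> \oo] --> normc (f n x - g x).
      exact: (cvg_comp _ _ c2 (@continuous_normc R (f n x - g x))).
    exact: (cvgM c3 c3).
  have -> : (\int[mu]_(x in D) (normc (f n x - g x) ^+ 2)%:E =
      \int[mu]_(x in D) limn_einf (u ^~ x))%E.
    by apply: eq_integral => x; rewrite inE => /lim ->.
  apply: (le_trans (fatou _ mD mu_ u0)).
  rewrite limn_einf_lim; apply: lime_le; first exact: is_cvg_einfs.
  near=> m; apply: (@le_trans _ _ (\int[mu]_(x in D) u m x)%E).
    by apply: ereal_inf_lbound; exists m => //=.
  rewrite -Re_L2ipE; last exact: L2_sub.
  by rewrite lee_fin; apply: H => //; rewrite leq_addl.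
have Ls : forall n0 e, (forall m n, (n0 <= m)%N -> (n0 <= n)%N ->
    complex.Re (L2ip (fun x => f m x - f n x) (fun x => f m x - f n x)) <= e) ->
    L2 (fun x => f n0 x - g x).
  move=> n0 e /key/(_ n0 (leqnn _)) H.
  have sr : measurable_fun D (fun x => complex.Re (f n0 x - g x)).
    rewrite (_ : (fun x => _) = (fun x => complex.Re (f n0 x) - complex.Re (g x))).
      by apply: measurable_funB => //; have [] := Lf n0.
    by apply/funext => x; case: (f n0 x) (g x) => ? ? [? ?].
  have si : measurable_fun D (fun x => complex.Im (f n0 x - g x)).
    rewrite (_ : (fun x => _) = (fun x => complex.Im (f n0 x) - complex.Im (g x))).
      by apply: measurable_funB => //; have [] := Lf n0.
    by apply/funext => x; case: (f n0 x) (g x) => ? ? [? ?].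
  split => //; apply/integrableP; split.
    by apply/measurable_EFinP; exact: measurable_normc2.
  under eq_integral do rewrite gee0_abs ?lee_fin ?sqr_ge0//.
  by apply: (le_lt_trans H); rewrite ltry.
have [n1 Hn1] := Cf 1 ltr01.
have Lg : L2 g.
  rewrite (_ : g = (fun x => -1 * (f n1 x - g x) + f n1 x)).
    by apply: L2_comb => //; exact: Ls Hn1.
  by apply/funext => x; ring.
split => // e e0; have [n0 Hn0] := Cf e e0; exists n0 => n nn0.
rewrite -lee_fin Re_L2ipE; last exact: L2_sub.
exact: key Hn0 n nn0.
Unshelve. all: by end_near. Qed.

End SquareIntegrable.

(** * Locally uniform limits of holomorphic functions *)

Section LocallyUniformLimits.
Context {R : realType}.
Implicit Types (p q : C2 R) (h : C2 R -> R[i]) (l m a b z w : R[i]) (e r M : R).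
Implicit Types (u v : nat -> R[i]).

Definition ccauchy u := forall e, 0 < e -> exists N, forall m n : nat, (N <= m)%N -> (N <= n)%N ->
  normc (u m - u n) <= e.

(** Total, so that limits can be taken without a proof of convergence. *)
Definition clim u : R[i] := lim (complex.Re (u n) @[n --> \oo]) +i* lim (complex.Im (u n) @[n --> \oo]).

Lemma ccauchy_cvg u : ccauchy u -> u n @[n --> \oo] --> (clim u : R[i]^o).
Proof.
move=> cu.
have real (P : R[i] -> R) : (forall z w, P (z - w) = P z - P w) ->
    (forall z, `|P z| <= normc z) -> cvgn (fun n => P (u n)).
  move=> PB Pn; apply/cauchy_cvgP; apply: cauchy_exP => e e0.
  have e2 : 0 < e / 2 by rewrite divr_gt0.
  have [N HN] := cu _ e2; exists (P (u N)); exists N => // n /= Nn.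
  rewrite /ball /= -PB; apply: (le_lt_trans (Pn _)).
  by apply: (le_lt_trans (HN _ _ (leqnn N) Nn)); rewrite gtr_pMr// invf_lt1// ltr1n.
have cR : cvgn (fun n => complex.Re (u n)).
  by apply: real; [move=> [? ?] [? ?]|exact: normc_ge_absRe].
have cI : cvgn (fun n => complex.Im (u n)).
  by apply: real; [move=> [? ?] [? ?]|exact: normc_ge_absIm].
apply/cvg_normcP => e e0; have e2 : 0 < e / 2 by rewrite divr_gt0.
move/cvgrPdist_lt : cR => /(_ _ e2) cR; move/cvgrPdist_lt : cI => /(_ _ e2) cI.
apply: filterS2 cR cI => n; rewrite distrC [X in _ -> X < _ -> _]distrC => cR cI.
apply: (le_lt_trans (normc_le_ReIm _)); rewrite /clim.
by case: (u n) cR cI => x y /= cR cI; rewrite [e]splitr ltrD.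
Qed.

Definition ccvg u l := u n @[n --> \oo] --> (l : R[i]^o).

Lemma ccvgB u v l m : ccvg u l -> ccvg v m -> ccvg (fun n => u n - v n) (l - m).
Proof.
exact: (@cvgB _ (R[i]^o) _ \oo _ (u : nat -> R[i]^o) (v : nat -> R[i]^o)).
Qed.

Lemma ccvgMl u l a : ccvg u l -> ccvg (fun n => u n * a) (l * a).
Proof.
move=> /cvg_normcP H; apply/cvg_normcP => e e0.
have a1 : 0 < normc a + 1 by rewrite ltr_wpDl ?normc_ge0.
have := H _ (divr_gt0 e0 a1); apply: filterS => n un.
rewrite -mulrBl normcM; apply: (@le_lt_trans _ _ (normc (u n - l) * (normc a + 1))).
  by rewrite ler_wpM2l ?normc_ge0// lerDl.
by rewrite -ltr_pdivlMr.
Qed.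

Lemma ccvg_le u l (K : R) : ccvg u l -> (forall n, normc (u n) <= K) -> normc l <= K.
Proof.
move=> ul uK; have c : normc (u n) @[n --> \oo] --> normc l.
  exact: (cvg_comp _ _ ul (@continuous_normc R l)).
by apply: (cvgr_to_le c); near=> n; exact: uK.
Unshelve. all: by end_near. Qed.

Lemma has_cderiv_uniq (G : R[i] -> R[i]) z l m :
  has_cderiv G z l -> has_cderiv G z m -> l = m.
Proof.
move=> Hl Hm; apply/eqP; rewrite -subr_eq0; apply/eqP/eq0_normc/eqP.
rewrite eq_le normc_ge0 andbT; apply/ler_addgt0Pr => e e0; rewrite add0r.
have [r r0 Hr] := has_cderivB Hl Hm e0.
have r2 : 0 < r / 2 by rewrite divr_gt0.
have := Hr (z + (r / 2)%:C); rewrite [z + _]addrC addrK !subrr sub0r normcN.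
rewrite normcM normc_real ger0_norm ?(ltW r2)// ler_pM2r//; apply.
by rewrite gtr_pMr// invf_lt1// ltr1n.
Qed.

(** The second order bound of [taylor2] is uniform along the sequence, so it
    survives in the limit, and it implies complex differentiability. *)
Lemma weierstrass (f : nat -> C2 R -> R[i]) (g : C2 R -> R[i]) p r M : 0 < r ->
  (forall n, separately_holomorphic (fun z w => f n (z, w)) p.1 p.2 (3 * r)) ->
  (forall n q, insq p.1 (3 * r) q.1 -> insq p.2 (3 * r) q.2 -> normc (f n q) <= M) ->
  (forall e, 0 < e -> exists N : nat, forall (m n : nat) q, (N <= m)%N -> (N <= n)%N ->
     insq p.1 (3 * r) q.1 -> insq p.2 (3 * r) q.2 -> normc (f m q - f n q) <= e) ->
  (forall q, insq p.1 (3 * r) q.1 -> insq p.2 (3 * r) q.2 -> ccvg (f ^~ q) (g q)) ->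
  differentiable (g : C2 R -> R[i]^o) p.
Proof.
move=> r0 hf fM fC fg; have r30 : 0 < 3 * r by rewrite mulr_gt0.
have p1 : insq p.1 (3 * r) p.1 by apply: insq_center; exact: ltW.
have p2 : insq p.2 (3 * r) p.2 by apply: insq_center; exact: ltW.
have /choice[l Hl] : forall n, exists l, has_cderiv (fun z => f n (z, p.2)) p.1 l.
  by move=> n; have [/holomorphic_atP] := hf n _ _ p1 p2.
have /choice[m Hm] : forall n, exists m, has_cderiv (fun w => f n (p.1, w)) p.2 m.
  by move=> n; have [_ /holomorphic_atP] := hf n _ _ p1 p2.
have cl : ccauchy l.
  move=> e e0; have [N HN] := fC (e * (3 * r) / 8) ltac:(by rewrite divr_gt0// mulr_gt0).
  exists N => i j Ni Nj; have -> : e = 8 * (e * (3 * r) / 8) / (3 * r) by field; rewrite gt_eqF.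
  apply: (cauchy_derivative_le r30 _ _ (has_cderivB (Hl i) (Hl j))).
    by move=> z zr; apply: holomorphicB; [exact: (hf i z p.2 zr p2).1|exact: (hf j z p.2 zr p2).1].
  by move=> z zr; apply: (HN i j (z, p.2)).
have cm : ccauchy m.
  move=> e e0; have [N HN] := fC (e * (3 * r) / 8) ltac:(by rewrite divr_gt0// mulr_gt0).
  exists N => i j Ni Nj; have -> : e = 8 * (e * (3 * r) / 8) / (3 * r) by field; rewrite gt_eqF.
  apply: (cauchy_derivative_le r30 _ _ (has_cderivB (Hm i) (Hm j))).
    by move=> z zr; apply: holomorphicB; [exact: (hf i p.1 z p1 zr).2|exact: (hf j p.1 z p1 zr).2].
  by move=> z zr; apply: (HN i j (p.1, z)).
have r3 : r <= 3 * r by move: r0; clear; lra.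
have T q : insq p.1 r q.1 -> insq p.2 r q.2 ->
    normc (g q - g p - clim l * (q.1 - p.1) - clim m * (q.2 - p.2)) <=
      256 * M / r ^+ 2 * (normc (q.1 - p.1) + normc (q.2 - p.2)) ^+ 2.
  move=> q1 q2; apply: (@ccvg_le (fun n => f n q - f n p - l n * (q.1 - p.1) - m n * (q.2 - p.2))).
    do 2![apply: ccvgB; last by apply: ccvgMl; exact: ccauchy_cvg].
    by apply: ccvgB; apply: fg => //; exact: insq_le r3 _.
  move=> n; have := @taylor2 R (fun z w => f n (z, w)) p.1 p.2 r M (l n) (m n) q.1 q.2 r0 (hf n).
  rewrite -!surjective_pairing; apply => //.
  by move=> z w zr wr; exact: (fM n (z, w)).
apply: (@has_cderiv2_differentiable _ _ _ (clim l) (clim m)) => e e0.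
have M0 : 0 <= M by apply: le_trans (fM 0%N p p1 p2); exact: normc_ge0.
have B0 : 0 <= 256 * M / r ^+ 2.
  by apply: divr_ge0; [exact: mulr_ge0|apply: exprn_ge0; exact: ltW].
move: (256 * M / r ^+ 2) B0 T => B B0 T.
pose K := B + 1.
have K0 : 0 < K by rewrite ltr_wpDl.
exists (Num.min r (e / (2 * K))); first by rewrite lt_min r0 divr_gt0// mulr_gt0.
move=> q; rewrite !lt_min => /andP[q1 s1] /andP[q2 s2].
apply: (le_trans (T q (insq_norm (ltW q1)) (insq_norm (ltW q2)))).
set t := _ + _; have t0 : 0 <= t by rewrite addr_ge0 ?normc_ge0.
have te : t <= e / K.
  have -> : e / K = e / (2 * K) + e / (2 * K) by field; rewrite gt_eqF.
  by rewrite lerD// ltW.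
rewrite expr2 mulrA; apply: ler_wpM2r => //.
apply: (@le_trans _ _ (K * (e / K))); last by rewrite mulrCA divff ?mulr1// gt_eqF.
by apply: ler_pM => //; rewrite lerDl.
Qed.

End LocallyUniformLimits.

(** * The Bergman space is a Hilbert space *)

Section BergmanSpace.
Context {R : realType} (Om : set (C2 R)).
Hypothesis openOm : forall p, Om p -> \forall q \near p, Om q.
Implicit Types (p q : C2 R) (h k : C2 R -> R[i]) (r s : R).
Local Notation mu := (@lebesgue_measure R).
Local Notation mu4 := (((mu \x mu) \x mu) \x mu)%E.
Local Notation oc := (@of_coordinates R).
Local Notation TR := (g_sigma_algebraType (R.-ocitv.-measurable)).
Local Notation TR4 := (TR * TR * TR * TR)%type.
Local Notation D := (oc @^-1` Om : set TR4).

Definition box p r s : set (C2 R) := [set q | insq p.1 r q.1 && insq p.2 s q.2].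

Lemma open_box p : Om p -> exists2 r, 0 < r & box p r r `<=` Om.
Proof.
move/openOm => /nbhs_C2P[r r0 Hr]; exists (r / 3); first by rewrite divr_gt0.
have norm (z w : R[i]) : insq z (r / 3) w -> normc (w - z) < r.
  move=> /andP[a b]; apply: (le_lt_trans (normc_le_ReIm _)).
  by apply: (le_lt_trans (lerD a b)); move: r0; clear; lra.
by move=> q /andP[/norm q1 /norm q2]; exact: Hr.
Qed.

Lemma nbhs4_of_coordinates x (U : set (C2 R)) :
  nbhs (oc x) U -> nbhs4 x (oc @^-1` U).
Proof.
case: x => [[[x1 y1] x2] y2] /nbhs_C2P[r r0 Hr].
have r2 : 0 < r / 2 by rewrite divr_gt0.
have nb (x : R) : nbhs x (ball x (r / 2)) by exact: nbhsx_ballx.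
exists ((ball x1 (r / 2) `*` ball y1 (r / 2)) `*` ball x2 (r / 2), ball y2 (r / 2)).
  split=> /=; last exact: nb.
  exists (ball x1 (r / 2) `*` ball y1 (r / 2), ball x2 (r / 2)) => //.
  split=> /=; last exact: nb.
  by exists (ball x1 (r / 2), ball y1 (r / 2)).
move=> [[[a b] c] d] [/= [[/= A B] C] D']; apply: Hr => /=;
  apply: (le_lt_trans (normc_le_ReIm _)) => /=; rewrite [r]splitr ltrD//.
- by rewrite distrC.
- by rewrite distrC.
- by rewrite distrC.
- by rewrite distrC.
Qed.

Lemma measurable_domain : measurable D.
Proof.
rewrite -[X in measurable X]setTI.
apply: (base_open_measurable (@countable_base4 R)) => // x _ Dx.
by apply: nbhs4_of_coordinates; exact: openOm.
Qed.

Lemma holomorphic_on_measurable h : holomorphic_on Om h ->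
  measurable_fun D (fun x => complex.Re (h (oc x))) /\
  measurable_fun D (fun x => complex.Im (h (oc x))).
Proof.
move=> hh.
have ch x : D x -> {for oc x, continuous (h : C2 R -> R[i]^o)}.
  by move=> Dx; apply: differentiable_continuous; exact: hh.
split; apply: (base_continuous_measurable (@countable_base4 R)) => //;
    try exact: measurable_domain.
  move=> x Dx A nA; apply: (@nbhs4_of_coordinates _ (fun q => A (complex.Re (h q)))).
  exact: (cvg_comp _ _ (ch x Dx) (@continuous_Re R _) A nA).
move=> x Dx A nA; apply: (@nbhs4_of_coordinates _ (fun q => A (complex.Im (h q)))).
exact: (cvg_comp _ _ (ch x Dx) (@continuous_Im R _) A nA).
Qed.

Lemma A2P h : A2 Om h <-> L2 mu4 D (h \o oc) /\ holomorphic_on Om h.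
Proof.
split=> [[h2 hh]|[[_ _ h2] hh]]; split => //.
by have [mr mi] := holomorphic_on_measurable hh; split.
Qed.

(** [|h|^2] is dominated by area means over a box contained in the domain. *)
Lemma A2_eval h p r s : A2 Om h -> 0 < r -> 0 < s -> box p r s `<=` Om ->
  normc (h p) ^+ 2 <= 8 / r ^+ 2 * (8 / s ^+ 2) * complex.Re (L2_inner Om h h).
Proof.
move=> /A2P[Lh hh] r0 s0 bOm.
have E : ((complex.Re (L2_inner Om h h))%:E =
  \int[mu4]_(x in D) (normc (h (oc x)) ^+ 2)%:E)%E := Re_L2ipE measurable_domain Lh.
rewrite -lee_fin [X in (_ <= X)%E]EFinM E integral_mkcond.
have [mr mi _] := Lh.
have := @normc2_le_integral4 R (fun z w => h (z, w)) p.1 p.2 r s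
   ((fun x => (normc (h (oc x)) ^+ 2)%:E) \_ D) r0 s0.
rewrite -surjective_pairing; apply.
- move=> z w zr ws; have /hh/differentiable_has_cderiv2 H : Om (z, w) by apply: bOm; exact/andP.
  by split; apply/holomorphic_atP; eexists; [exact: (has_cderiv2_fst H)|exact: (has_cderiv2_snd H)].
- have m2 : measurable_fun D (fun x => (normc (h (oc x)) ^+ 2)%:E).
    by apply/measurable_EFinP; exact: (measurable_normc2 mr mi).
  exact: ((measurable_restrictT _ measurable_domain).1 m2).
- by apply: erestrict_ge0 => x _; rewrite lee_fin sqr_ge0.
move=> x y u v xy uv; rewrite patchE ifT// inE /=.
by apply: bOm; rewrite /box /= xy.
Qed.

Local Notation V := (C2 R -> R[i]^o).
Local Notation N h := (complex.Re (L2_inner Om h h)).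

Lemma A2_comb (a : R[i]) (h k : V) : A2 Om h -> A2 Om k -> A2 Om (a *: h + k).
Proof.
move=> /A2P[Lh hh] /A2P[Lk hk]; apply/A2P; split.
  exact: (L2_comb measurable_domain a Lh Lk).
move=> p Op; apply: differentiableD; last exact: hk.
by apply: differentiableZ; exact: hh.
Qed.

Lemma A2_0 : A2 Om (0 : V).
Proof.
apply/A2P; split; first exact: L2_0.
by move=> p _; exact: differentiable_cst.
Qed.

Lemma L2_inner_comb (a : R[i]) (h k l : V) : A2 Om h -> A2 Om k -> A2 Om l ->
  L2_inner Om (a *: h + k) l = a * L2_inner Om h l + L2_inner Om k l.
Proof.
move=> /A2P[Lh _] /A2P[Lk _] /A2P[Ll _].
exact: (L2ip_comb measurable_domain a Lh Lk Ll).
Qed.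

Lemma L2_inner_conj (h k : V) : A2 Om h -> A2 Om k ->
  L2_inner Om k h = conjc (L2_inner Om h k).
Proof. by move=> /A2P[Lh _] /A2P[Lk _]; exact: (L2ip_conj measurable_domain Lh Lk). Qed.

Lemma mulcJ_Re_ge0 (z : R[i]) : 0 <= complex.Re (z * conjc z).
Proof. by case: z => x y /=; rewrite mulrN opprK -!expr2 addr_ge0// sqr_ge0. Qed.

Lemma L2_inner_ge0 (h : V) : A2 Om h -> 0 <= N h.
Proof. by move=> _; apply: Rintegral_ge0 => x _; exact: mulcJ_Re_ge0. Qed.

Lemma A2_sub (h k : V) : A2 Om h -> A2 Om k -> A2 Om (h - k).
Proof. exact: (P_sub A2_comb). Qed.

Lemma box_trans p q r s r' s' : box p r s q -> box q r' s' `<=` box p (r + r') (s + s').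
Proof.
move=> /andP[q1 q2] x /andP[x1 x2].
by apply/andP; split; [exact: insqD q1 x1|exact: insqD q2 x2].
Qed.

Lemma box_le p r s r' s' : r <= r' -> s <= s' -> box p r s `<=` box p r' s'.
Proof.
by move=> rr ss q /andP[q1 q2]; apply/andP; split; [exact: insq_le rr _|exact: insq_le ss _].
Qed.

Lemma box_center p r s : 0 <= r -> 0 <= s -> box p r s p.
Proof. by move=> r0 s0; rewrite /box /= !insq_center. Qed.

Lemma holomorphic_box h p r : holomorphic_on Om h -> box p r r `<=` Om ->
  separately_holomorphic (fun z w => h (z, w)) p.1 p.2 r.
Proof.
move=> hh bOm; apply: (holomorphic_separately hh) => q q1 q2.
by apply: bOm; apply/andP.
Qed.

(** Evaluation is bounded uniformly on small boxes, so a Cauchy sequence for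
    the norm converges locally uniformly; the limit is holomorphic by
    [weierstrass], and it is the limit in norm by [L2_complete]. *)
Lemma A2_complete (u : nat -> V) : (forall n, A2 Om (u n)) ->
  (forall e : R, 0 < e -> exists n0, forall m n, (n0 <= m)%N -> (n0 <= n)%N ->
     N (u m - u n) <= e) ->
  exists2 l : V, A2 Om l & forall e : R, 0 < e -> exists n0, forall n, (n0 <= n)%N ->
     N (u n - l) <= e.
Proof.
move=> Au Cu; pose g (q : C2 R) : R[i]^o := clim (u ^~ q).
(* Evaluation being bounded on small boxes, the sequence is locally uniformly Cauchy. *)
have unif p r : 0 < r -> box p (r + r) (r + r) `<=` Om -> forall e, 0 < e ->
    exists n0 : nat, forall (m n : nat) q, (n0 <= m)%N -> (n0 <= n)%N -> box p r r q ->
      normc (u m q - u n q) <= e.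
  move=> r0 bOm e e0; pose C := 8 / r ^+ 2 * (8 / r ^+ 2).
  have C0 : 0 < C by rewrite mulr_gt0// divr_gt0// exprn_gt0.
  have d0 : 0 < e ^+ 2 / C by rewrite divr_gt0// exprn_gt0.
  have [n0 Hn] := Cu _ d0; exists n0 => m n q n0m n0n pq.
  have := A2_eval (A2_sub (Au m) (Au n)) r0 r0 (subset_trans (box_trans pq) bOm).
  have := ler_wpM2l (ltW C0) (Hn m n n0m n0n).
  have -> : C * (e ^+ 2 / C) = e ^+ 2 by field; rewrite gt_eqF.
  move=> A B; rewrite -(@ler_pXn2r _ 2) ?nnegrE ?normc_ge0 ?(ltW e0)//.
  exact: le_trans B A.
have half p : Om p -> exists2 r, 0 < r & box p (r + r) (r + r) `<=` Om.
  move=> /open_box[r r0 bOm]; exists (r / 2); first by rewrite divr_gt0.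
  by rewrite -splitr.
have cvg p : Om p -> ccvg (u ^~ p) (g p).
  move=> /half[r r0 bOm]; apply: ccauchy_cvg => e e0.
  have [n0 Hn] := unif p r r0 bOm e e0; exists n0 => m n n0m n0n.
  by apply: (Hn m n p) => //; apply: box_center; exact: ltW.
have hg : holomorphic_on Om g.
  move=> p /half[r r0 bOm].
  have r30 : 0 < r / 3 by rewrite divr_gt0.
  have E3 : 3 * (r / 3) = r by field.
  have [n1 Hn1] := unif p r r0 bOm 1 ltr01.
  pose C := 8 / r ^+ 2 * (8 / r ^+ 2) * N (u n1).
  have bM q : box p r r q -> normc (u n1 q) <= C + 1.
    move=> pq; have := A2_eval (Au n1) r0 r0 (subset_trans (box_trans pq) bOm).
    rewrite -/C; have := normc_ge0 (u n1 q); move: (normc _) => x x0.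
    have := sqr_ge0 (x - 1); nra.
  apply: (@weierstrass R (fun n => u (n + n1)%N) g p (r / 3) (C + 1 + 1) r30); rewrite ?E3.
  - move=> n; apply: holomorphic_box; first by have [] := (A2P _).1 (Au (n + n1)%N).
    apply: subset_trans bOm; apply: box_le; rewrite lerDl; exact: ltW.
  - move=> n q q1 q2; have pq : box p r r q by apply/andP.
    have -> : u (n + n1)%N q = u n1 q + (u (n + n1)%N q - u n1 q) by ring.
    apply: (le_trans (le_normcD _ _)); rewrite lerD ?bM//.
    by apply: Hn1 => //; rewrite leq_addl.
  - move=> e e0; have [n0 Hn] := unif p r r0 bOm e e0; exists n0 => m n q mn nn q1 q2.
    apply: Hn; [exact: leq_trans mn (leq_addr _ _)|exact: leq_trans nn (leq_addr _ _)|exact/andP].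
  - move=> q q1 q2.
    have Oq : Om q.
      apply: bOm; apply: (@box_le p r r); rewrite ?lerDl ?ltW//; exact/andP.
    by rewrite /ccvg (cvg_shiftn n1 (fun n => u n q : R[i]^o)); exact: cvg.
have LU n : L2 mu4 D (u n \o oc) by have [] := (A2P _).1 (Au n).
have [Lg Cg] := L2_complete measurable_domain LU (fun x Dx => cvg (oc x) Dx) Cu.
by exists g => //; apply/A2P.
Qed.

Lemma A2_riesz (lam : V -> R[i]) (C : R) :
  (forall a (u v : V), A2 Om u -> A2 Om v -> lam (a *: u + v) = a * lam u + lam v) ->
  (forall u : V, A2 Om u -> normc (lam u) ^+ 2 <= C * N u) ->
  exists2 k : V, A2 Om k & forall h : V, A2 Om h -> lam h = L2_inner Om h k.
Proof.
exact: (riesz A2_comb L2_inner_comb L2_inner_conj L2_inner_ge0 A2_0 A2_complete).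
Qed.

End BergmanSpace.

(** * Complex partial derivatives *)

Section PartialDerivatives.
Context {R : realType}.
Implicit Types (p q : C2 R) (h k : C2 R -> R[i]) (r s e M : R).

Lemma ord2_case (P : 'I_2 -> Prop) : P 0 -> P 1 -> forall j, P j.
Proof.
move=> P0 P1 [[|[|//]] lt].
  by rewrite (_ : Ordinal lt = 0)//; exact/val_inj.
by rewrite (_ : Ordinal lt = 1)//; exact/val_inj.
Qed.

Lemma basis_vector0 : basis_vector 0 = (1, 0) :> C2 R. Proof. by []. Qed.
Lemma basis_vector1 : basis_vector 1 = (0, 1) :> C2 R. Proof. by []. Qed.

Lemma shift0 p z : p + z *: basis_vector 0 = (p.1 + z, p.2) :> C2 R.
Proof.
rewrite basis_vector0; congr (_, _); rewrite /= -[_ *: _]/(z * _) ?mulr1 ?mulr0 ?addr0//.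
Qed.

Lemma shift1 p z : p + z *: basis_vector 1 = (p.1, p.2 + z) :> C2 R.
Proof.
rewrite basis_vector1; congr (_, _); rewrite /= -[_ *: _]/(z * _) ?mulr1 ?mulr0 ?addr0//.
Qed.

Lemma has_cderiv_comb (a : R[i]) (G H : R[i] -> R[i]) z l m :
  has_cderiv G z l -> has_cderiv H z m ->
  has_cderiv (fun w => a * G w + H w) z (a * l + m).
Proof.
move=> dG dH e e0; pose K := 2 * (normc a + 1).
have K0 : 0 < K by rewrite mulr_gt0// ltr_wpDl// normc_ge0.
have e2 : 0 < e / 2 by rewrite divr_gt0.
have [r r0 Hr] := dG _ (divr_gt0 e0 K0); have [s s0 Hs] := dH _ e2.
exists (Num.min r s) => [|w]; first by rewrite lt_min r0 s0.
rewrite lt_min => /andP[/Hr wr /Hs ws].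
have -> : a * G w + H w - (a * G z + H z) - (a * l + m) * (w - z) =
    a * (G w - G z - l * (w - z)) + (H w - H z - m * (w - z)) by ring.
apply: (le_trans (le_normcD _ _)).
apply: (@le_trans _ _ (e / 2 * normc (w - z) + e / 2 * normc (w - z))); last first.
  by rewrite -mulrDl -splitr.
apply: lerD => //; rewrite normcM.
apply: (le_trans (ler_wpM2l (normc_ge0 a) wr)).
rewrite mulrA; apply: ler_wpM2r; first exact: normc_ge0.
rewrite mulrCA; apply: ler_wpM2l; first exact: ltW.
rewrite ler_pdivrMr// /K mulrA mulVf// mul1r lerDl; exact: ler01.
Qed.

Lemma cpartial_has_cderiv j h p : differentiable (h : C2 R -> R[i]^o) p ->
  has_cderiv (fun z => h (p + z *: basis_vector j)) 0 (cpartial j h p).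
Proof.
move=> /differentiable_has_cderiv2 H e e0; have [r r0 Hr] := H e e0; exists r => // z.
rewrite subr0 scale0r addr0 => zr; move: zr; elim/ord2_case: j => zr.
  have := Hr (p.1 + z, p.2); rewrite shift0 /= [p.1 + z]addrC addrK subrr.
  by rewrite normc0 mulr0 subr0 addr0; apply.
have := Hr (p.1, p.2 + z); rewrite shift1 /= [p.2 + z]addrC addrK subrr.
by rewrite normc0 mulr0 subr0 add0r; apply.
Qed.

Lemma cpartial_comb j (a : R[i]) h k p :
  differentiable (h : C2 R -> R[i]^o) p -> differentiable (k : C2 R -> R[i]^o) p ->
  cpartial j (fun q => a * h q + k q) p = a * cpartial j h p + cpartial j k p.
Proof.
move=> dh dk; have d : differentiable ((fun q => a * h q + k q) : C2 R -> R[i]^o) p.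
  apply: (@differentiableD _ _ _ (fun q => a * h q : R[i]^o)); last exact: dk.
  exact: (@differentiableZ _ _ _ (h : C2 R -> R[i]^o)).
have H1 := @cpartial_has_cderiv j _ p d.
have H2 := has_cderiv_comb a (@cpartial_has_cderiv j _ p dh) (@cpartial_has_cderiv j _ p dk).
exact: has_cderiv_uniq H1 H2.
Qed.

Lemma box_shift p r j z : normc z <= r -> box p r r (p + z *: basis_vector j).
Proof.
move=> zr; have r0 := le_trans (normc_ge0 z) zr.
elim/ord2_case: j; rewrite ?shift0 ?shift1 /box /=.
  rewrite insq_center// andbT; apply: insq_norm.
  by rewrite [_ + z]addrC addrK.
rewrite insq_center//=; apply: insq_norm.
by rewrite [_ + z]addrC addrK.
Qed.

Lemma insq_shift p r z j : 0 <= r -> insq 0 r z -> box p r r (p + z *: basis_vector j).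
Proof.
move=> r0; rewrite /insq subr0 => /andP[z1 z2].
elim/ord2_case: j; rewrite ?shift0 ?shift1 /box /=.
  by rewrite insq_center// andbT /insq [_ + z]addrC addrK z1.
by rewrite insq_center//= /insq [_ + z]addrC addrK z1.
Qed.

Lemma differentiable_slice j h p z :
  differentiable (h : C2 R -> R[i]^o) (p + z *: basis_vector j) ->
  holomorphic_at (fun z => h (p + z *: basis_vector j)) z.
Proof.
move=> /(@cpartial_has_cderiv j) H; apply/holomorphic_atP; eexists => e e0.
have [r r0 Hr] := H e e0; exists r => // w wz.
have E x : p + x *: basis_vector j = p + z *: basis_vector j + (x - z) *: basis_vector j.
  by rewrite -addrA -scalerDl addrCA subrr addr0.
by have := Hr (w - z); rewrite subr0 scale0r addr0 -E; apply.
Qed.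

Lemma cpartial_slice_le Om j h p r M : 0 < r -> holomorphic_on Om h ->
  (forall z, insq 0 r z -> Om (p + z *: basis_vector j)) ->
  (forall z, insq 0 r z -> normc (h (p + z *: basis_vector j)) <= M) ->
  normc (cpartial j h p) <= 8 * M / r.
Proof.
move=> r0 hh bOm hM.
have dh : differentiable (h : C2 R -> R[i]^o) p.
  have := bOm 0 (insq_center 0 (ltW r0)); rewrite scale0r addr0; exact: hh.
have H := @cpartial_has_cderiv j _ p dh.
apply: (cauchy_derivative_le r0 _ _ H); last exact: hM.
by move=> z zr; apply: differentiable_slice; apply/hh/bOm.
Qed.

Lemma cpartial_le Om j h p r M : 0 < r -> holomorphic_on Om h -> box p r r `<=` Om ->
  (forall q, box p r r q -> normc (h q) <= M) -> normc (cpartial j h p) <= 8 * M / r.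
Proof.
move=> r0 hh bOm hM; apply: (cpartial_slice_le r0 hh) => z zr.
  by apply/bOm/insq_shift => //; exact: ltW.
by apply/hM/insq_shift => //; exact: ltW.
Qed.

(** A second order remainder whose constant is a sup bound: it is what makes
    difference quotients converge uniformly. *)
Lemma cpartial_taylor Om j h p r M z : 0 < r -> holomorphic_on Om h ->
  box p (3 * r) (3 * r) `<=` Om ->
  (forall q, box p (3 * r) (3 * r) q -> normc (h q) <= M) -> normc z <= r ->
  normc (h (p + z *: basis_vector j) - h p - cpartial j h p * z) <=
    256 * M / r ^+ 2 * normc z ^+ 2.
Proof.
move=> r0 hh bOm hM zr; have r30 : 0 <= 3 * r by rewrite mulr_ge0// ltW.
have dh : differentiable (h : C2 R -> R[i]^o) p.
  by apply/hh/bOm/box_center.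
have := @cderiv_taylor _ (fun z => h (p + z *: basis_vector j)) 0 r M z (cpartial j h p) r0.
rewrite !subr0 scale0r addr0; apply.
- by move=> w wr; apply: differentiable_slice; apply/hh/bOm/insq_shift.
- by move=> w wr; apply: hM; apply: insq_shift.
- by apply: insq_norm; rewrite subr0.
- exact: cpartial_has_cderiv.
Qed.

Lemma differentiable_shift h (a : C2 R) p :
  differentiable (h : C2 R -> R[i]^o) (p + a) ->
  differentiable ((fun q => h (q + a)) : C2 R -> R[i]^o) p.
Proof.
move=> /differentiable_has_cderiv2 H.
apply: (@has_cderiv2_differentiable _ _ _ (cpartial 0 h (p + a)) (cpartial 1 h (p + a))).
move=> e e0; have [r r0 Hr] := H e e0; exists r => // q q1 q2.
have E1 : (q + a).1 - (p + a).1 = q.1 - p.1 by rewrite /=; ring.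
have E2 : (q + a).2 - (p + a).2 = q.2 - p.2 by rewrite /=; ring.
by have := Hr (q + a); rewrite E1 E2; apply.
Qed.

(** The difference quotients along a basis vector are holomorphic, and by
    [cpartial_taylor] they converge locally uniformly to the partial derivative. *)
Lemma cpartial_holomorphic Om j h : (forall p, Om p -> \forall q \near p, Om q) ->
  holomorphic_on Om h -> holomorphic_on Om (cpartial j h).
Proof.
move=> oOm hh p Op.
(* Near [p] the function is bounded, so the Taylor bounds apply there. *)
pose Om' := [set q | Om q /\ normc (h q) < normc (h p) + 1].
have oOm' : forall q, Om' q -> \forall x \near q, Om' x.
  move=> q [Oq hq]; have : {for q, continuous (h : C2 R -> R[i]^o)}.
    by apply: differentiable_continuous; exact: hh.
  move=> /cvg_normcP/(_ (normc (h p) + 1 - normc (h q))); rewrite subr_gt0 => /(_ hq).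
  apply: filterS2 (oOm q Oq) => x Ox hx; split => //.
  have -> : h x = (h x - h q) + h q by rewrite subrK.
  by apply: (le_lt_trans (le_normcD _ _)); rewrite -ltrBrDr.
have [r r0 bOm] : exists2 r, 0 < r & box p (6 * r) (6 * r) `<=` Om'.
  have [r r0 bOm] := @open_box _ _ oOm' p (conj Op (ltr_pwDr ltr01 (lexx _))).
  exists (r / 6); first by rewrite divr_gt0.
  by rewrite mulrC divfK.
pose M := normc (h p) + 1.
have sub q : box p (3 * r) (3 * r) q -> box q (3 * r) (3 * r) `<=` Om'.
  move=> pq; apply: subset_trans bOm.
  have E : 6 * r = 3 * r + 3 * r by ring.
  by rewrite E; exact: (box_trans pq).
have T q z : box p (3 * r) (3 * r) q -> normc z <= r ->
    normc (h (q + z *: basis_vector j) - h q - cpartial j h q * z) <=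
      256 * M / r ^+ 2 * normc z ^+ 2.
  move=> pq zr; apply: (@cpartial_taylor Om) => //.
    by move=> x /(sub q pq) [].
  by move=> x /(sub q pq) [_ /ltW].
pose K := 256 * M / r ^+ 2.
have K0 : 0 <= K.
  apply: divr_ge0; last by apply: exprn_ge0; exact: ltW.
  by apply: mulr_ge0 => //; apply: addr_ge0 => //; exact: normc_ge0.
have [n0 Hn0] : exists n0 : nat, forall n, (n0 <= n)%N -> n.+1%:R^-1 <= r.
  exists (Num.truncn r^-1) => n nn.
  rewrite -[r]invrK lef_pV2 ?posrE ?invr_gt0//.
  by apply/ltW/(lt_le_trans (truncnS_gt _)); rewrite ler_nat ltnS.
pose t (n : nat) : R := (n + n0).+1%:R^-1.
have t0 n : 0 < t n by rewrite invr_gt0.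
have tr n : t n <= r by apply: Hn0; rewrite leq_addl.
pose f (n : nat) q : R[i] := (t n)^-1%:C * (h (q + (t n)%:C *: basis_vector j) - h q).
have nt n : normc (t n)%:C = t n by rewrite normc_real ger0_norm// ltW.
have fT n q : box p (3 * r) (3 * r) q -> normc (f n q - cpartial j h q) <= K * t n.
  move=> pq; have tn0 : (t n)%:C != 0 by rewrite -normc_gt0 nt.
  have -> : f n q - cpartial j h q = (t n)^-1%:C *
      (h (q + (t n)%:C *: basis_vector j) - h q - cpartial j h q * (t n)%:C).
    by rewrite /f fmorphV; field.
  have := T q (t n)%:C pq; rewrite nt => /(_ (tr n)); rewrite -/K => H.
  rewrite normcM normc_real ger0_norm ?invr_ge0 ?(ltW (t0 n))//.
  by rewrite ler_pdivrMl// mulrCA -expr2.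
have tlim e : 0 < e -> exists n1 : nat, forall n, (n1 <= n)%N -> K * t n <= e.
  move=> e0; have K1 : 0 < K + 1 by rewrite ltr_wpDl.
  exists (Num.truncn ((e / (K + 1))^-1)) => n nn.
  have tn : t n <= e / (K + 1).
    rewrite -[e / _]invrK lef_pV2 ?posrE ?invr_gt0 ?divr_gt0//.
    apply/ltW/(lt_le_trans (truncnS_gt _)); rewrite ler_nat ltnS.
    exact: leq_trans nn (leq_addr _ _).
  apply: (@le_trans _ _ ((K + 1) * (e / (K + 1)))).
    by apply: ler_pM => //; [exact: ltW|rewrite lerDl].
  by rewrite mulrCA divff ?mulr1// gt_eqF.
apply: (@weierstrass R f (cpartial j h) p r (8 * M / (3 * r) + K * r) r0).
- move=> n; apply: (@holomorphic_separately _ (box p (3 * r) (3 * r)) (f n)); last first.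
    by move=> q q1 q2; apply/andP.
  move=> q pq; have r3 : r <= 3 * r by move: r0; clear; lra.
  have r30 : 0 <= 3 * r by apply: mulr_ge0; [exact: ler0n|exact: ltW].
  have d1 : differentiable (h : C2 R -> R[i]^o) q.
    by apply: hh; have [] := sub _ pq _ (box_center q r30 r30).
  have d2 : differentiable (h : C2 R -> R[i]^o) (q + (t n)%:C *: basis_vector j).
    apply: hh; have [] // := sub _ pq (q + (t n)%:C *: basis_vector j) _.
    by apply: (box_le r3 r3); apply: box_shift; rewrite nt.
  apply: (@differentiableZ _ _ _ (fun q => h (q + (t n)%:C *: basis_vector j) - h q : R[i]^o)).
  apply: (@differentiableB _ _ _ (fun q => h (q + (t n)%:C *: basis_vector j) : R[i]^o)); last exact: d1.
  exact: differentiable_shift.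
- move=> n q q1 q2; have pq : box p (3 * r) (3 * r) q by apply/andP.
  have -> : f n q = cpartial j h q + (f n q - cpartial j h q) by ring.
  apply: (le_trans (le_normcD _ _)); apply: lerD.
    apply: (@cpartial_le Om) => //; first by rewrite mulr_gt0.
      by move=> x /(sub q pq) [].
    by move=> x /(sub q pq) [_ /ltW].
  by apply: (le_trans (fT n q pq)); rewrite ler_wpM2l.
- move=> e e0; have e2 : 0 < e / 2 by rewrite divr_gt0.
  have [n1 Hn1] := tlim _ e2; exists n1 => m n q mm nn q1 q2.
  have pq : box p (3 * r) (3 * r) q by apply/andP.
  have -> : f m q - f n q = (f m q - cpartial j h q) - (f n q - cpartial j h q) by ring.
  apply: (le_trans (ler_normcB _ _)); rewrite [e]splitr; apply: lerD.
    exact: le_trans (fT m q pq) (Hn1 m mm).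
  exact: le_trans (fT n q pq) (Hn1 n nn).
- move=> q q1 q2; have pq : box p (3 * r) (3 * r) q by apply/andP.
  apply/cvg_normcP => e e0; have e2 : 0 < e / 2 by rewrite divr_gt0.
  have [n1 Hn1] := tlim _ e2; exists n1 => // n /= nn.
  apply: (le_lt_trans (fT n q pq)); apply: (le_lt_trans (Hn1 n nn)).
  by rewrite gtr_pMr// invf_lt1// ltr1n.
Qed.

End PartialDerivatives.

(** * Wirtinger derivatives *)

Section WirtingerCalculus.
Context {R : realType}.
Implicit Types (G H : R[i] -> R[i]) (a b c z w : R[i]) (e r : R).

(** First order expansion at 0 of a function of one complex variable that is
    differentiable in the real sense; [a] and [b] are its two Wirtinger
    derivatives. *)
Definition wder G a b := forall e : R, 0 < e -> exists2 r : R, 0 < r &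
  forall z, normc z < r -> normc (G z - G 0 - a * z - b * conjc z) <= e * normc z.

Lemma wder_quadratic G a b r (C : R) : 0 < r ->
  (forall z, normc z <= r -> normc (G z - G 0 - a * z - b * conjc z) <= C * normc z ^+ 2) ->
  wder G a b.
Proof.
move=> r0 H e e0; pose K := `|C| + 1.
have K0 : 0 < K by rewrite ltr_wpDl.
exists (Num.min r (e / K)) => [|z]; first by rewrite lt_min r0 divr_gt0.
rewrite lt_min => /andP[zr zk]; apply: (le_trans (H z (ltW zr))).
rewrite expr2 mulrA; apply: ler_wpM2r; first exact: normc_ge0.
apply: (@le_trans _ _ (K * normc z)).
  apply: ler_wpM2r; first exact: normc_ge0.
  by rewrite /K; apply: (le_trans (ler_norm C)); rewrite lerDl.
by rewrite mulrC -ler_pdivlMr// ltW.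
Qed.

Lemma wder_near G H a b r : 0 < r -> (forall z, normc z < r -> G z = H z) ->
  wder G a b -> wder H a b.
Proof.
move=> r0 E D e e0; have [s s0 Hs] := D e e0.
exists (Num.min r s) => [|z]; first by rewrite lt_min r0.
rewrite lt_min => /andP[zr zs]; rewrite -!E//; last by rewrite normc0.
exact: Hs.
Qed.

Lemma wder_lip G a b : wder G a b -> exists2 C : R, 0 < C & exists2 r, 0 < r &
  forall z, normc z < r -> normc (G z - G 0) <= C * normc z.
Proof.
move=> D; exists (normc a + normc b + 1).
  by rewrite ltr_wpDl// addr_ge0 ?normc_ge0.
have [r r0 Hr] := D _ ltr01; exists r => // z /Hr; rewrite mul1r => L.
have -> : G z - G 0 = (a * z + b * conjc z) + (G z - G 0 - a * z - b * conjc z) by ring.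
apply: (le_trans (le_normcD _ _)); rewrite !mulrDl mul1r; apply: lerD => //.
by apply: (le_trans (le_normcD _ _)); rewrite !normcM normc_conj.
Qed.

Lemma wderM G H a b c d : wder G a b -> wder H c d ->
  wder (fun z => G z * H z) (a * H 0 + G 0 * c) (b * H 0 + G 0 * d).
Proof.
move=> DG DH e e0.
have [B B0 [s s0 Bs]] := wder_lip DG; have [B' B'0 [s' s'0 Bs']] := wder_lip DH.
pose K := 3 * (normc (H 0) + normc (G 0) + 1).
have K0 : 0 < K by rewrite mulr_gt0// ltr_wpDl// addr_ge0 ?normc_ge0.
have e3 : 0 < e / K by rewrite divr_gt0.
have [r r0 Hr] := DG _ e3; have [r' r'0 Hr'] := DH _ e3.
exists (Num.min (Num.min r r') (Num.min (Num.min s s') (e / (3 * B * B')))).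
  by rewrite !lt_min r0 r'0 s0 s'0 divr_gt0// mulr_gt0// mulr_gt0.
move=> z; rewrite !lt_min => /andP[/andP[/Hr x1 /Hr' x2] /andP[/andP[/Bs y1 /Bs' y2] z3]].
have -> : G z * H z - G 0 * H 0 - (a * H 0 + G 0 * c) * z - (b * H 0 + G 0 * d) * conjc z =
   (G z - G 0 - a * z - b * conjc z) * H 0 + G 0 * (H z - H 0 - c * z - d * conjc z)
   + (G z - G 0) * (H z - H 0) by ring.
apply: (le_trans (le_normcD _ _)).
have n0 := normc_ge0 z.
have -> : e * normc z = e / 3 * normc z + e / 3 * normc z + e / 3 * normc z by field.
apply: lerD; last first.
  rewrite normcM; apply: (le_trans (ler_pM (normc_ge0 _) (normc_ge0 _) y1 y2)).
  have -> : B * normc z * (B' * normc z) = (B * B' * normc z) * normc z by ring.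
  apply: ler_wpM2r => //.
  have B3 : 0 < 3 * B * B' by rewrite mulr_gt0// mulr_gt0.
  move: z3; rewrite ltr_pdivlMr// => z3.
  rewrite ler_pdivlMr//; apply/ltW; rewrite (_ : B * B' * _ * 3 = normc z * (3 * B * B'))//; ring.
have Ke (t : R) : t <= normc (H 0) + normc (G 0) + 1 -> e / K * t <= e / 3.
  move=> tK; rewrite -ler_pdivlMl// (_ : _ * _ = normc (H 0) + normc (G 0) + 1)//.
  by rewrite /K; field; rewrite (gt_eqF e0) /= gt_eqF// ltr_wpDl// addr_ge0 ?normc_ge0.
apply: (le_trans (le_normcD _ _)); apply: lerD; rewrite normcM.
  apply: (le_trans (ler_wpM2r (normc_ge0 _) x1)).
  rewrite mulrAC; apply: ler_wpM2r => //; apply: Ke.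
  by rewrite -addrA lerDl addr_ge0// normc_ge0.
apply: (le_trans (ler_wpM2l (normc_ge0 _) x2)).
rewrite mulrA; apply: ler_wpM2r => //; rewrite mulrC; apply: Ke.
by apply: (@le_trans _ _ (normc (H 0) + normc (G 0))); rewrite ?lerDr ?normc_ge0// lerDl.
Qed.

Lemma is_derive_eps (f : R -> R) (t d : R) : is_derive t (1 : R) f d ->
  forall e, 0 < e -> exists2 r : R, 0 < r & forall h, `|h| < r ->
    `|f (t + h) - f t - h * d| <= e * `|h|.
Proof.
case=> df fd e e0.
have : h^-1 *: ((f \o shift t) (h *: (1 : R)) - f t) @[h --> 0^'] --> d by rewrite -fd; exact: df.
move=> /cvgrPdist_le/(_ e e0).
rewrite near_withinE => /nbhs_ballP[r r0 Hr]; exists r => // h hr.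
have [->|h0] := eqVneq h 0; first by rewrite addr0 subrr mul0r subr0 normr0 mulr0.
have := Hr h; rewrite /ball /= sub0r normrN => /(_ hr h0).
rewrite -[h *: 1]/(h * 1) mulr1 [h + t]addrC => L.
have hn : 0 < `|h| by rewrite normr_gt0.
have -> : f (t + h) - f t - h * d = - ((d - h^-1 *: (f (t + h) - f t)) * h).
  by rewrite -[_ *: _]/(h^-1 * (f (t + h) - f t)); field.
by rewrite normrN normrM ler_wpM2r.
Qed.

(** Chain rule for a real function of a real valued function; it serves for
    [ln] and for the inverse of the kernel on the diagonal. *)
Lemma wder_comp_real (u : R[i] -> R) (f : R -> R) (d : R) a b :
  wder (fun z => (u z)%:C) a b -> is_derive (u 0) (1 : R) f d ->
  wder (fun z => (f (u z))%:C) (d%:C * a) (d%:C * b).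
Proof.
move=> Du Df e e0; have [B B0 [s s0 Bs]] := wder_lip Du.
have e1 : 0 < e / (2 * B) by rewrite divr_gt0// mulr_gt0.
have [q q0 Hq] := is_derive_eps Df e1.
have D0 : 0 < 2 * (`|d| + 1) by rewrite mulr_gt0// ltr_wpDl.
have [r r0 Hr] := Du _ (divr_gt0 e0 D0).
exists (Num.min r (Num.min s (q / B))) => [|z]; first by rewrite !lt_min r0 s0 divr_gt0.
rewrite !lt_min => /andP[/Hr x1 /andP[/Bs x2 zq]].
have x3 : `|u z - u 0| <= B * normc z by move: x2; rewrite -rmorphB /= normc_real.
have x4 : `|u z - u 0| < q.
  by apply: (le_lt_trans x3); rewrite mulrC -ltr_pdivlMr.
have := Hq _ x4; rewrite [u 0 + _]addrC subrK => x5.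
have -> : (f (u z))%:C - (f (u 0))%:C - d%:C * a * z - d%:C * b * conjc z =
  (f (u z) - f (u 0) - (u z - u 0) * d)%:C +
   d%:C * ((u z)%:C - (u 0)%:C - a * z - b * conjc z).
  by rewrite !rmorphB rmorphM rmorphB /=; ring.
apply: (le_trans (le_normcD _ _)); rewrite normcM !normc_real.
have n0 := normc_ge0 z.
have -> : e * normc z = e / 2 * normc z + e / 2 * normc z by field.
apply: lerD.
  apply: (le_trans x5); apply: (le_trans (ler_wpM2l (ltW e1) x3)).
  by rewrite mulrA; apply: ler_wpM2r => //; rewrite le_eqVlt; apply/orP; left; apply/eqP; field; rewrite gt_eqF.
apply: (le_trans (ler_wpM2l (normr_ge0 _) x1)); rewrite mulrA; apply: ler_wpM2r => //.
rewrite mulrCA; apply: ler_wpM2l; first exact: ltW.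
by rewrite ler_pdivrMr// mulrA mulVf// mul1r lerDl; exact: ler01.
Qed.

Lemma wder_cont_gt0 (u : R[i] -> R) a b : wder (fun z => (u z)%:C) a b -> 0 < u 0 ->
  exists2 r, 0 < r & forall z, normc z < r -> 0 < u z.
Proof.
move=> /wder_lip[B B0 [s s0 Bs]] u0; exists (Num.min s (u 0 / B)).
  by rewrite lt_min s0 divr_gt0.
move=> z; rewrite lt_min => /andP[/Bs]; rewrite -rmorphB /= normc_real => x1.
rewrite ltr_pdivlMr// mulrC => x2.
have := le_lt_trans (le_trans (ler_norm _) (le_trans _ x1)) x2.
rewrite -normrN opprB => /(_ (u 0 - u z) (lexx _)); lra.
Qed.

Lemma real_derivative_wder (v : C2 R) g p (l : R[i]) :
  (forall e : R, 0 < e -> exists2 r : R, 0 < r & forall t : R, `|t| < r ->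
    normc (g (p + t%:C *: v) - g p - t%:C * l) <= e * `|t|) ->
  real_derivative v g p = l.
Proof.
move=> H.
have part (P : R[i] -> R) : (forall z w, P (z - w) = P z - P w) ->
    (forall z, `|P z| <= normc z) -> (forall (t : R) z, P (t%:C * z) = t * P z) ->
    derive1 (fun t : R => P (g (p + t%:C *: v))) 0 = P l.
  move=> PB Pn PZ; rewrite derive1E; apply: derive_val.
  apply: real_is_derive => e e0; have [r r0 Hr] := H e e0; exists r => // h hr.
  rewrite add0r scale0r addr0 -PZ -!PB; apply: (le_trans (Pn _)); exact: Hr.
rewrite /real_derivative !part.
- by case: (l).
- by move=> [? ?] [? ?].
- exact: normc_ge_absIm.
- by move=> t [x y] /=; ring.
- by move=> [? ?] [? ?].
- exact: normc_ge_absRe.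
- by move=> t [x y] /=; ring.
Qed.

(** The expansion [a z + b conj z] along the complex line of a variable
    contains the derivatives along [1] and ['i], from which both Wirtinger
    derivatives are recovered. *)
Lemma wder_wirtinger (k : 'I_2) g (p : C2 R) a b :
  wder (fun z => g (p + z *: basis_vector k)) a b ->
  wirtinger k g p = a /\ wirtinger_bar k g p = b.
Proof.
move=> D.
have E1 : real_derivative (basis_vector k) g p = a + b.
  apply: real_derivative_wder => e e0; have [r r0 Hr] := D e e0.
  exists r => // t tr; have := Hr t%:C; rewrite normc_real => /(_ tr).
  rewrite scale0r addr0 conjc_real.
  by rewrite -addrA -opprD -mulrDl [_ * t%:C]mulrC.
have E2 : real_derivative ('i *: basis_vector k) g p = 'i * a - 'i * b.
  apply: real_derivative_wder => e e0; have [r r0 Hr] := D e e0.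
  exists r => // t tr; have := Hr (t%:C * 'i); rewrite normcM normc_real normci mulr1 => /(_ tr).
  have -> : conjc (t%:C * 'i) = t%:C * - 'i :> R[i] by simpc.
  rewrite scale0r addr0 scalerA.
  have -> : g (p + (t%:C * 'i) *: basis_vector k) - g p - a * (t%:C * 'i) - b * (t%:C * - 'i) =
    g (p + (t%:C * 'i) *: basis_vector k) - g p - t%:C * ('i * a - 'i * b) by ring.
  by [].
rewrite /wirtinger /wirtinger_bar E1 E2.
have i2 : 'i * 'i = -1 :> R[i] by rewrite -expr2 sqr_i.
have two : (2 : R[i]) != 0 by rewrite pnatr_eq0.
split.
  have -> : a + b - 'i * ('i * a - 'i * b) = a + b - ('i * 'i) * (a - b) by ring.
  by rewrite i2; field.
have -> : a + b + 'i * ('i * a - 'i * b) = a + b + ('i * 'i) * (a - b) by ring.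
by rewrite i2; field.
Qed.

Lemma is_derive_inv (x : R) : x != 0 -> is_derive x (1 : R) (fun y : R => y^-1) (- x ^- 2).
Proof.
move=> x0.
have := @is_deriveV R (fun y : R => y) x 1 1 x0 (is_derive_id _ _).
by rewrite -[_ *: 1]/(_ * 1) mulr1.
Qed.

End WirtingerCalculus.

(** * Functionals on the Bergman space and their representing elements *)

Section Representers.
Context {R : realType} (Om : set (C2 R)).
Hypothesis openOm : forall p, Om p -> \forall q \near p, Om q.
Local Notation V := (C2 R -> R[i]^o).
Local Notation ip := (L2_inner Om).
Local Notation N h := (complex.Re (L2_inner Om h h)).
Implicit Types (p q : C2 R) (h k u v : V) (T S : V -> V) (r : R) (z : R[i]).

Lemma A2_add u v : A2 Om u -> A2 Om v -> A2 Om (u + v).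
Proof. exact: (P_add (A2_comb openOm)). Qed.

Lemma A2_scale (a : R[i]) u : A2 Om u -> A2 Om (a *: u).
Proof. exact: (P_scale (A2_comb openOm) (A2_0 openOm)). Qed.

Lemma L2_innerDl u v w : A2 Om u -> A2 Om v -> A2 Om w -> ip (u + v) w = ip u w + ip v w.
Proof. exact: (ip_add (L2_inner_comb openOm)). Qed.

Lemma L2_innerDr u v w : A2 Om u -> A2 Om v -> A2 Om w -> ip w (u + v) = ip w u + ip w v.
Proof. exact: (ip_addr (A2_comb openOm) (L2_inner_comb openOm) (L2_inner_conj openOm)). Qed.

Lemma L2_innerBr u v w : A2 Om u -> A2 Om v -> A2 Om w -> ip w (u - v) = ip w u - ip w v.
Proof. exact: (ip_subr (A2_comb openOm) (L2_inner_comb openOm) (L2_inner_conj openOm)). Qed.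

Lemma L2_innerZl (a : R[i]) u w : A2 Om u -> A2 Om w -> ip (a *: u) w = a * ip u w.
Proof. exact: (ip_scale (L2_inner_comb openOm) (A2_0 openOm)). Qed.

Lemma L2_innerZr (a : R[i]) u w : A2 Om u -> A2 Om w -> ip w (a *: u) = conjc a * ip w u.
Proof.
exact: (ip_scaler (A2_comb openOm) (L2_inner_comb openOm) (L2_inner_conj openOm) (A2_0 openOm)).
Qed.

Lemma L2_inner_self u : A2 Om u -> ip u u = (N u)%:C.
Proof. exact: (ip_self (L2_inner_conj openOm)). Qed.

Lemma L2_cauchy_schwarz u v : A2 Om u -> A2 Om v -> normc (ip u v) ^+ 2 <= N u * N v.
Proof.
exact: (cauchy_schwarz (A2_comb openOm) (L2_inner_comb openOm) (L2_inner_conj openOm)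
  (@L2_inner_ge0 _ Om) (A2_0 openOm)).
Qed.

Lemma N_ge0 u : A2 Om u -> 0 <= N u.
Proof. exact: L2_inner_ge0. Qed.

(** The families [h |-> T h q] of functionals that arise from evaluation by
    differentiating in [q]: linear, holomorphic in [q] and locally uniformly bounded.
    Representing elements exist and can be differentiated for all of them. *)
Definition tame T :=
  [/\ forall (a : R[i]) u v p, A2 Om u -> A2 Om v -> Om p -> T (a *: u + v) p = a * T u p + T v p,
      forall h, A2 Om h -> holomorphic_on Om (T h)
    & forall p, Om p -> exists2 r : R, 0 < r & exists2 C : R, 0 <= C &
        box p r r `<=` Om /\
        forall h q, A2 Om h -> box p r r q -> normc (T h q) ^+ 2 <= C * N h].

Lemma half_box p r q : 0 < r -> box p (r / 2) (r / 2) q -> box q (r / 2) (r / 2) `<=` box p r r.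
Proof. by move=> r0 pq; have := box_trans (r' := r / 2) (s' := r / 2) pq; rewrite -splitr. Qed.

Lemma tame_id : tame id.
Proof.
split=> [//|h /A2P[]//|p /(open_box openOm)[r r0 bOm]].
have r2 : 0 < r / 2 by rewrite divr_gt0.
exists (r / 2) => //; exists (8 / (r / 2) ^+ 2 * (8 / (r / 2) ^+ 2)).
  by apply: mulr_ge0; apply: divr_ge0 => //; rewrite exprn_ge0// ltW.
split.
  apply: subset_trans bOm; apply: box_le; rewrite ler_pdivrMr// ler_pMr// ler1n//.
move=> h q Ah pq; apply: A2_eval => //.
exact: subset_trans (half_box r0 pq) bOm.
Qed.

Lemma has_cderiv_near (G H : R[i] -> R[i]) z (l : R[i]) r : 0 < r ->
  (forall w, normc (w - z) < r -> G w = H w) -> has_cderiv G z l -> has_cderiv H z l.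
Proof.
move=> r0 E D e e0; have [s s0 Hs] := D e e0.
exists (Num.min r s) => [|w]; first by rewrite lt_min r0.
rewrite lt_min => /andP[wr ws]; rewrite -!E//; first exact: Hs.
by rewrite subrr normc0.
Qed.

Lemma cpartial_near j h k p : differentiable h p -> differentiable k p ->
  (\forall q \near p, h q = k q) -> cpartial j h p = cpartial j k p.
Proof.
move=> dh dk /nbhs_C2P[r r0 E].
have H1 := @cpartial_has_cderiv _ j _ p dh.
have H2 := @cpartial_has_cderiv _ j _ p dk.
apply: has_cderiv_uniq H2; apply: (has_cderiv_near r0 _ H1) => w; rewrite subr0 => wr.
have E0 (c : R[i]) : normc (c - c) < r by rewrite subrr normc0.
have Ew (c : R[i]) : normc (c + w - c) < r by rewrite [c + w]addrC addrK.
by elim/ord2_case: j {H1}; rewrite ?shift0 ?shift1; apply: E; rewrite /=.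
Qed.

(** A partial derivative is bounded at [q] by the values on a box about [q], by
    the Cauchy estimate; hence locally bounded functionals stay so under
    differentiation. *)
Lemma tame_partial T j : tame T -> tame (fun h => cpartial j (T h)).
Proof.
move=> [lT hT bT]; split.
- move=> a u v p Au Av Op.
  have du := hT _ Au p Op; have dv := hT _ Av p Op.
  rewrite -(cpartial_comb j a du dv); apply: cpartial_near.
  + exact: (hT _ (A2_comb openOm a Au Av) p Op).
  + apply: (@differentiableD _ _ _ (fun q => a * T u q : R[i]^o)); last exact: dv.
    exact: (@differentiableZ _ _ _ (T u)).
  + by apply: filterS (openOm Op) => q Oq; exact: lT.
- by move=> h Ah; apply: cpartial_holomorphic openOm (hT h Ah).
move=> p Op; have [r r0 [C C0 [bOm HC]]] := bT p Op.
have r2 : 0 < r / 2 by rewrite divr_gt0.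
exists (r / 2) => //; exists (64 / (r / 2) ^+ 2 * C).
  by apply: mulr_ge0 => //; apply: divr_ge0 => //; rewrite exprn_ge0// ltW.
split.
  apply: subset_trans bOm; apply: box_le; rewrite ler_pdivrMr// ler_pMr// ler1n//.
move=> h q Ah pq; pose M := Num.sqrt (C * N h).
have CN : 0 <= C * N h by rewrite mulr_ge0// N_ge0.
have M2 : M ^+ 2 = C * N h by rewrite sqr_sqrtr.
have := @cpartial_le _ Om j (T h) q (r / 2) M r2 (hT h Ah) (subset_trans (half_box r0 pq) bOm).
have HM x : box q (r / 2) (r / 2) x -> normc (T h x) <= M.
  move=> /(half_box r0 pq) /(HC h x Ah); rewrite -M2.
  by rewrite ler_pXn2r ?nnegrE ?normc_ge0 ?sqrtr_ge0.
move=> /(_ HM) L; have B0 := le_trans (normc_ge0 _) L.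
have -> : 64 / (r / 2) ^+ 2 * C * N h = (8 * M / (r / 2)) ^+ 2.
  by rewrite -mulrA -M2; field; rewrite gt_eqF.
by rewrite ler_pXn2r ?nnegrE ?normc_ge0.
Qed.

(** For [T] the identity this is the function chosen in the definition of the
    Bergman kernel. *)
Definition repr T q : V :=
  xget (fun=> 0) [set k | A2 Om k /\ forall h, A2 Om h -> T h q = ip h k].

(** Riesz representation of [h |-> T h q]. *)
Lemma reprP T q : tame T -> Om q -> A2 Om (repr T q) /\
  forall h, A2 Om h -> T h q = ip h (repr T q).
Proof.
move=> [lT hT bT] Oq; have [r r0 [C C0 [bOm HC]]] := bT q Oq.
have bq : box q r r q by apply: box_center; exact: ltW.
have [k Ak Hk] := @A2_riesz _ _ openOm (fun h => T h q) C
  (fun a u v Au Av => lT a u v q Au Av Oq) (fun u Au => HC u q Au bq).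
by have := @xgetPex _ (fun=> 0) [set k | A2 Om k /\ forall h, A2 Om h -> T h q = ip h k]
  (ex_intro _ k (conj Ak Hk)).
Qed.

Opaque repr.

Lemma quartic_le (a b : R) : 0 <= a -> a ^+ 2 <= b * a -> a <= b \/ a = 0.
Proof.
move=> a0; rewrite expr2; have [->|an0] := eqVneq a 0; first by right.
by rewrite ler_pM2r ?lt_def ?an0//; left.
Qed.

(** Let [x] be the element whose norm is estimated.  Pairing a function with [x]
    gives its Taylor remainder, of second order by [cpartial_taylor] with a constant
    that is a multiple of the norm; applied to [x] itself this bounds the norm of
    [x].  So representing elements depend on the base point in an antiholomorphic
    way, in norm. *)
Lemma repr_taylor T j p : tame T -> Om p -> exists2 r : R, 0 < r & exists2 C : R, 0 <= C &
  forall z, normc z <= r -> Om (p + z *: basis_vector j) /\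
    N (repr T (p + z *: basis_vector j) - repr T p -
       conjc z *: repr (fun h => cpartial j (T h)) p) <= C * normc z ^+ 4.
Proof.
move=> tT Op; have [lT hT bT] := tT; have [r r0 [C C0 [bOm HC]]] := bT p Op.
have tT' := tame_partial j tT.
have r3 : 0 < r / 3 by rewrite divr_gt0.
have E3 : 3 * (r / 3) = r by field.
exists (r / 3) => //; exists ((256 / (r / 3) ^+ 2) ^+ 2 * C).
  by rewrite mulr_ge0// sqr_ge0.
move=> z zr; have Oz : Om (p + z *: basis_vector j).
  apply/bOm/box_shift/(le_trans zr); rewrite ler_pdivrMr// ler_pMr// ler1n//.
split => //; set x := (_ - _ - _).
have [Az Hz] := reprP tT Oz; have [A0 H0] := reprP tT Op; have [A' H'] := reprP tT' Op.
have Az0 := A2_sub openOm Az A0; have As := A2_scale (conjc z) A'.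
have Ax : A2 Om x by exact: A2_sub.
have N0 := N_ge0 Ax.
pose M := Num.sqrt (C * N x).
have CN : 0 <= C * N x by rewrite mulr_ge0.
have M2 : M ^+ 2 = C * N x by rewrite sqr_sqrtr.
have := @cpartial_taylor _ Om j (T x) p (r / 3) M z r3 (hT x Ax); rewrite E3 => /(_ bOm).
have HM q : box p r r q -> normc (T x q) <= M.
  move=> /(HC x q Ax); rewrite -M2.
  by rewrite ler_pXn2r ?nnegrE ?normc_ge0 ?sqrtr_ge0.
move=> /(_ HM zr).
have -> : T x (p + z *: basis_vector j) - T x p - cpartial j (T x) p * z = ip x x.
  have -> : ip x x = ip x (repr T (p + z *: basis_vector j) - repr T p -
    conjc z *: repr (fun h => cpartial j (T h)) p) by [].
  rewrite (Hz _ Ax) (H0 _ Ax) (H' _ Ax); clearbody x.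
  by rewrite !L2_innerBr// L2_innerZr// conjcK [z * _]mulrC.
rewrite (L2_inner_self Ax) normc_real (ger0_norm N0) => L.
have B0 := le_trans N0 L.
have : N x ^+ 2 <= (256 * M / (r / 3) ^+ 2 * normc z ^+ 2) ^+ 2.
  by rewrite ler_pXn2r.
have -> : (256 * M / (r / 3) ^+ 2 * normc z ^+ 2) ^+ 2 =
    ((256 / (r / 3) ^+ 2) ^+ 2 * C * normc z ^+ 4) * N x.
  transitivity ((256 / (r / 3) ^+ 2) ^+ 2 * normc z ^+ 4 * M ^+ 2).
    by field; rewrite gt_eqF.
  by rewrite M2; ring.
case/(quartic_le N0) => // ->.
by rewrite mulr_ge0 ?exprn_ge0 ?normc_ge0// mulr_ge0// sqr_ge0.
Qed.

Local Notation nm u := (Num.sqrt (N u)).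

Lemma L2_inner_le u v (a b : R) : A2 Om u -> A2 Om v -> 0 <= a -> 0 <= b ->
  N u <= a ^+ 2 -> N v <= b ^+ 2 -> normc (ip u v) <= a * b.
Proof.
move=> Au Av a0 b0 ua vb; rewrite -(@ler_pXn2r _ 2) ?nnegrE ?normc_ge0 ?mulr_ge0//.
apply: (le_trans (L2_cauchy_schwarz Au Av)); rewrite exprMn.
by apply: ler_pM => //; exact: N_ge0.
Qed.

Lemma inner_expansion (a0 a' b0 b' az bz : V) z (C D : R) : A2 Om a0 -> A2 Om a' -> A2 Om b0 ->
  A2 Om b' -> A2 Om az -> A2 Om bz -> normc z <= 1 -> 0 <= C -> 0 <= D ->
  N (az - a0 - conjc z *: a') <= C * normc z ^+ 4 ->
  N (bz - b0 - conjc z *: b') <= D * normc z ^+ 4 ->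
  normc (ip az bz - ip a0 b0 - ip a0 b' * z - ip a' b0 * conjc z) <=
  (nm a' * nm b' + nm a0 * Num.sqrt D + nm a' * Num.sqrt D + Num.sqrt C * nm b0 +
   Num.sqrt C * nm b' + Num.sqrt C * Num.sqrt D) * normc z ^+ 2.
Proof.
move=> A0 A' B0 B' Az Bz z1 C0 D0; set c := Num.sqrt C; set d := Num.sqrt D.
have Aa := A2_scale (conjc z) A'; have Ab := A2_scale (conjc z) B'.
have Ax := A2_sub openOm (A2_sub openOm Az A0) Aa.
have Ay := A2_sub openOm (A2_sub openOm Bz B0) Ab.
have Ea : az = a0 + conjc z *: a' + (az - a0 - conjc z *: a').
  by apply/funext => q; rewrite !fctE; ring.
have Eb : bz = b0 + conjc z *: b' + (bz - b0 - conjc z *: b').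
  by apply/funext => q; rewrite !fctE; ring.
move: (az - a0 - _) (bz - b0 - _) Ax Ay Ea Eb => x y Ax Ay Ea Eb Nx Ny.
rewrite Ea Eb {Ea Eb}.
have Aaa := A2_add A0 Aa; have Abb := A2_add B0 Ab; have By := A2_add Abb Ay.
have E : ip (a0 + conjc z *: a' + x) (b0 + conjc z *: b' + y) =
   ip a0 b0 + z * ip a0 b' + ip a0 y + conjc z * (ip a' b0 + z * ip a' b' + ip a' y)
   + (ip x b0 + z * ip x b' + ip x y).
  rewrite (L2_innerDl Aaa Ax By) (L2_innerDl A0 Aa By) (L2_innerZl _ A' By).
  rewrite (L2_innerDr Abb Ay A0) (L2_innerDr Abb Ay A') (L2_innerDr Abb Ay Ax).
  rewrite (L2_innerDr B0 Ab A0) (L2_innerDr B0 Ab A') (L2_innerDr B0 Ab Ax).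
  by rewrite (L2_innerZr _ B' A0) (L2_innerZr _ B' A') (L2_innerZr _ B' Ax) conjcK.
rewrite E {E}.
set R1 := (X in normc X <= _).
have -> : R1 = (z * conjc z) * ip a' b' + ip a0 y + conjc z * ip a' y + ip x b0
    + z * ip x b' + ip x y by rewrite /R1; ring.
have n0 := normc_ge0 z; have n2 : 0 <= normc z ^+ 2 by exact: sqr_ge0.
have cz : N x <= (c * normc z ^+ 2) ^+ 2 by rewrite exprMn -exprM sqr_sqrtr.
have dz : N y <= (d * normc z ^+ 2) ^+ 2 by rewrite exprMn -exprM sqr_sqrtr.
have c0 : 0 <= c by exact: sqrtr_ge0. have d0 : 0 <= d by exact: sqrtr_ge0.
have cz0 : 0 <= c * normc z ^+ 2 by exact: mulr_ge0.
have dz0 : 0 <= d * normc z ^+ 2 by exact: mulr_ge0.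
have sq := @sqrtr_ge0 R.
have nmE u : A2 Om u -> N u <= nm u ^+ 2 by move=> Au; rewrite sqr_sqrtr// N_ge0.
have L1 := L2_inner_le A' B' (sq _) (sq _) (nmE _ A') (nmE _ B').
have L2 := L2_inner_le A0 Ay (sq _) dz0 (nmE _ A0) dz.
have L3 := L2_inner_le A' Ay (sq _) dz0 (nmE _ A') dz.
have L4 := L2_inner_le Ax B0 cz0 (sq _) cz (nmE _ B0).
have L5 := L2_inner_le Ax B' cz0 (sq _) cz (nmE _ B').
have L6 := L2_inner_le Ax Ay cz0 dz0 cz dz.
have n21 : normc z ^+ 2 <= 1 by rewrite expr_le1.
apply: (le_trans (le_normcD _ _)); rewrite !mulrDl; apply: lerD; last first.
  apply: (le_trans L6); rewrite mulrACA mulrA; apply: ler_piMr => //.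
  by apply: mulr_ge0 => //; exact: mulr_ge0.
have lez (w : R[i]) (t : R) : normc w <= t -> normc (z * w) <= t.
  move=> wt; rewrite normcM; apply: le_trans wt; apply: ler_piMl => //; exact: normc_ge0.
have lezJ (w : R[i]) (t : R) : normc w <= t -> normc (conjc z * w) <= t.
  move=> wt; rewrite normcM normc_conj; apply: le_trans wt; apply: ler_piMl => //; exact: normc_ge0.
apply: (le_trans (le_normcD _ _)); apply: lerD; last first.
  by apply: lez; apply: (le_trans L5); rewrite mulrAC.
apply: (le_trans (le_normcD _ _)); apply: lerD; last first.
  by apply: (le_trans L4); rewrite mulrAC.
apply: (le_trans (le_normcD _ _)); apply: lerD; last first.
  by apply: lezJ; apply: (le_trans L3); rewrite mulrA.
apply: (le_trans (le_normcD _ _)); apply: lerD; last first.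
  by apply: (le_trans L2); rewrite mulrA.
by rewrite !normcM normc_conj -expr2 mulrC; apply: ler_wpM2r.
Qed.

(** Both factors have first order expansions in norm by [repr_taylor], in powers
    of [conj z]; the second slot of the inner product is antilinear, and contributes
    the term in [z]. *)
Lemma repr_inner_wder T S j p : tame T -> tame S -> Om p ->
  wder (fun z => ip (repr T (p + z *: basis_vector j)) (repr S (p + z *: basis_vector j)))
    (ip (repr T p) (repr (fun h => cpartial j (S h)) p))
    (ip (repr (fun h => cpartial j (T h)) p) (repr S p)).
Proof.
move=> tT tS Op; have [r r0 [C C0 HC]] := repr_taylor j tT Op.
have [s s0 [D D0 HD]] := repr_taylor j tS Op.
have [A0 _] := reprP tT Op; have [A' _] := reprP (tame_partial j tT) Op.
have [B0 _] := reprP tS Op; have [B' _] := reprP (tame_partial j tS) Op.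
have m0 : 0 < Num.min 1 (Num.min r s) by rewrite !lt_min ltr01 r0.
apply: (wder_quadratic m0) => z; rewrite !le_min => /andP[z1 /andP[zr zs]].
have [Oz Nx] := HC z zr; have [_ Ny] := HD z zs.
have [Az _] := reprP tT Oz; have [Bz _] := reprP tS Oz.
rewrite scale0r addr0.
exact: (inner_expansion A0 A' B0 B' Az Bz z1 C0 D0 Nx Ny).
Qed.

End Representers.

(** * The Bergman metric in terms of representing elements *)

Section BergmanMetric.
Context {R : realType} (Om : set (C2 R)).
Hypothesis openOm : forall p, Om p -> \forall q \near p, Om q.
Local Notation V := (C2 R -> R[i]^o).
Local Notation ip := (L2_inner Om).
Local Notation N h := (complex.Re (L2_inner Om h h)).
Local Notation K := (bergman_diagonal Om).
Implicit Types (p q xi : C2 R) (h : V) (r : R) (z : R[i]) (j k : 'I_2).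

Local Notation kappa := (repr Om (@id V)).
Local Notation L k := (repr Om (fun h : V => (cpartial k h : V))).

Let tame_d k : tame Om (fun h : V => (cpartial k h : V)) := tame_partial openOm k (tame_id openOm).

Lemma bergman_kernel_repr q : Om q -> K q = N (kappa q).
Proof.
move=> Oq; have [Ak Hk] := reprP openOm (tame_id openOm) Oq.
by rewrite -(Hk _ Ak).
Qed.

Lemma bergman_diagonal_ge0 q : Om q -> 0 <= K q.
Proof.
move=> Oq; rewrite bergman_kernel_repr//; apply: L2_inner_ge0.
by have [] := reprP openOm (tame_id openOm) Oq.
Qed.

Lemma open_line j p : Om p -> exists2 r : R, 0 < r & forall z, normc z < r ->
  Om (p + z *: basis_vector j).
Proof.
move=> /(open_box openOm)[r r0 bOm]; exists r => // z /ltW zr.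
exact/bOm/box_shift.
Qed.

(** On the diagonal the kernel is the squared norm of the representing element
    of the evaluation. *)
Lemma bergman_diagonal_wder j p : Om p ->
  wder (fun z => (K (p + z *: basis_vector j))%:C)
    (ip (kappa p) (L j p)) (ip (L j p) (kappa p)).
Proof.
move=> Op; have [r r0 Or] := open_line j Op.
apply: (wder_near r0 _ (repr_inner_wder openOm j (tame_id openOm) (tame_id openOm) Op)).
move=> z /Or Oz; have [Ak _] := reprP openOm (tame_id openOm) Oz.
by rewrite (bergman_kernel_repr Oz) (L2_inner_self openOm Ak).
Qed.

Lemma wirtinger_bar_ln_diagonal k p : Om p -> 0 < K p ->
  wirtinger_bar k (fun q => (ln (K q))%:C) p = (K p)^-1%:C * ip (L k p) (kappa p).
Proof.
move=> Op K0; have D := bergman_diagonal_wder k Op.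
have Dln : is_derive (K (p + 0 *: basis_vector k)) (1 : R) (@ln R) (K p)^-1.
  by rewrite scale0r addr0; exact: is_derive1_ln.
have := wder_comp_real D Dln.
by move/(@wder_wirtinger R k (fun q => (ln (K q))%:C) p) => [].
Qed.

(** The mixed derivative involves only pairings of first order representing
    elements: the elements of second order occur in the coefficient of [conj z],
    which the derivative [wirtinger j] does not see. *)
Lemma hessian_entry j k p : Om p -> 0 < K p ->
  wirtinger j (wirtinger_bar k (fun q => (ln (K q))%:C)) p =
  (K p)^-1%:C * ip (L k p) (L j p) -
  ((K p) ^- 2)%:C * (ip (L k p) (kappa p) * ip (kappa p) (L j p)).
Proof.
move=> Op K0; have D := bergman_diagonal_wder j Op.
have Di : is_derive (K (p + 0 *: basis_vector j)) (1 : R) (fun y : R => y^-1) (- (K p) ^- 2).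
  by rewrite scale0r addr0; apply: is_derive_inv; rewrite gt_eqF.
have DL := repr_inner_wder openOm j (tame_d k) (tame_id openOm) Op.
have DM := wderM (wder_comp_real D Di) DL.
have [r r0 Or] := open_line j Op.
have K0' : 0 < K (p + 0 *: basis_vector j) by rewrite scale0r addr0.
have [s s0 Ks] := wder_cont_gt0 (u := fun z => K (p + z *: basis_vector j)) D K0'.
have m0 : 0 < Num.min r s by rewrite lt_min r0.
pose W q := wirtinger_bar k (fun q => (ln (K q))%:C) q.
have E z : normc z < Num.min r s -> ((K (p + z *: basis_vector j))^-1)%:C *
    ip (L k (p + z *: basis_vector j)) (kappa (p + z *: basis_vector j)) =
    W (p + z *: basis_vector j).
  by rewrite lt_min => /andP[/Or Oz /Ks Kz]; rewrite /W wirtinger_bar_ln_diagonal.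
have [-> _] := @wder_wirtinger R j W p _ _ (wder_near m0 E DM).
by rewrite scale0r addr0 rmorphN /=; ring.
Qed.

Lemma sum_ord2 (G : 'I_2 -> R[i]) : \sum_(j < 2) G j = G 0 + G 1.
Proof. by rewrite !big_ord_recl big_ord0 addr0; congr (_ + G _); exact/val_inj. Qed.

Lemma sum_ord22 (G : 'I_2 -> 'I_2 -> R[i]) :
  \sum_(j < 2) \sum_(k < 2) G j k = G 0 0 + G 0 1 + (G 1 0 + G 1 1).
Proof. by rewrite sum_ord2 (sum_ord2 (G 0)) (sum_ord2 (G 1)). Qed.

Lemma complex_hessian_sum (u : C2 R -> R) p xi (H : 'I_2 -> 'I_2 -> R[i]) :
  (forall j k, wirtinger j (wirtinger_bar k (fun q => (u q)%:C)) p = H j k) ->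
  complex_hessian u p xi = complex.Re (
    H 0 0 * xi.1 * conjc xi.1 + H 0 1 * xi.1 * conjc xi.2 +
    (H 1 0 * xi.2 * conjc xi.1 + H 1 1 * xi.2 * conjc xi.2)).
Proof.
move=> HE; rewrite -!HE {HE}.
have c0 : coordinate xi 0 = xi.1 by [].
have c1 : coordinate xi 1 = xi.2 by [].
have := sum_ord22 (fun j k => wirtinger j (wirtinger_bar k (fun q => (u q)%:C)) p * coordinate xi j * (coordinate xi k)^*).
rewrite c0 c1; exact: (congr1 (@complex.Re R)).
Qed.

Definition dxi p xi h : R[i] := xi.1 * cpartial 0 h p + xi.2 * cpartial 1 h p.

Definition repr_dxi p xi : V := conjc xi.1 *: L 0 p + conjc xi.2 *: L 1 p.

Lemma repr_dxiP p xi : Om p -> A2 Om (repr_dxi p xi) /\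
  forall h, A2 Om h -> dxi p xi h = ip h (repr_dxi p xi).
Proof.
move=> Op; have [A0 H0] := reprP openOm (tame_d 0) Op; have [A1 H1] := reprP openOm (tame_d 1) Op.
have A0' := A2_scale openOm (conjc xi.1) A0; have A1' := A2_scale openOm (conjc xi.2) A1.
split=> [|h Ah]; first exact: A2_add.
rewrite /repr_dxi (L2_innerDr openOm A0' A1' Ah) (L2_innerZr openOm _ A0 Ah).
by rewrite (L2_innerZr openOm _ A1 Ah) !conjcK /dxi H0// H1.
Qed.

(** The sum over both indices assembles into the element representing the
    derivative along [xi]. *)
Lemma bergman_metricE p xi : Om p -> 0 < K p ->
  bergman_metric Om p xi =
  (K p)^-1 * N (repr_dxi p xi) - (K p) ^- 2 * normc (ip (repr_dxi p xi) (kappa p)) ^+ 2.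
Proof.
move=> Op K0; have [A0 _] := reprP openOm (tame_d 0) Op; have [A1 _] := reprP openOm (tame_d 1) Op.
have [Ak _] := reprP openOm (tame_id openOm) Op.
have A0' := A2_scale openOm (conjc xi.1) A0; have A1' := A2_scale openOm (conjc xi.2) A1.
have [Ax _] := repr_dxiP xi Op.
have E1 : ip (repr_dxi p xi) (kappa p) =
    conjc xi.1 * ip (L 0 p) (kappa p) + conjc xi.2 * ip (L 1 p) (kappa p).
  rewrite /repr_dxi (L2_innerDl openOm A0' A1' Ak).
  by rewrite (L2_innerZl openOm _ A0 Ak) (L2_innerZl openOm _ A1 Ak).
have E2 : ip (repr_dxi p xi) (repr_dxi p xi) =
    conjc xi.1 * (xi.1 * ip (L 0 p) (L 0 p) + xi.2 * ip (L 0 p) (L 1 p)) +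
    conjc xi.2 * (xi.1 * ip (L 1 p) (L 0 p) + xi.2 * ip (L 1 p) (L 1 p)).
  rewrite {1}/repr_dxi (L2_innerDl openOm A0' A1' Ax).
  rewrite (L2_innerZl openOm _ A0 Ax) (L2_innerZl openOm _ A1 Ax) /repr_dxi.
  rewrite (L2_innerDr openOm A0' A1' A0) (L2_innerDr openOm A0' A1' A1).
  rewrite (L2_innerZr openOm _ A0 A0) (L2_innerZr openOm _ A1 A0).
  by rewrite (L2_innerZr openOm _ A0 A1) (L2_innerZr openOm _ A1 A1) !conjcK.
have E3 : (normc (ip (repr_dxi p xi) (kappa p)) ^+ 2)%:C =
    (conjc xi.1 * ip (L 0 p) (kappa p) + conjc xi.2 * ip (L 1 p) (kappa p)) *
    (xi.1 * ip (kappa p) (L 0 p) + xi.2 * ip (kappa p) (L 1 p)).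
  rewrite E1 (L2_inner_conj openOm A0 Ak) (L2_inner_conj openOm A1 Ak).
  set w := conjc xi.1 * _ + _.
  have -> : xi.1 * conjc (ip (L 0 p) (kappa p)) + xi.2 * conjc (ip (L 1 p) (kappa p)) = conjc w.
    by rewrite /w rmorphD !rmorphM /= !conjcK.
  by rewrite normc_sqrE; case: (w) => x y; simpc; congr (_ +i* _); ring.
rewrite /bergman_metric (complex_hessian_sum xi (fun j k => hessian_entry j k Op K0)).
set X := (X in complex.Re X).
have -> : X = (K p)^-1%:C * (N (repr_dxi p xi))%:C -
    ((K p) ^- 2)%:C * (normc (ip (repr_dxi p xi) (kappa p)) ^+ 2)%:C.
  rewrite E3 -(L2_inner_self openOm Ax) E2 /X; clear.
  move: (ip _ _) (ip _ _) (ip _ _) (ip _ _) (ip _ _) (ip _ _) (ip _ _) (ip _ _).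
  move: (conjc xi.1) (conjc xi.2) (xi.1) (xi.2) ((K p)^-1%:C) (((K p) ^- 2)%:C) => *; ring.
by rewrite -!rmorphM -rmorphB.
Qed.

Lemma conjcMr z (t : R) : conjc (z * t%:C) = conjc z * t%:C.
Proof. by case: z => a b; simpc. Qed.

Lemma mulcJr z (t : R) : conjc z * t%:C * z = (t * normc z ^+ 2)%:C.
Proof. by rewrite normc_sqrE; case: z => a b; simpc; rewrite /=; congr (_ +i* _); ring. Qed.

Lemma bergman_metric_le p xi : Om p -> 0 < K p ->
  bergman_metric Om p xi <= N (repr_dxi p xi) / K p.
Proof.
move=> Op K0; rewrite bergman_metricE// mulrC lerBlDr lerDl.
by rewrite mulr_ge0 ?sqr_ge0// invr_ge0 sqr_ge0.
Qed.

(** Since [h p = 0], the representing element of the derivative may be replaced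
    by its component orthogonal to that of the evaluation; the squared norm of this
    component is [K p] times the metric.  Then Cauchy-Schwarz. *)
Lemma bergman_metric_ge p xi h : Om p -> 0 < K p -> A2 Om h -> h p = 0 ->
  normc (dxi p xi h) ^+ 2 <= N h * (K p * bergman_metric Om p xi).
Proof.
move=> Op K0 Ah hp; have [Ax Hx] := repr_dxiP xi Op.
have [Ak Hk] := reprP openOm (tame_id openOm) Op.
have hk : ip h (kappa p) = 0 by rewrite -Hk.
rewrite bergman_metricE//; set x := repr_dxi p xi in Ax Hx *; set kp := kappa p in Ak Hk hk *.
(* [c *: kp] is the orthogonal projection of [x] onto the line of [kp]. *)
pose c := ip x kp * (K p)^-1%:C.
have Ac := A2_scale openOm c Ak; have Ay := A2_sub openOm Ax Ac.
have -> : dxi p xi h = ip h (x - c *: kp).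
  by rewrite (L2_innerBr openOm Ax Ac Ah) (L2_innerZr openOm _ Ak Ah) hk mulr0 subr0 Hx.
have := L2_cauchy_schwarz openOm Ah Ay; congr (_ <= _ * _).
have KE : ip kp kp = (K p)%:C by rewrite (bergman_kernel_repr Op) (L2_inner_self openOm Ak).
have K1 : (K p)%:C != 0 by rewrite -normc_gt0 normc_real ger0_norm// ltW.
have E : ip (x - c *: kp) (x - c *: kp) = ip x x - conjc c * ip x kp.
  have B : ip kp (x - c *: kp) = 0.
    rewrite (L2_innerBr openOm Ax Ac Ak) (L2_innerZr openOm _ Ak Ak) KE.
    rewrite (L2_inner_conj openOm Ax Ak) /c conjcMr fmorphV.
    by rewrite -mulrA mulVf// mulr1 subrr.
  have C : ip (x - c *: kp) (x - c *: kp) = ip x (x - c *: kp) - c * ip kp (x - c *: kp).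
    have := L2_innerDl openOm Ay Ac Ay; rewrite subrK (L2_innerZl openOm _ Ak Ay) => ->.
    by rewrite addrK.
  by rewrite C B mulr0 subr0 (L2_innerBr openOm Ax Ac Ax) (L2_innerZr openOm _ Ak Ax).
rewrite E /c conjcMr.
rewrite mulcJr (L2_inner_self openOm Ax) -rmorphB /=; field; exact: lt0r_neq0.
Qed.

(** The bound is applied to the representing element itself. *)
Lemma repr_bound (A : V) (lam : V -> R[i]) (C : R) : A2 Om A -> 
  (forall h, A2 Om h -> lam h = ip h A) ->
  (forall h, A2 Om h -> normc (lam h) ^+ 2 <= C * N h) -> 0 <= C -> N A <= C.
Proof.
move=> AA HA HC C0; have N0 := L2_inner_ge0 AA; have := HC _ AA.
rewrite HA// (L2_inner_self openOm AA) normc_real (ger0_norm N0).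
by case/(quartic_le N0) => // ->.
Qed.

End BergmanMetric.

(** * Calculus of one real variable *)

Section RealDerivatives.
Context {R : realType}.
Implicit Types (f g : R -> R) (a b d e r s t x y : R).

Lemma derD f g x a b : is_derive x (1 : R) f a -> is_derive x (1 : R) g b ->
  is_derive x (1 : R) (fun y => f y + g y) (a + b).
Proof. by move=> Hf Hg; exact: is_deriveD. Qed.

Lemma derM f g x a b : is_derive x (1 : R) f a -> is_derive x (1 : R) g b ->
  is_derive x (1 : R) (fun y => f y * g y) (a * g x + f x * b).
Proof.
move=> Hf Hg; have := @is_deriveM _ _ f g x 1 a b Hf Hg.
by rewrite -[_ *: b]/(_ * b) -[_ *: a]/(_ * a) addrC [g x * a]mulrC.
Qed.

Lemma derC x k : is_derive x (1 : R) (fun=> k) (0 : R).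
Proof. exact: is_derive_cst. Qed.

Lemma derI x : is_derive x (1 : R) (fun y : R => y) (1 : R).
Proof. exact: is_derive_id. Qed.

Lemma der_comp f g x a b : is_derive (g x) (1 : R) f a -> is_derive x (1 : R) g b ->
  is_derive x (1 : R) (fun y => f (g y)) (a * b).
Proof. by move=> Hf Hg; exact: is_derive1_comp. Qed.

Lemma der_eq f x a b : is_derive x (1 : R) f a -> a = b -> is_derive x (1 : R) f b.
Proof. by move=> H <-. Qed.

Lemma der_continuous f x a : is_derive x (1 : R) f a -> {for x, continuous f}.
Proof. by case=> df _; apply: differentiable_continuous; exact/derivable1_diffP. Qed.

Lemma mvt f f' a b : a < b -> (forall x, a <= x <= b -> is_derive x (1 : R) f (f' x)) ->
  exists2 c, a < c < b & f b - f a = f' c * (b - a).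
Proof.
move=> ab df; have H x : x \in `]a, b[%R -> is_derive x (1 : R) f (f' x).
  by rewrite in_itv /= => /andP[ac cb]; apply: df; rewrite !ltW.
have C : {within `[a, b], continuous f}.
  apply: continuous_in_subspaceT => x; rewrite inE /= in_itv /= => xab.
  exact: der_continuous (df x xab).
by have [c cab E] := MVT ab H C; exists c => //; rewrite in_itv in cab.
Qed.

(** Only the existence of the second derivative at [x0] is available, so the
    bound is one-sided with a margin [e]: the comparison function has a derivative
    of the sign of [x0 - x] near [x0]. *)
Lemma taylor_upper g g1 x0 d e : 0 < x0 -> 0 < e ->
  (forall x, 0 < x -> is_derive x (1 : R) g (g1 x)) -> is_derive x0 (1 : R) g1 d ->
  exists2 r, 0 < r & forall h, `|h| < r ->
    0 < x0 + h /\ g (x0 + h) <= g x0 + g1 x0 * h + (d / 2 + e) * h ^+ 2.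
Proof.
move=> x00 e0 dg dg1; have [r r0 Hr] := is_derive_eps dg1 e0.
exists (Num.min r x0); first by rewrite lt_min r0.
move=> h; rewrite lt_min => /andP[hr hx]; have xh : 0 < x0 + h.
  by move: hx; rewrite ltr_norml => /andP[? _]; lra.
split=> //.
pose psi x := g x - g1 x0 * (x - x0) - (d / 2 + e) * ((x - x0) * (x - x0)).
pose psi' x := g1 x - g1 x0 - (d + 2 * e) * (x - x0).
have dpsi x : 0 < x -> is_derive x (1 : R) psi (psi' x).
  move=> xp; have Dx : is_derive x (1 : R) (fun y => y - x0) 1.
    by apply: der_eq (derD (derI x) (derC x (- x0))) _; rewrite addr0.
  have := derD (derD (dg x xp) (derM (derC x (- g1 x0)) Dx))
    (derM (derC x (- (d / 2 + e))) (derM Dx Dx)).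
  have -> : (fun y => g y + - g1 x0 * (y - x0) + - (d / 2 + e) * ((y - x0) * (y - x0))) = psi.
    by apply/funext => y; rewrite /psi; ring.
  by move/der_eq; apply; rewrite /psi'; field.
suff : psi (x0 + h) <= psi x0.
  have E : x0 + h - x0 = h by ring.
  by rewrite /psi E subrr !mulr0 !subr0 expr2; lra.
have key c : `|c - x0| < r -> 0 < c -> psi' c * (c - x0) <= 0.
  move=> cr c0; have := Hr (c - x0) cr; rewrite [x0 + _]addrC subrK => L.
  have {}L : (g1 c - g1 x0 - (c - x0) * d) * (c - x0) <= e * (c - x0) ^+ 2.
    apply: (le_trans (ler_norm _)); rewrite normrM -[X in _ <= _ * X]ger0_norm ?sqr_ge0//.
    by rewrite normrX expr2 mulrA ler_wpM2r.
  rewrite /psi'; have := mulr_ge0 (ltW e0) (sqr_ge0 (c - x0)); move: L; nra.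
have [hp|hn|<-] := ltgtP 0 h; last by rewrite addr0.
- have lt : x0 < x0 + h by rewrite ltrDl.
  have [x /andP[x1 _]|c /andP[c1 c2] E] := mvt lt (f := psi) (f' := psi').
    by apply: dpsi; exact: lt_le_trans x1.
  have c0 : 0 < c - x0 by rewrite subr_gt0.
  have : psi' c <= 0.
    rewrite -(pmulr_lle0 _ c0); apply: key; last exact: lt_trans c1.
    by rewrite gtr0_norm//; move: hr; rewrite gtr0_norm//; lra.
  move=> n; rewrite -subr_le0 E [x0 + h]addrC addrK.
  by rewrite mulr_le0_ge0// ltW.
- have lt : x0 + h < x0 by rewrite gtrDl.
  have [x /andP[x1 _]|c /andP[c1 c2] E] := mvt lt (f := psi) (f' := psi').
    by apply: dpsi; exact: lt_le_trans x1.
  have c0 : c - x0 < 0 by rewrite subr_lt0.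
  have : 0 <= psi' c.
    rewrite -(nmulr_lle0 _ c0); apply: key; last exact: lt_trans c1.
    by rewrite ltr0_norm//; move: hr; rewrite ltr0_norm//; lra.
  move=> n; rewrite -subr_ge0 E opprD addrA subrr sub0r.
  by rewrite mulr_ge0// oppr_ge0 ltW.
Qed.

Lemma integral_cos_square (a b d : R) :
  (\int[lebesgue_measure]_(t in `[0%R, (2 * pi)%R]) (a + b * cos t + d * (cos t * cos t))%:E =
   (2 * pi * a + pi * d)%:E)%E.
Proof.
pose G t := a * t + b * sin t + d / 2 * (t + sin t * cos t).
have pi0 : 0 < 2 * pi :> R by rewrite mulr_gt0// pi_gt0.
have dG t : is_derive t (1 : R) G (a + b * cos t + d * (cos t * cos t)).
  have ds := is_derive_sin t; have dc := is_derive_cos t.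
  have := derD (derD (derM (derC t a) (derI t)) (derM (derC t b) ds))
    (derM (derC t (d / 2)) (derD (derI t) (derM ds dc))).
  move/der_eq; apply; have := cos2Dsin2 t; rewrite !expr2.
  move: (cos t) (sin t) => c s cs.
  have -> : 1 + (c * c + s * - s) = 2 * (c * c) by lra.
  by field.
have cG : continuous G by move=> t; exact: der_continuous (dG t).
rewrite (@continuous_FTC2 _ _ G) //.
- rewrite -EFinB /G (_ : 2 * pi = pi *+ 2) ?sin2pi ?sin0; last by rewrite mulr_natl.
  congr EFin; rewrite -mulr_natl.
  by rewrite !(mulr0, mul0r, addr0, add0r, subr0); field.
- apply: continuous_subspaceT => t.
  have dc := is_derive_cos t.
  exact: der_continuous (derD (derD (derC t a) (derM (derC t b) dc)) (derM (derC t d) (derM dc dc))).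
- split.
  + by move=> t _; case: (dG t).
  + by apply: cvg_at_right_filter; exact: cG.
  + by apply: cvg_at_left_filter; exact: cG.
- by move=> t _; rewrite derive1E; case: (dG t).
Qed.

End RealDerivatives.

(** * Subharmonicity of a radial function *)

Section Profile.
Context {R : realType}.
Implicit Types (F : R[i] -> R) (f g : R -> R) (a b d e r s t x y : R).

Lemma halfline_eps g g' : is_derivative_on_halfline g g' -> forall x, 0 <= x ->
  forall e, 0 < e -> exists2 r, 0 < r & forall y, 0 <= y -> `|y - x| < r ->
    `|g y - g x - (y - x) * g' x| <= e * `|y - x|.
Proof.
move=> H x x0 e e0; have /cvgrPdist_le/(_ e e0) := H x x0.
rewrite /within /= => /nbhs_ballP[r r0 Hr]; exists r => // y y0 yx.
have [->|yn] := eqVneq y x; first by rewrite !subrr mul0r subr0 normr0 mulr0.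
have yx0 : y - x != 0 by rewrite subr_eq0.
have := Hr y; rewrite /ball /= distrC => /(_ yx yn y0) L.
have -> : g y - g x - (y - x) * g' x = - ((g' x - (g y - g x) / (y - x)) * (y - x)) by field.
by rewrite normrN normrM ler_wpM2r.
Qed.

Lemma halfline_is_derive g g' : is_derivative_on_halfline g g' -> forall x, 0 < x ->
  is_derive x (1 : R) g (g' x).
Proof.
move=> H x x0; apply: real_is_derive => e e0.
have [r r0 Hr] := halfline_eps H (ltW x0) e0; exists (Num.min r x) => [|h].
  by rewrite lt_min r0.
rewrite lt_min => /andP[hr hx]; have xh : 0 <= x + h.
  by move: hx; rewrite ltr_norml => /andP[? _]; lra.
by have := Hr (x + h) xh; rewrite [x + h]addrC addrK => /(_ hr).
Qed.

Lemma halfline_lip g g' : is_derivative_on_halfline g g' -> forall x, 0 <= x ->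
  exists2 C, 0 < C & exists2 r, 0 < r & forall y, 0 <= y -> `|y - x| < r ->
    `|g y - g x| <= C * `|y - x|.
Proof.
move=> H x x0; exists (`|g' x| + 1); first by rewrite ltr_wpDl.
have [r r0 Hr] := halfline_eps H x0 ltr01; exists r => // y y0 yx.
have -> : g y - g x = (y - x) * g' x + (g y - g x - (y - x) * g' x) by ring.
apply: (le_trans (ler_normD _ _)); rewrite [leRHS]mulrDl; apply: lerD; last exact: Hr.
by rewrite normrM mulrC.
Qed.

Variables (F : R[i] -> R) (f : R -> R).
Hypothesis F_subharmonic : subharmonic F.
Hypothesis fE : forall z : R[i], f (normc z) = F z.
Hypothesis F_flat : vanishes_to_infinite_order f.

Lemma flat_derivatives : exists f1 f2 : R -> R,
  [/\ is_derivative_on_halfline f f1, is_derivative_on_halfline f1 f2, f 0 = 0, f1 0 = 0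
    & forall n, f x / x ^+ n @[x --> 0^'+] --> (0 : R)].
Proof.
have [D [D0 DD Dz fl]] := F_flat; exists (D 1%N), (D 2%N); split => //.
  move=> x x0; apply: cvg_trans (DD 0%N x x0); apply: near_eq_cvg.
  by rewrite near_withinE; apply: nearW => y y0; rewrite !D0.
by rewrite -D0// Dz.
Qed.

Lemma circle_norm r0 t (delta : R) :
  normc (r0%:C + (delta * cos t +i* (delta * sin t))) =
  Num.sqrt (r0 ^+ 2 + (2 * r0 * delta * cos t + delta ^+ 2)).
Proof.
rewrite normcE' /=; congr Num.sqrt.
have := cos2Dsin2 t; rewrite !expr2; move: (cos t) (sin t) => c s cs.
have -> : delta * delta = delta * delta * (c * c + s * s) by rewrite cs mulr1.
ring.
Qed.

(** The left hand side is [r0] times the Laplacian [f'' + f' / r] of the radial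
    function.  In the variable [x = r^2] the circle about [r0] of radius [delta] is
    the set of [r0^2 + h] with [h = 2 r0 delta cos t + delta^2], a trigonometric
    polynomial of mean [delta^2] and mean square [2 r0^2 delta^2 + delta^4].  So the
    sub-mean value inequality on small circles, with [taylor_upper], gives
    [g' + x g'' >= 0] for [g x = f (sqrt x)]. *)
Lemma laplacian_ge0 f1 f2 : is_derivative_on_halfline f f1 -> is_derivative_on_halfline f1 f2 ->
  forall r0, 0 < r0 -> 0 <= f1 r0 + r0 * f2 r0.
Proof.
move=> df df1 r0 r00.
pose rho' x := (2 * Num.sqrt x)^-1.
pose g x := f (Num.sqrt x); pose g1 x := f1 (Num.sqrt x) * rho' x.
pose x0 := r0 ^+ 2; have x00 : 0 < x0 by rewrite exprn_gt0.
have sx0 : Num.sqrt x0 = r0 by rewrite sqrtr_sqr gtr0_norm.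
have dg x : 0 < x -> is_derive x (1 : R) g (g1 x).
  move=> xp; apply: (@der_comp R f (@Num.sqrt R)); last exact: is_derive1_sqrt.
  by apply: (halfline_is_derive df); rewrite sqrtr_gt0.
pose g2 := f2 r0 / (4 * r0 ^+ 2) - f1 r0 / (4 * r0 ^+ 3).
have dg1 : is_derive x0 (1 : R) g1 g2.
  have ds := is_derive1_sqrt x00.
  have df1s : is_derive (Num.sqrt x0) (1 : R) f1 (f2 r0).
    by rewrite sx0; exact: (halfline_is_derive df1).
  have d2s := derM (derC x0 2) ds.
  have n0 : 2 * Num.sqrt x0 != 0 by rewrite sx0 gt_eqF// mulr_gt0.
  have drho := @der_comp R (fun y => y^-1) (fun y => 2 * Num.sqrt y) x0 _ _ (is_derive_inv n0) d2s.
  have := derM (@der_comp R f1 (@Num.sqrt R) x0 _ _ df1s ds) drho.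
  move/der_eq; apply; rewrite /g2 /rho' sx0; field.
  by rewrite gt_eqF.
have key e : 0 < e -> 0 <= g1 x0 + (g2 / 2 + e) * (2 * x0).
  move=> e0; have [r rp Hr] := taylor_upper x00 e0 dg dg1.
  (* The sub-mean value inequality on the circle of radius [delta]. *)
  have Q delta : 0 < delta -> delta < 1 -> delta * (2 * r0 + 1) < r ->
      0 <= g1 x0 + (g2 / 2 + e) * (2 * x0 + delta ^+ 2).
    move=> dp d1 dr; pose h t := 2 * r0 * delta * cos t + delta ^+ 2.
    have hr t : `|h t| < r.
      apply: le_lt_trans dr; apply: (le_trans (ler_normD _ _)).
      rewrite normrM [`|2 * r0 * delta|]gtr0_norm; last by rewrite mulr_gt0// mulr_gt0.
      rewrite [`|delta ^+ 2|]ger0_norm ?sqr_ge0// expr2.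
      have : `|cos t| <= 1 by rewrite ler_norml cos_geN1 cos_le1.
      have := normr_ge0 (cos t); move: (`|cos t|) => c c0 c1.
      have : 2 * r0 * delta * c <= 2 * r0 * delta.
        by apply: ler_piMr => //; rewrite mulr_ge0 ?mulr_ge0// ltW.
      have : delta * delta <= delta by apply: ler_piMr => //; exact: ltW.
      by lra.
    have [_ sub] := F_subharmonic; have := sub r0%:C delta dp.
    have pi0 : 0 < pi :> R by exact: pi_gt0.
    have pi2 : 0 < 2 * pi :> R by rewrite mulr_gt0.
    have hc : continuous h.
      by move=> t; exact: der_continuous (derD (derM (derC t (2 * r0 * delta)) (is_derive_cos t)) (derC t (delta ^+ 2))).
    pose B := g1 x0; pose C := g2 / 2 + e.
    pose P t := (g x0 + B * delta ^+ 2 + C * delta ^+ 4) +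
        (2 * B * r0 * delta + 4 * C * r0 * delta ^+ 3) * cos t +
        (4 * C * r0 ^+ 2 * delta ^+ 2) * (cos t * cos t).
    have PE t : P t = g x0 + B * h t + C * h t ^+ 2 by rewrite /P /h; ring.
    have cP : continuous P.
      move=> t; have dc := is_derive_cos t.
      exact: der_continuous (derD (derD (derC t _) (derM (derC t _) dc)) (derM (derC t _) (derM dc dc))).
    have cg : continuous (fun t => g (x0 + h t)).
      move=> t; have [xh _] := Hr _ (hr t).
      apply: (@continuous_comp _ _ _ (fun t => x0 + h t) g).
        by apply: continuousD; [exact: cst_continuous|exact: hc].
      exact: der_continuous (dg _ xh).
    have int (k : R -> R) : continuous k -> lebesgue_measure.-integrable `[0, 2 * pi] (EFin \o k).
      move=> ck; apply: continuous_compact_integrable; first exact: segment_compact.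
      exact: continuous_subspaceT.
    have -> : F r0%:C = g x0 by rewrite -fE normc_real gtr0_norm// /g sx0.
    have E : (\int[lebesgue_measure]_(t in `[0%R, (2 * pi)%R])
          (F (r0%:C + (delta * cos t +i* (delta * sin t))))%:E <=
        (2 * pi * (g x0 + B * delta ^+ 2 + C * delta ^+ 4) + pi * (4 * C * r0 ^+ 2 * delta ^+ 2))%:E)%E.
      rewrite -(integral_cos_square _ (2 * B * r0 * delta + 4 * C * r0 * delta ^+ 3)).
      under eq_integral => t _ do rewrite -fE circle_norm -/(h t) -/x0 -/(g (x0 + h t)).
      apply: le_integral; [exact: measurable_itv|exact: int cg|exact: int cP|].
      move=> t _; rewrite lee_fin -/(P t) PE.
      by have [_] := Hr _ (hr t).
    move=> L; have i0 : (0 <= ((2 * pi)^-1)%:E :> \bar R)%E by rewrite lee_fin invr_ge0 ltW.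
    have := le_trans L (lee_wpmul2l i0 E); rewrite -EFinM lee_fin.
    have -> : (2 * pi)^-1 * (2 * pi * (g x0 + B * delta ^+ 2 + C * delta ^+ 4) +
        pi * (4 * C * r0 ^+ 2 * delta ^+ 2)) =
      g x0 + delta ^+ 2 * (B + C * (2 * x0 + delta ^+ 2)).
      have pn : pi != 0 :> R by rewrite gt_eqF.
      rewrite /x0; move: (g (r0 ^+ 2)) (B) (C) (pi) pn; clear => gx B C p pn.
      by field.
    by rewrite lerDl pmulr_rge0// exprn_gt0.
  set A := g1 x0 in Q *; set C := g2 / 2 + e in Q *.
  rewrite leNgt; apply/negP => neg.
  pose m := - (A + C * (2 * x0)); have m0 : 0 < m by rewrite oppr_gt0.
  pose delta := Num.min (Num.min (2^-1) (r / (2 * (2 * r0 + 1)))) (m / (`|C| + 1)).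
  have r1 : 0 < 2 * r0 + 1 by lra.
  have C1 : 0 < `|C| + 1 by rewrite ltr_wpDl.
  have dp : 0 < delta by rewrite !lt_min invr_gt0 ltr0n divr_gt0 ?mulr_gt0// divr_gt0.
  have d1 : delta <= 2^-1 by rewrite !ge_min lexx.
  have d2 : delta <= r / (2 * (2 * r0 + 1)) by rewrite !ge_min lexx orbT.
  have d3 : delta <= m / (`|C| + 1) by rewrite !ge_min lexx !orbT.
  have d1' : delta < 1 by apply: (le_lt_trans d1); rewrite invf_lt1// ltr1n.
  have d2' : delta * (2 * r0 + 1) < r.
    move: d2; rewrite ler_pdivlMr ?mulr_gt0// => d2; rewrite mulrCA in d2.
    have : 0 < delta * (2 * r0 + 1) by rewrite mulr_gt0.
    by move: d2; clear; lra.
  have := Q delta dp d1' d2'; rewrite mulrDr addrA.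
  have : C * delta ^+ 2 < m.
    apply: (@le_lt_trans _ _ (`|C| * delta ^+ 2)).
      by rewrite ler_wpM2r ?sqr_ge0// ler_norm.
    move: d3; rewrite ler_pdivlMr// => d3.
    have : delta * `|C| < m by apply: lt_le_trans d3; rewrite ltr_pM2l// ltrDl.
    have : `|C| * delta ^+ 2 <= delta * `|C|.
      rewrite mulrC expr2 -mulrA ler_wpM2l ?(ltW dp)//.
      by apply: ler_piMl => //; exact: ltW.
    by clear; lra.
  rewrite /m -subr_lt0 opprK addrC => lt ge.
  by have := le_lt_trans ge lt; rewrite ltxx.
have : 0 <= g1 x0 + g2 * x0.
  apply/ler_addgt0Pr => e e0.
  have x2 : 0 < 2 * x0 by rewrite mulr_gt0.
  have := key _ (divr_gt0 e0 x2); congr (_ <= _).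
  by field; rewrite gt_eqF.
have -> : g1 x0 + g2 * x0 = (f1 r0 + r0 * f2 r0) / (4 * r0).
  by rewrite /g1 /rho' sx0 /g2 /x0; field; rewrite gt_eqF.
by rewrite pmulr_lge0// invr_gt0 mulr_gt0.
Qed.

End Profile.

(** * Consequences for the radial profile *)

Section ProfileConsequences.
Context {R : realType}.
Implicit Types (F : R[i] -> R) (a b d e r s t x y : R).

(** Near the origin the defining function is then [- Im w], whose complex
    Hessian is zero. *)
Lemma levi_flat_of_zero F a : 0 < a -> (forall z, normc z < a -> F z = 0) ->
  levi_flat_around (Omega F) (defining_function F) (0, 0).
Proof.
move=> a0 F0; have a2 : 0 < a / 2 by rewrite divr_gt0.
pose u := defining_function F.
pose b k : R[i] := if k == 0 :> 'I_2 then 0 else 0 +i* - 2^-1.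
have uE (q : C2 R) : normc q.1 < a -> u q = - complex.Im q.2.
  by move=> qa; rewrite /u /defining_function F0// sub0r.
have first k (q : C2 R) : normc q.1 < a -> wirtinger_bar k (fun q => (u q)%:C) q = b k.
  move=> qa; have r0 : 0 < a - normc q.1 by rewrite subr_gt0.
  have near1 (z : R[i]) : normc z < a - normc q.1 -> normc (q.1 + z) < a.
    move=> zr; apply: (le_lt_trans (le_normcD _ _)); by rewrite addrC -ltrBrDr.
  suff W : wder (fun z => (u (q + z *: basis_vector k))%:C) (conjc (b k)) (b k).
    by have [_] := @wder_wirtinger R k (fun q => (u q)%:C) q _ _ W.
  have E (z : R[i]) : normc z < a - normc q.1 ->
      (- complex.Im (q + z *: basis_vector k).2)%:C = (u (q + z *: basis_vector k))%:C.
    move=> zr; rewrite uE//.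
    by elim/ord2_case: k; rewrite ?shift0 ?shift1 /=; [exact: near1|].
  apply: (wder_near r0 E) => e e0; exists 1 => // z _.
  rewrite scale0r addr0 /b.
  have -> : (- complex.Im (q + z *: basis_vector k).2)%:C - (- complex.Im q.2)%:C -
      conjc (b k) * z - b k * conjc z = 0; last by rewrite normc0 mulr_ge0 ?normc_ge0 ?ltW.
  clear E; case: z => x y; elim/ord2_case: k; rewrite ?shift0 ?shift1 /b /=.
    by case: (q.2) => c d /=; simpc; rewrite /=; congr (_ +i* _); ring.
  by case: (q.2) => c d /=; simpc; rewrite /=; congr (_ +i* _); field.
apply/nbhs_C2P; exists a => // p; rewrite /= subr0 => pa _ _ xi _.
have hess j k : wirtinger j (wirtinger_bar k (fun q => (u q)%:C)) p = 0.
  have r0 : 0 < a - normc p.1 by rewrite subr_gt0.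
  suff W : wder (fun z => wirtinger_bar k (fun q => (u q)%:C) (p + z *: basis_vector j)) 0 0.
    by have [] := @wder_wirtinger R j _ p _ _ W.
  have E (z : R[i]) : normc z < a - normc p.1 ->
      b k = wirtinger_bar k (fun q => (u q)%:C) (p + z *: basis_vector j).
    move=> zr; rewrite first//; elim/ord2_case: j; rewrite ?shift0 ?shift1 //=.
    by apply: (le_lt_trans (le_normcD _ _)); rewrite addrC -ltrBrDr.
  apply: (wder_near r0 E) => e e0; exists 1 => // z _.
  by rewrite subrr !mul0r !subr0 normc0 mulr_ge0 ?normc_ge0 ?ltW.
rewrite (@complex_hessian_sum _ _ _ _ (fun _ _ => 0) hess).
by rewrite !mul0r !addr0.
Qed.

Variables (f f1 f2 : R -> R).
Hypothesis df : is_derivative_on_halfline f f1.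
Hypothesis df1 : is_derivative_on_halfline f1 f2.
Hypothesis f0 : f 0 = 0.
Hypothesis f10 : f1 0 = 0.
Hypothesis lap : forall r, 0 < r -> 0 <= f1 r + r * f2 r.

(** The derivative of [r f'(r)] is the quantity of [lap]. *)
Lemma slope_nondecreasing a b : 0 < a -> a <= b -> a * f1 a <= b * f1 b.
Proof.
move=> a0; rewrite le_eqVlt => /predU1P[->//|ab].
have [x /andP[ax _]|c /andP[ac _] E] := @mvt R (fun x => x * f1 x) (fun x => f1 x + x * f2 x) a b ab.
  have := derM (derI x) (halfline_is_derive df1 (lt_le_trans a0 ax)).
  by move/der_eq; apply; rewrite mul1r.
by rewrite -subr_ge0 E mulr_ge0 ?subr_ge0 ?(ltW ab)// lap// (lt_trans a0).
Qed.

(** [r f'(r)] is nondecreasing and tends to 0 at 0, the derivative [f'] being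
    Lipschitz at 0. *)
Lemma slope_ge0 r : 0 < r -> 0 <= f1 r.
Proof.
move=> r0; rewrite -(pmulr_rge0 _ r0) leNgt; apply/negP => neg.
have [C C0 [rho rho0 Hr]] := halfline_lip df1 (lexx 0).
pose m := - (r * f1 r); have m0 : 0 < m by rewrite oppr_gt0.
pose a := Num.min (Num.min r 1) (Num.min (rho / 2) (m / (2 * C))).
have a0 : 0 < a by rewrite !lt_min r0 ltr01 !divr_gt0// mulr_gt0.
have ar : a <= r by rewrite !ge_min lexx.
have a1 : a <= 1 by rewrite !ge_min lexx orbT.
have arho : a < rho.
  by apply: (@le_lt_trans _ _ (rho / 2)); rewrite ?gtr_pMr// ?invf_lt1 ?ltr1n// !ge_min lexx !orbT.
have am : 2 * (C * a) <= m.
  have -> : 2 * (C * a) = a * (2 * C) by ring.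
  by rewrite -ler_pdivlMr ?mulr_gt0// !ge_min lexx !orbT.
have := Hr a (ltW a0); rewrite subr0 gtr0_norm// f10 subr0 => /(_ arho).
rewrite ler_norml => /andP[L _].
have := slope_nondecreasing a0 ar.
have : a * (C * a) <= C * a by rewrite ler_piMl// mulr_ge0// ltW.
have : - (a * (C * a)) <= a * f1 a by rewrite -mulrN ler_pM2l.
have -> : r * f1 r = - m by rewrite /m opprK.
move: am; move: (m) (C * a) (a * _) (a * f1 a) m0 => ? ? ? ? *; lra.
Qed.

Local Notation g := (fun x => f `|x|).

(** Precomposing with the absolute value turns a function on the half line into
    one on the real line, for which the two-sided theorems apply at 0. *)
Lemma abs_continuous : continuous (g : R -> R).
Proof.
move=> x; have [C C0 [r r0 Hr]] := halfline_lip df (normr_ge0 x).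
apply/cvgrPdist_lt => e e0; near=> y.
have yx : `| `|y| - `|x| | <= `|y - x| by exact: ler_dist_dist.
have yr : `|y - x| < r by near: y; apply/nbhs_ballP; exists r => // y; rewrite /ball /= distrC.
have ye : `|y - x| < e / C.
  by near: y; apply/nbhs_ballP; exists (e / C); [rewrite /= divr_gt0|move=> y; rewrite /ball /= distrC].
rewrite distrC; apply: (le_lt_trans (Hr _ (normr_ge0 y) (le_lt_trans yx yr))).
by rewrite mulrC -ltr_pdivlMr//; exact: le_lt_trans ye.
Unshelve. all: by end_near. Qed.

Lemma mvt_half a b : 0 <= a -> a < b -> exists2 c, a < c < b & f b - f a = f1 c * (b - a).
Proof.
move=> a0 ab.
have dg x : x \in `]a, b[%R -> is_derive x (1 : R) (g : R -> R) (f1 x).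
  rewrite in_itv /= => /andP[ax _]; have x0 := le_lt_trans a0 ax.
  apply: real_is_derive => e e0; have [r r0 Hr] := is_derive_eps (halfline_is_derive df x0) e0.
  exists (Num.min r x) => [|h]; first by rewrite lt_min r0.
  rewrite lt_min => /andP[hr hx]; have xh : 0 <= x + h.
    by move: hx; rewrite ltr_norml => /andP[? _]; lra.
  by rewrite (ger0_norm xh) (gtr0_norm x0); exact: Hr.
have [c cab] := MVT ab dg (continuous_subspaceT abs_continuous).
by rewrite in_itv in cab; rewrite (ger0_norm a0) (ger0_norm (le_trans a0 (ltW ab))) => E; exists c.
Qed.

(** A zero of [r f'(r)] forces zeros at all smaller radii.  In view of
    [levi_flat_of_zero] this is where the hypothesis on the Levi form enters. *)
Lemma zero_slope a : 0 < a -> f1 a = 0 -> forall x, 0 <= x <= a -> f x = 0.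
Proof.
move=> a0 fa x /andP[]; rewrite le_eqVlt => /predU1P[<-//|x0] xa.
have [c /andP[c0 cx] E] := mvt_half (lexx 0) x0.
have : c * f1 c <= 0.
  by apply: (le_trans (slope_nondecreasing c0 (le_trans (ltW cx) xa))); rewrite fa mulr0.
rewrite pmulr_rle0// => fc; move: E; rewrite f0 !subr0 => ->.
by apply/eqP; rewrite mulf_eq0 eq_le fc slope_ge0.
Qed.

Hypothesis slope_gt0 : forall x, 0 < x -> 0 < f1 x.

Lemma profile_lt a b : 0 <= a -> a < b -> f a < f b.
Proof.
move=> a0 ab; have [c /andP[ac _] E] := mvt_half a0 ab.
by rewrite -subr_gt0 E mulr_gt0 ?subr_gt0// slope_gt0// (le_lt_trans a0).
Qed.

Lemma profile_le a b : 0 <= a -> a <= b -> f a <= f b.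
Proof. by move=> a0; rewrite le_eqVlt => /predU1P[->//|ab]; rewrite ltW// profile_lt. Qed.

Lemma profile_ltE a b : 0 <= a -> 0 <= b -> (f a < f b) = (a < b).
Proof.
move=> a0 b0; case: (ltP a b) => ab; first by rewrite profile_lt.
by apply/negbTE; rewrite -leNgt profile_le.
Qed.

Lemma profile_gt0 a : 0 < a -> 0 < f a.
Proof. by move=> a0; rewrite -f0 profile_lt. Qed.

Lemma profile_ge0 a : 0 <= a -> 0 <= f a.
Proof. by move=> a0; rewrite -f0 profile_le. Qed.

(** As [r f'(r)] is nondecreasing, [f'] is at least [f'(1) / r] beyond 1. *)
Lemma profile_log r : 1 <= r -> f 1 + f1 1 * ln r <= f r.
Proof.
rewrite le_eqVlt => /predU1P[<-|r1]; first by rewrite ln1 mulr0 addr0.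
pose k x := f x - f1 1 * ln x.
have dk x : 1 <= x <= r -> is_derive x (1 : R) k (f1 x - f1 1 / x).
  move=> /andP[x1 _]; have x0 : 0 < x by exact: lt_le_trans x1.
  have := derD (halfline_is_derive df x0) (derM (derC x (- f1 1)) (is_derive1_ln x0)).
  have -> : (fun y => f y + - f1 1 * ln y) = k by apply/funext => y; rewrite /k mulNr.
  by move/der_eq; apply; rewrite mul0r add0r mulNr.
have [c /andP[c1 _] E] := mvt r1 dk.
have c0 : 0 < c by exact: lt_trans c1.
have : 0 <= k r - k 1.
  rewrite E mulr_ge0 ?subr_ge0 ?(ltW r1)// ler_pdivrMr// mulrC.
  by have := slope_nondecreasing ltr01 (ltW c1); rewrite mul1r.
by rewrite /k ln1 mulr0 subr0; lra.
Qed.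

Lemma profile_surj y : 0 <= y -> exists2 s, 0 <= s & f s = y.
Proof.
move=> y0; have c0 := slope_gt0 ltr01; pose b := expR (y / f1 1).
have b1 : 1 <= b by rewrite -expR0 ler_expR divr_ge0// ltW.
have b0 : 0 <= b by exact: le_trans b1.
have fb : y <= f b.
  apply: le_trans (profile_log b1); rewrite expRK mulrC divfK ?gt_eqF//.
  by rewrite lerDr profile_ge0.
have [] := @IVT R g 0 b y b0 (continuous_subspaceT abs_continuous).
  by rewrite normr0 f0 (ger0_norm b0) ge_min y0 le_max fb orbT.
move=> c; rewrite in_itv /= => /andP[c0' _]; rewrite ger0_norm// => fc.
by exists c.
Qed.

Lemma halfline_inverseK s : 0 <= s -> halfline_inverse f (f s) = s.
Proof.
move=> s0; apply: pinvKV; last by rewrite inE.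
move=> x y; rewrite !inE /= => x0 y0 E; apply/eqP; rewrite eq_le.
have := profile_ltE x0 y0; have := profile_ltE y0 x0; rewrite E ltxx => /esym + /esym.
by move=> /negbT + /negbT; rewrite -!leNgt => -> ->.
Qed.

(** Doubling of [- 1 / ln f] means that [ln f] is at least halved in absolute
    value from [x] to [sigma x].  This form of the hypothesis says that the height
    [f] is squared when the radius is divided by [sigma]. *)
Lemma doubling_sqr r : 0 < r -> r < halfline_inverse f 1 -> doubling r (Lambda f) ->
  exists2 sigma, 1 < sigma & forall x, 0 < x -> x <= r / sigma -> f x <= f (sigma * x) ^+ 2.
Proof.
move=> r0 r1 [_ _ [sigma s1 H]]; exists sigma => // x x0 xr.
have s0 : 0 < sigma by exact: lt_trans s1.
have sx0 : 0 < sigma * x by exact: mulr_gt0.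
have fr : f r < 1.
  have [t t0 ft] := profile_surj ler01.
  by move: r1; rewrite -ft halfline_inverseK// => rt; rewrite profile_lt// ltW.
have fsx : f (sigma * x) < 1.
  apply: le_lt_trans fr; apply: profile_le; first exact: ltW.
  by rewrite mulrC -ler_pdivlMr.
have fx : f x < 1.
  apply: le_lt_trans fsx; apply: profile_le; first exact: ltW.
  by rewrite ler_peMl ?ltW.
have := H x; rewrite (ltW x0) xr /= => /(_ isT).
rewrite /Lambda x0 sx0.
have p1 := profile_gt0 x0; have p2 := profile_gt0 sx0.
have l1 : ln (f x) < 0 by rewrite ln_lt0// p1.
have l2 : ln (f (sigma * x)) < 0 by rewrite ln_lt0// p2.
have -> : 2 * (-1 / ln (f x)) = 2 / (- ln (f x)) by field; rewrite lt_eqF.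
have -> : -1 / ln (f (sigma * x)) = (- ln (f (sigma * x)))^-1 by field; rewrite lt_eqF.
rewrite ler_pdivrMr ?oppr_gt0// mulrC ler_pdivlMr ?oppr_gt0// => L.
rewrite -ler_ln ?posrE ?exprn_gt0// lnXn// mulr2n; lra.
Qed.

End ProfileConsequences.

(** * Majorants of product form *)

Section Majorants.
Context {R : realType}.
Local Notation mu := (@lebesgue_measure R).
Local Notation TR := (g_sigma_algebraType (R.-ocitv.-measurable)).

(** It has the size of the Poisson kernel divided by [y], and an elementary
    primitive. *)
Definition bump_kernel (a y x : R) : R := (`|x - a| + y) ^- 2.

Lemma bump_kernel_gt0 a y x : 0 < y -> 0 < bump_kernel a y x.
Proof. by move=> y0; rewrite invr_gt0 exprn_gt0// ltr_wpDl. Qed.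

Lemma bump_kernel_continuous (a y : R) : 0 < y -> continuous (bump_kernel a y).
Proof.
move=> y0 x; have n0 : (`|x - a| + y) ^+ 2 != 0 by rewrite gt_eqF// exprn_gt0// ltr_wpDl.
apply: (@continuousV _ _ (fun x : R => (`|x - a| + y) ^+ 2)) => //.
have c1 : {for x, continuous (fun x : R => `|x - a| + y)}.
  apply: (@continuousD _ _ _ (fun x : R => `|x - a|) (fun=> y)); last exact: cst_continuous.
  apply: (@continuous_comp _ _ _ (fun x : R => x - a) (fun x : R => `|x|)); last exact: norm_continuous.
  by apply: (@continuousB _ _ _ (fun x : R => x) (fun=> a)); [exact: cvg_id|exact: cst_continuous].
exact: (@continuousM _ _ (fun x : R => `|x - a| + y) (fun x : R => `|x - a| + y)).
Qed.

Lemma integral_bump_half (a y : R) : 0 < y ->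
  (\int[mu]_(x in `[a, +oo[) (bump_kernel a y x)%:E = (y^-1)%:E)%E.
Proof.
move=> y0; pose G x : R := - (x - a + y)^-1.
have pos x : a <= x -> 0 < x - a + y by move=> ax; rewrite ltr_wpDl// subr_ge0.
have dG x : a <= x -> is_derive x (1 : R) G ((x - a + y) ^- 2).
  move=> ax; have n0 : x - a + y != 0 by rewrite gt_eqF// pos.
  have D := derD (derD (derI x) (derC x (- a))) (derC x y).
  have := derM (derC x (-1)) (@der_comp R (fun t => t^-1) (fun x => x - a + y) x _ _ (is_derive_inv n0) D).
  have -> : (fun y0 => -1 * (y0 - a + y)^-1) = G by apply/funext => t; rewrite /G mulN1r.
  by move/der_eq; apply; ring.
rewrite (@ge0_continuous_FTC2y R _ G a 0).
- by rewrite sub0e -EFinN /G subrr add0r opprK.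
- by move=> x _; apply/ltW/bump_kernel_gt0.
- by apply: continuous_subspaceT; exact: bump_kernel_continuous.
- rewrite -[X in _ --> X]oppr0; apply: cvgN.
  apply/cvgrPdist_le => e e0; near=> x; rewrite sub0r normrN.
  have xa : a + e^-1 <= x by near: x; apply: nbhs_pinfty_ge; rewrite num_real.
  have ei : 0 < e^-1 by rewrite invr_gt0.
  have p : 0 < x - a + y by apply: pos; apply: le_trans xa; rewrite lerDl ltW.
  rewrite gtr0_norm ?invr_gt0// -[e]invrK lef_pV2 ?posrE//; move: xa y0 ei; lra.
- by move=> x /ltW /dG [].
- by apply: cvg_at_right_filter; exact: der_continuous (dG a (lexx a)).
- move=> x; rewrite in_itv /= andbT => /ltW ax; rewrite derive1E.
  by have [_ ->] := dG x ax; rewrite /bump_kernel ger0_norm// subr_ge0.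
Unshelve. all: by end_near. Qed.

Lemma measurable_bump_kernel a y : 0 < y -> measurable_fun (setT : set TR) (bump_kernel a y).
Proof. by move=> y0; apply: continuous_measurable_fun; exact: bump_kernel_continuous. Qed.

Lemma bump_kernel_opp (a y x : R) : bump_kernel a y (- x) = bump_kernel (- a) y x.
Proof. by rewrite /bump_kernel -normrN (_ : - (- x - a) = x - - a)//; ring. Qed.

(** Two half lines, each contributing [1 / y]. *)
Lemma integral_bump_le (a y : R) : 0 < y ->
  (\int[mu]_x (bump_kernel a y x)%:E <= (2 / y)%:E)%E.
Proof.
move=> y0; have mb : measurable_fun (setT : set TR) (fun x => (bump_kernel a y x)%:E).
  by apply/measurable_EFinP; exact: measurable_bump_kernel.
have b0 x : (0 <= (bump_kernel a y x)%:E)%E by rewrite lee_fin ltW// bump_kernel_gt0.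
have -> : (setT : set TR) = `]-oo, a[ `|` `[a, +oo[.
  by apply/seteqP; split => // x _ /=; rewrite !in_itv /= andbT; case: (ltP x a); [left|right].
rewrite ge0_integral_setU//=; first last.
- by rewrite disj_set2E; apply/eqP/seteqP; split => // x [] /=; rewrite !in_itv /= andbT => /lt_geF ->.
- exact: measurable_funTS.
have -> : (2 / y)%:E = ((y^-1)%:E + (y^-1)%:E)%E by rewrite -EFinD; congr EFin; field; rewrite gt_eqF.
apply: leeD; last by rewrite integral_bump_half.
apply: (@le_trans _ _ (\int[mu]_(x in `]-oo, a]) (bump_kernel a y x)%:E)%E).
  apply: ge0_subset_integral => //; first exact: measurable_funTS.
  by move=> x /=; rewrite !in_itv /=; exact: ltW.
rewrite -{1}[a]opprK ge0_integration_by_substitutionNy.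
- rewrite -(integral_bump_half (- a) y0); rewrite (_ : integral _ _ _ = integral mu `[(- a)%R, +oo[
    (fun x => (bump_kernel (- a) y x)%:E))//; apply: eq_integral => x _; congr EFin.
  exact: bump_kernel_opp.
- by apply: continuous_subspaceT; exact: bump_kernel_continuous.
- by move=> x _; apply/ltW/bump_kernel_gt0.
Qed.

Local Notation mu4 := (((mu \x mu) \x mu) \x mu)%E.
Local Notation TR4 := (TR * TR * TR * TR)%type.

Definition tensor4 (a1 a2 a3 a4 : R -> R) (x : TR4) : R :=
  a1 x.1.1.1 * a2 x.1.1.2 * (a3 x.1.2 * a4 x.2).

Lemma measurable_tensor4 (a1 a2 a3 a4 : R -> R) :
  measurable_fun (setT : set TR) a1 -> measurable_fun (setT : set TR) a2 ->
  measurable_fun (setT : set TR) a3 -> measurable_fun (setT : set TR) a4 ->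
  measurable_fun (setT : set TR4) (tensor4 a1 a2 a3 a4).
Proof.
move=> m1 m2 m3 m4.
have p11 : measurable_fun (setT : set TR4) (fun x => x.1.1).
  by apply: measurableT_comp; [exact: measurable_fst|exact: measurable_fst].
apply: measurable_funM; apply: measurable_funM.
- apply: (measurableT_comp m1); exact: (measurableT_comp measurable_fst).
- apply: (measurableT_comp m2); exact: (measurableT_comp measurable_snd).
- apply: (measurableT_comp m3); exact: (measurableT_comp measurable_snd measurable_fst).
- apply: (measurableT_comp m4); exact: measurable_snd.
Qed.

(** Tonelli, one variable at a time. *)
Lemma integral_tensor4_le (a1 a2 a3 a4 : R -> R) (c1 c2 c3 c4 : R) :
  measurable_fun (setT : set TR) a1 -> measurable_fun (setT : set TR) a2 ->
  measurable_fun (setT : set TR) a3 -> measurable_fun (setT : set TR) a4 ->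
  (forall x, 0 <= a1 x) -> (forall x, 0 <= a2 x) -> (forall x, 0 <= a3 x) ->
  (forall x, 0 <= a4 x) ->
  (\int[mu]_x (a1 x)%:E <= c1%:E)%E -> (\int[mu]_x (a2 x)%:E <= c2%:E)%E ->
  (\int[mu]_x (a3 x)%:E <= c3%:E)%E -> (\int[mu]_x (a4 x)%:E <= c4%:E)%E ->
  (\int[mu4]_x (tensor4 a1 a2 a3 a4 x)%:E <= (c1 * c2 * (c3 * c4))%:E)%E.
Proof.
move=> m1 m2 m3 m4 p1 p2 p3 p4 i1 i2 i3 i4.
have I0 (k : R -> R) : (forall x, 0 <= k x) -> (0 <= \int[mu]_x (k x)%:E)%E.
  by move=> k0; apply: integral_ge0 => x _; rewrite lee_fin.
have scale (k : R -> R) (c : R) : measurable_fun (setT : set TR) k -> (forall x, 0 <= k x) -> 0 <= c ->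
    (\int[mu]_x (c * k x)%:E = c%:E * \int[mu]_x (k x)%:E)%E.
  move=> mk k0 c0; under eq_integral do rewrite EFinM.
  rewrite ge0_integralZl_EFin//; first by move=> x _; rewrite lee_fin.
  exact/measurable_EFinP.
have mP : measurable_fun (setT : set TR4) (fun x => (tensor4 a1 a2 a3 a4 x)%:E).
  by apply/measurable_EFinP; exact: measurable_tensor4.
have P0 x : (0 <= (tensor4 a1 a2 a3 a4 x)%:E)%E by rewrite lee_fin !mulr_ge0.
have [_ _ ->] := @tonelli4 _ _ _ _ TR TR TR TR R mu mu mu mu _ mP P0.
have fin (k : R -> R) (c : R) : (forall x, 0 <= k x) -> (\int[mu]_x (k x)%:E <= c%:E)%E ->
    (\int[mu]_x (k x)%:E)%E = (fine (\int[mu]_x (k x)%:E)%E)%:E.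
  move=> k0 kc; rewrite fineK// ge0_fin_numE ?I0//; exact: le_lt_trans kc (ltry _).
pose J1 := fine (\int[mu]_x (a1 x)%:E)%E; pose J2 := fine (\int[mu]_x (a2 x)%:E)%E.
pose J3 := fine (\int[mu]_x (a3 x)%:E)%E; pose J4 := fine (\int[mu]_x (a4 x)%:E)%E.
have J30 : 0 <= J3 by apply: fine_ge0; exact: I0.
have J40 : 0 <= J4 by apply: fine_ge0; exact: I0.
have J20 : 0 <= J2 by apply: fine_ge0; exact: I0.
have J10 : 0 <= J1 by apply: fine_ge0; exact: I0.
have E1 : forall x y, inner_integral mu mu (fun x => (tensor4 a1 a2 a3 a4 x)%:E) (x, y) =
    (a1 x * a2 y * (J3 * J4))%:E.
  move=> x y; rewrite /inner_integral.
  transitivity (\int[mu]_u (a1 x * a2 y * J4 * a3 u)%:E)%E.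
    apply: eq_integral => u _; rewrite /tensor4 /=.
    transitivity (\int[mu]_v (a1 x * a2 y * a3 u * a4 v)%:E)%E.
      by apply: eq_integral => v _; rewrite mulrA.
    rewrite scale ?mulr_ge0// (fin _ _ p4 i4) -/J4 -EFinM; congr EFin; ring.
  rewrite scale ?mulr_ge0// (fin _ _ p3 i3) -/J3 -EFinM; congr EFin; ring.
have -> : (\int[mu]_x \int[mu]_y
    inner_integral mu mu (fun x => (tensor4 a1 a2 a3 a4 x)%:E) (x, y) =
    (J1 * J2 * (J3 * J4))%:E)%E.
  transitivity (\int[mu]_x (J2 * (J3 * J4) * a1 x)%:E)%E.
    apply: eq_integral => x _.
    transitivity (\int[mu]_y (a1 x * (J3 * J4) * a2 y)%:E)%E.
      by apply: eq_integral => y _; rewrite E1; congr EFin; ring.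
    by rewrite scale ?mulr_ge0// (fin _ _ p2 i2) -/J2 -EFinM; congr EFin; ring.
  by rewrite scale ?mulr_ge0// (fin _ _ p1 i1) -/J1 -EFinM; congr EFin; ring.
have Jc (k : R -> R) (c : R) : (forall x, 0 <= k x) -> (\int[mu]_x (k x)%:E <= c%:E)%E ->
    fine (\int[mu]_x (k x)%:E)%E <= c.
  by move=> k0 kc; rewrite -lee_fin -(fin k c).
have h1 : J1 <= c1 := Jc _ _ p1 i1. have h2 : J2 <= c2 := Jc _ _ p2 i2.
have h3 : J3 <= c3 := Jc _ _ p3 i3. have h4 : J4 <= c4 := Jc _ _ p4 i4.
by rewrite lee_fin; apply: ler_pM; rewrite ?mulr_ge0//; apply: ler_pM.
Qed.

Lemma measurable_indic_itv (t : R) : measurable_fun (setT : set TR) (\1_(`[- t, t]%classic) : R -> R).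
Proof. by apply: measurable_indic; exact: measurable_itv. Qed.

Lemma integral_indic_itv (t : R) : 0 <= t ->
  (\int[mu]_x (\1_(`[- t, t]%classic) x)%:E <= (2 * t)%:E)%E.
Proof.
move=> t0; rewrite (@integral_indic _ _ _ mu setT)//= setIT lebesgue_measure_itv /=.
case: ifP => _; rewrite ?lee_fin; last by rewrite mulr_ge0.
by rewrite opprK mulr2n mulrDl mul1r.
Qed.

End Majorants.

(** * The complex exponential *)

Section Exponential.
Context {R : realType}.
Implicit Types (t x y e r : R) (w z : R[i]).

(** This is [exp (i t w)]; on the upper half plane it decays with the height. *)
Definition cexp t w : R[i] :=
  (expR (- t * complex.Im w))%:C * (cos (t * complex.Re w) +i* sin (t * complex.Re w)).

Lemma cexpD t w z : cexp t (w + z) = cexp t w * cexp t z.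
Proof.
case: w z => [a b] [c d]; rewrite /cexp /= !mulrDr expRD cosD sinD; simpc.
by congr (_ +i* _); ring.
Qed.

Lemma normc_cexp t w : normc (cexp t w) = expR (- t * complex.Im w).
Proof.
rewrite /cexp normcM normc_real gtr0_norm ?expR_gt0//.
by rewrite [normc (_ +i* _)]normcE' /= cos2Dsin2 sqrtr1 mulr1.
Qed.

(** The remainder is a combination of the first order remainders of the
    exponential, the cosine and the sine, and of the product of the two
    coordinates; seven terms of size [d] occur. *)
Lemma cexp_cderiv0 t : has_cderiv (cexp t) 0 ('i * t%:C).
Proof.
move=> e e0; pose d := e / 7; have d0 : 0 < d by rewrite divr_gt0.
have Dl k : is_derive (0 : R) (1 : R) (fun x => k * x) k.
  by apply: der_eq (derM (derC 0 k) (derI 0)) _; rewrite mul0r add0r mulr1.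
have De : is_derive (0 : R) (1 : R) (fun x => expR (- t * x)) (- t).
  apply: der_eq (@der_comp R (@expR R) (fun x => - t * x) 0 _ _ (is_derive_expR _) (Dl (- t))) _.
  by rewrite mulr0 expR0 mul1r.
have Dc : is_derive (0 : R) (1 : R) (fun x => cos (t * x)) 0.
  apply: der_eq (@der_comp R (@cos R) (fun x => t * x) 0 _ _ (is_derive_cos _) (Dl t)) _.
  by rewrite mulr0 sin0 oppr0 mul0r.
have Ds : is_derive (0 : R) (1 : R) (fun x => sin (t * x)) t.
  apply: der_eq (@der_comp R (@sin R) (fun x => t * x) 0 _ _ (is_derive_sin _) (Dl t)) _.
  by rewrite mulr0 cos0 mul1r.
have [r1 r10 H1] := is_derive_eps De d0; have [r2 r20 H2] := is_derive_eps Dc d0.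
have [r3 r30 H3] := is_derive_eps Ds d0.
have t1 : 0 < `|t| + 1 by rewrite ltr_wpDl.
have t2 : 0 < t ^+ 2 + 1 by rewrite ltr_wpDl// sqr_ge0.
pose r := Num.min (Num.min r1 r2) (Num.min r3 (Num.min (`|t| + 1)^-1 (d / (t ^+ 2 + 1)))).
exists r; first by rewrite !lt_min r10 r20 r30 invr_gt0 t1 divr_gt0.
case=> u v; rewrite subr0 => wr.
have ur : `|u| < r by exact: le_lt_trans (normc_ge_absRe (u +i* v)) wr.
have vr : `|v| < r by exact: le_lt_trans (normc_ge_absIm (u +i* v)) wr.
move: ur vr; rewrite !lt_min => /andP[/andP[ur1 ur2] /andP[ur3 _]].
move=> /andP[/andP[vr1 _] /andP[_ /andP[vt vd]]].
have := H1 v vr1; have := H2 u ur2; have := H3 u ur3.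
rewrite !add0r !mulr0 expR0 cos0 sin0 !subr0.
have -> : cexp t 0 = 1 by rewrite /cexp /= !mulr0 expR0 cos0 sin0; simpc.
rewrite /cexp /=; set c := cos _; set s := sin _; set E := expR _ => h3 h2 h1.
have c1 : `|c| <= 1 by rewrite ler_norml cos_geN1 cos_le1.
have s1 : `|s| <= 1 by rewrite ler_norml sin_geN1 sin_le1.
have nu := normc_ge_absRe (u +i* v); have nv := normc_ge_absIm (u +i* v).
have -> : E%:C * (c +i* s) - 1 - 'i * t%:C * (u +i* v) =
    (E * c - 1 + t * v) +i* (E * s - t * u).
  by rewrite -[X in _ - X - _]/(1 +i* 0); simpc; rewrite /=; congr (_ +i* _); ring.
have tv : `|1 - t * v| <= 2.
  apply: (le_trans (ler_normB _ _)); rewrite normr1 normrM.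
  have : `|t| * `|v| <= (`|t| + 1) * (`|t| + 1)^-1.
    by apply: ler_pM => //; [rewrite lerDl|exact: ltW].
  by rewrite divff ?gt_eqF//; lra.
have tuv : `|t ^+ 2 * u * v| <= d * `|u|.
  rewrite mulrAC normrM; apply: ler_wpM2r => //.
  rewrite normrM ger0_norm ?sqr_ge0//.
  apply: (@le_trans _ _ ((t ^+ 2 + 1) * (d / (t ^+ 2 + 1)))).
    by apply: ler_pM => //; [exact: sqr_ge0|rewrite lerDl|exact: ltW].
  by rewrite mulrCA divff ?mulr1// gt_eqF.
apply: (le_trans (normc_le_ReIm _)) => /=.
have -> : E * c - 1 + t * v = (E - 1 - v * - t) * c + (1 - t * v) * (c - 1) by ring.
have -> : E * s - t * u = (E - 1 - v * - t) * s + (1 - t * v) * (s - u * t) - t ^+ 2 * u * v by ring.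
have A1 : `|(E - 1 - v * - t) * c| <= d * `|v|.
  by rewrite normrM -[leRHS]mulr1; exact: ler_pM.
have A2 : `|(E - 1 - v * - t) * s| <= d * `|v|.
  by rewrite normrM -[leRHS]mulr1; exact: ler_pM.
have A3 : `|(1 - t * v) * (c - 1)| <= 2 * (d * `|u|) by rewrite normrM; exact: ler_pM.
have A4 : `|(1 - t * v) * (s - u * t)| <= 2 * (d * `|u|) by rewrite normrM; exact: ler_pM.
have B1 := ler_wpM2l (ltW d0) nu; have B2 := ler_wpM2l (ltW d0) nv.
apply: (@le_trans _ _ (7 * (d * normc (u +i* v)))); last first.
  by rewrite mulrA /d mulrCA divff// mulr1.
have := ler_normD ((E - 1 - v * - t) * c) ((1 - t * v) * (c - 1)).
have := ler_normD ((E - 1 - v * - t) * s + (1 - t * v) * (s - u * t)) (- (t ^+ 2 * u * v)).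
have := ler_normD ((E - 1 - v * - t) * s) ((1 - t * v) * (s - u * t)).
rewrite normrN; move: A1 A2 A3 A4 B1 B2 tuv => /=; clear.
move: `|_ * c| `|_ * s| `|_ * (c - 1)| `|_ * (s - _)| `|t ^+ 2 * _ * _| => a1 a2 a3 a4 a5.
move: (d * _) (d * _) (d * _) `|_ + _| `|_ + _| `|_ - _| => *; lra.
Qed.

Lemma cexp_holomorphic t w : holomorphic_at (cexp t) w.
Proof.
apply/holomorphic_atP; exists (cexp t w * ('i * t%:C)) => e e0.
have n1 : 0 < normc (cexp t w) + 1 by rewrite ltr_wpDl// normc_ge0.
have [r r0 Hr] := cexp_cderiv0 t (divr_gt0 e0 n1); exists r => // z zw.
have := Hr (z - w); rewrite subr0 => /(_ zw) L.
have c0 : cexp t 0 = 1 by rewrite /cexp /= !mulr0 expR0 cos0 sin0; simpc.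
have -> : cexp t z = cexp t w * cexp t (z - w) by rewrite -cexpD addrC subrK.
have -> : cexp t w * cexp t (z - w) - cexp t w - cexp t w * ('i * t%:C) * (z - w) =
    cexp t w * (cexp t (z - w) - cexp t 0 - 'i * t%:C * (z - w)) by rewrite c0; ring.
rewrite normcM; apply: (@le_trans _ _ ((normc (cexp t w) + 1) * (e / (normc (cexp t w) + 1) * normc (z - w)))).
  by apply: ler_pM; rewrite ?normc_ge0// lerDl.
by rewrite mulrA [_ * (e / _)]mulrC divfK// gt_eqF.
Qed.

End Exponential.

(** * Derivatives of the test functions at the base point *)

Section TestFunctions.
Context {R : realType}.
Implicit Types (p q xi : C2 R) (w z : R[i]) (G : R[i] -> R[i]).

Lemma differentiable_of_snd G q : holomorphic_at G q.2 ->
  differentiable ((fun q : C2 R => G q.2) : C2 R -> R[i]^o) q.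
Proof.
move=> /holomorphic_atP[l H]; apply: (@has_cderiv2_differentiable _ _ _ 0 l) => e e0.
have [r r0 Hr] := H e e0; exists r => // x _ x2; rewrite mul0r subr0.
by apply: (le_trans (Hr _ x2)); rewrite ler_wpM2l ?(ltW e0)// lerDr normc_ge0.
Qed.

Lemma differentiable_fst q :
  differentiable ((fun q : C2 R => q.1) : C2 R -> R[i]^o) q.
Proof.
apply: (@has_cderiv2_differentiable _ _ _ 1 0) => e e0; exists 1 => // x _ _.
rewrite mul1r mul0r subr0 subrr normc0 mulr_ge0 ?(ltW e0)//.
by rewrite addr_ge0// normc_ge0.
Qed.

Lemma holomorphic_id z : holomorphic_at id z.
Proof.
apply/holomorphic_atP; exists 1 => e e0; exists 1 => // w _.
by rewrite mul1r subrr normc0 mulr_ge0 ?(ltW e0) ?normc_ge0.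
Qed.

Lemma has_cderiv_idM G l : has_cderiv G 0 l -> has_cderiv (fun z => z * G z) 0 (G 0).
Proof.
move=> H e e0; have [r r0 Hr] := H 1 ltr01.
have n1 : 0 < normc l + 1 by rewrite ltr_wpDl// normc_ge0.
exists (Num.min r (e / (normc l + 1))) => [|z]; first by rewrite lt_min r0 divr_gt0.
rewrite subr0 lt_min => /andP[zr ze]; have := Hr z; rewrite subr0 mul1r => /(_ zr) L.
have -> : z * G z - 0 * G 0 - G 0 * z = (l * z + (G z - G 0 - l * z)) * z by ring.
rewrite normcM; apply: ler_wpM2r; first exact: normc_ge0.
apply: (le_trans (le_normcD _ _)); rewrite normcM.
apply: (@le_trans _ _ ((normc l + 1) * normc z)).
  by rewrite mulrDl mul1r lerD2l.
by rewrite mulrC -ler_pdivlMr// ltW.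
Qed.

Lemma dxi_test1 p xi G : holomorphic_at G p.2 ->
  dxi p xi (fun q : C2 R => (q.1 - p.1) * G q.2) = xi.1 * G p.2.
Proof.
move=> hG; set h := (X in dxi p xi X).
have dh : differentiable (h : C2 R -> R[i]^o) p.
  apply: (@differentiableM _ _ (fun q : C2 R => q.1 - p.1 : R[i]^o) (fun q : C2 R => G q.2 : R[i]^o)).
    apply: (@differentiableB _ _ _ (fun q : C2 R => q.1 : R[i]^o)); first exact: differentiable_fst.
    exact: differentiable_cst.
  exact: differentiable_of_snd.
have H0 := @cpartial_has_cderiv _ 0 _ _ dh; have H1 := @cpartial_has_cderiv _ 1 _ _ dh.
have -> : dxi p xi h = xi.1 * cpartial 0 h p + xi.2 * cpartial 1 h p by [].
have -> : cpartial 0 h p = G p.2.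
  have D := @has_cderiv_idM (fun=> G p.2) 0 _.
  apply: (has_cderiv_uniq H0); apply: (has_cderiv_near ltr01 _ (D _)) => [z _|e e0].
    by rewrite shift0 /h /= [p.1 + z]addrC addrK.
  by exists 1 => // z _; rewrite mul0r subrr subr0 normc0 mulr_ge0 ?(ltW e0) ?normc_ge0.
have -> : cpartial 1 h p = 0.
  apply: (has_cderiv_uniq H1) => e e0; exists 1 => // z _.
  rewrite !shift1 /h /= subrr !mul0r !subr0 normc0.
  by rewrite mulr_ge0 ?(ltW e0) ?normc_ge0.
by rewrite mulr0 addr0.
Qed.

Lemma dxi_test2 p xi G : holomorphic_at G p.2 ->
  dxi p xi (fun q : C2 R => (q.2 - p.2) * G q.2) = xi.2 * G p.2.
Proof.
move=> hG; set h := (X in dxi p xi X).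
have dh : differentiable (h : C2 R -> R[i]^o) p.
  apply: (@differentiable_of_snd (fun w => (w - p.2) * G w)).
  apply: holomorphicM hG; apply: holomorphicB; last exact: holomorphic_cst.
  exact: holomorphic_id.
have H0 := @cpartial_has_cderiv _ 0 _ _ dh; have H1 := @cpartial_has_cderiv _ 1 _ _ dh.
have -> : dxi p xi h = xi.1 * cpartial 0 h p + xi.2 * cpartial 1 h p by [].
have -> : cpartial 0 h p = 0.
  apply: (has_cderiv_uniq H0) => e e0; exists 1 => // z _.
  rewrite !shift0 /h /= subrr !mul0r !subr0 normc0.
  by rewrite mulr_ge0 ?(ltW e0) ?normc_ge0.
have -> : cpartial 1 h p = G p.2.
  have /holomorphic_atP[l Hl] := hG.
  have Hl' : has_cderiv (fun z => G (z + p.2)) 0 l by apply: has_cderiv_shift; rewrite add0r.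
  have D := has_cderiv_idM Hl'; rewrite add0r in D.
  apply: (has_cderiv_uniq H1); apply: (has_cderiv_near ltr01 _ D) => z _.
  by rewrite shift1 /h /= [p.2 + z]addrC addrK.
by rewrite mulr0 add0r.
Qed.

End TestFunctions.

(** * Membership in the Bergman space by majorization *)

Section MajorizedFunctions.
Context {R : realType} (Om : set (C2 R)).
Hypothesis openOm : forall p, Om p -> \forall q \near p, Om q.
Local Notation mu := (@lebesgue_measure R).
Local Notation mu4 := (((mu \x mu) \x mu) \x mu)%E.
Local Notation oc := (@of_coordinates R).
Local Notation TR := (g_sigma_algebraType (R.-ocitv.-measurable)).
Local Notation TR4 := (TR * TR * TR * TR)%type.
Local Notation D := (oc @^-1` Om : set TR4).
Local Notation N h := (complex.Re (L2_inner Om h h)).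

(** A part concentrated on a square of half side [s] in the first variable, and a
    part spread over the plane. *)
Definition majorant (s y A B u0 : R) (x : TR4) : R :=
  A * tensor4 (\1_(`[- s, s]%classic)) (\1_(`[- s, s]%classic))
        (bump_kernel u0 y) (bump_kernel 0 y) x +
  B * tensor4 (bump_kernel 0 1) (bump_kernel 0 1) (bump_kernel u0 y) (bump_kernel 0 y) x.

(** The majorant is integrable over all of R^4 with an explicit integral, so the
    domain enters only through the pointwise bound. *)
Lemma A2_majorized (h : C2 R -> R[i]^o) (s y A B u0 : R) : 0 < s -> 0 < y -> 0 <= A -> 0 <= B ->
  holomorphic_on Om h ->
  (forall x : TR4, Om (oc x) -> normc (h (oc x)) ^+ 2 <= majorant s y A B u0 x) ->
  A2 Om h /\ N h <= 16 * (A * s ^+ 2 + B) / y ^+ 2.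
Proof.
move=> s0 y0 A0 B0 hh hM; have mD := measurable_domain openOm.
have mi := measurable_indic_itv s; have mq a y (y0 : 0 < y) := @measurable_bump_kernel R a y y0.
have q0 a (y1 x : R) : 0 < y1 -> 0 <= bump_kernel a y1 x by move=> y10; rewrite ltW// bump_kernel_gt0.
have i0 (x : R) : 0 <= (\1_(`[- s, s]%classic) x : R) by rewrite indicE.
pose T1 := tensor4 (\1_(`[- s, s]%classic)) (\1_(`[- s, s]%classic)) (bump_kernel u0 y) (bump_kernel 0 y).
pose T2 := tensor4 (bump_kernel 0 1) (bump_kernel 0 1) (bump_kernel u0 y) (bump_kernel 0 y).
have mT1 : measurable_fun (setT : set TR4) T1.
  by apply: measurable_tensor4; [exact: mi|exact: mi|exact: mq|exact: mq].
have mT2 : measurable_fun (setT : set TR4) T2.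
  by apply: measurable_tensor4; [exact: mq ltr01|exact: mq ltr01|exact: mq|exact: mq].
have T10 x : 0 <= T1 x by rewrite /T1 /tensor4 !mulr_ge0// q0.
have T20 x : 0 <= T2 x by rewrite /T2 /tensor4 !mulr_ge0// q0.
have I1 : (\int[mu4]_x (T1 x)%:E <= (2 * s * (2 * s) * (2 / y * (2 / y)))%:E)%E.
  apply: integral_tensor4_le => //; try exact: mq; try (by move=> x; exact: q0);
    try exact: integral_bump_le; exact: integral_indic_itv (ltW s0).
have I2 : (\int[mu4]_x (T2 x)%:E <= (2 / 1 * (2 / 1) * (2 / y * (2 / y)))%:E)%E.
  apply: integral_tensor4_le => //; try exact: mq; try (by move=> x; exact: q0);
    try exact: integral_bump_le; exact: integral_bump_le ltr01.
have mM : measurable_fun (setT : set TR4) (majorant s y A B u0).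
  by apply: measurable_funD; apply: measurable_funM => //; exact: measurable_cst.
have M0 x : 0 <= majorant s y A B u0 x by rewrite addr_ge0// mulr_ge0.
have IM : (\int[mu4]_x (majorant s y A B u0 x)%:E <= (16 * (A * s ^+ 2 + B) / y ^+ 2)%:E)%E.
  have -> : (\int[mu4]_x (majorant s y A B u0 x)%:E =
      \int[mu4]_x (A%:E * (T1 x)%:E + B%:E * (T2 x)%:E))%E by [].
  have mE (c : R) (T : TR4 -> R) : measurable_fun (setT : set TR4) T ->
      measurable_fun (setT : set TR4) (fun x => (c%:E * (T x)%:E)%E).
    by move=> mT; apply: measurable_funeM; exact/measurable_EFinP.
  rewrite ge0_integralD//; first last.
  - exact: mE.
  - by move=> x _; rewrite -EFinM lee_fin mulr_ge0.
  - exact: mE.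
  - by move=> x _; rewrite -EFinM lee_fin mulr_ge0.
  rewrite !ge0_integralZl_EFin//; first last.
  - exact/measurable_EFinP.
  - by move=> x _; rewrite lee_fin.
  - exact/measurable_EFinP.
  - by move=> x _; rewrite lee_fin.
  have -> : 16 * (A * s ^+ 2 + B) / y ^+ 2 = A * (2 * s * (2 * s) * (2 / y * (2 / y))) +
      B * (2 / 1 * (2 / 1) * (2 / y * (2 / y))) by field; rewrite gt_eqF.
  by rewrite EFinD !EFinM; apply: leeD; apply: lee_wpmul2l; rewrite ?lee_fin -?EFinM.
have iM : mu4.-integrable D (EFin \o majorant s y A B u0).
  apply: (@integrableS _ _ _ _ setT) => //; apply/integrableP; split.
    exact/measurable_EFinP.
  under eq_integral => x _ do rewrite /= ger0_norm//.
  exact: le_lt_trans IM (ltry _).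
have [mr mim] := holomorphic_on_measurable openOm hh.
have L : L2 mu4 D (h \o oc) by apply: L2_le iM _.
have Ah : A2 Om h by apply/(A2P openOm).
split=> //; rewrite -lee_fin (Re_L2ipE mD L); apply: le_trans IM.
apply: (@le_trans _ _ (\int[mu4]_(x in D) (majorant s y A B u0 x)%:E)%E).
  apply: ge0_le_integral => //.
  - by move=> x _; rewrite lee_fin sqr_ge0.
  - by case: L => _ _ /integrableP[].
  - by move/integrableP: iM => [].
apply: ge0_subset_integral => //; first exact/measurable_EFinP.
by move=> x _; rewrite lee_fin.
Qed.

End MajorizedFunctions.

(** * Bounds of the Bergman metric by boxes and test functions *)

Section BergmanBounds.
Context {R : realType} (Om : set (C2 R)).
Hypothesis openOm : forall p, Om p -> \forall q \near p, Om q.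
Local Notation V := (C2 R -> R[i]^o).
Local Notation N h := (complex.Re (L2_inner Om h h)).
Local Notation K := (bergman_diagonal Om).
Implicit Types (p q xi : C2 R) (h : V) (r s : R) (z : R[i]).

Lemma bergman_diagonal_le p r s : 0 < r -> 0 < s -> box p r s `<=` Om ->
  K p <= 64 / (r ^+ 2 * s ^+ 2).
Proof.
move=> r0 s0 bOm; have Op : Om p by apply/bOm/box_center; exact: ltW.
rewrite (bergman_kernel_repr openOm Op); have [Ak Hk] := reprP openOm (tame_id openOm) Op.
have rs : 0 < r ^+ 2 * s ^+ 2 by rewrite mulr_gt0// exprn_gt0.
apply: (repr_bound openOm Ak Hk); last by rewrite divr_ge0// ltW.
move=> h Ah; have := A2_eval openOm Ah r0 s0 bOm; congr (_ <= _ * _).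
by field; rewrite !gt_eqF.
Qed.

Lemma bergman_diagonal_ge p h : Om p -> A2 Om h -> normc (h p) ^+ 2 <= N h * K p.
Proof.
move=> Op Ah; rewrite (bergman_kernel_repr openOm Op).
have [Ak Hk] := reprP openOm (tame_id openOm) Op.
by have := L2_cauchy_schwarz openOm Ah Ak; rewrite -Hk.
Qed.

Lemma bergman_metric_ge0 p xi : Om p -> 0 < K p -> 0 <= bergman_metric Om p xi.
Proof.
move=> Op K0; have [Ax _] := repr_dxiP openOm xi Op.
rewrite (bergman_metricE openOm xi Op K0) subr_ge0.
have [Ak _] := reprP openOm (tame_id openOm) Op.
have := L2_cauchy_schwarz openOm Ax Ak; rewrite -(bergman_kernel_repr openOm Op) => L.
rewrite [K p ^+ 2]expr2 invfM -mulrA ler_pM2l ?invr_gt0//.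
by rewrite ler_pdivrMl// mulrC.
Qed.

(** The Cauchy estimate in the first variable on half of the box, each value there
    being bounded by evaluation on a box of half the width. *)
Lemma cpartial0_le h p r s : 0 < r -> 0 < s -> box p r s `<=` Om -> A2 Om h ->
  normc (cpartial 0 h p) ^+ 2 <= 2 ^+ 16 / (r ^+ 2 * s ^+ 2) / r ^+ 2 * N h.
Proof.
move=> r0 s0 bOm Ah; have [_ hh] := Ah; have N0 := L2_inner_ge0 Ah.
have r2 : 0 < r / 2 by rewrite divr_gt0.
pose M := Num.sqrt (8 / (r / 2) ^+ 2 * (8 / s ^+ 2) * N h).
have M2 : M ^+ 2 = 8 / (r / 2) ^+ 2 * (8 / s ^+ 2) * N h.
  by rewrite sqr_sqrtr// !mulr_ge0// invr_ge0 sqr_ge0.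
have sub z : insq 0 (r / 2) z -> box (p + z *: basis_vector 0) (r / 2) s `<=` box p r s.
  rewrite /insq subr0 => /andP[z1 z2] q; rewrite shift0 /box /= => /andP[q1 q2].
  rewrite q2 andbT [r]splitr; apply: insqD q1.
  by rewrite /insq [p.1 + z]addrC addrK z1.
have L := @cpartial_slice_le _ Om 0 h p (r / 2) M r2 hh.
have {}L : normc (cpartial 0 h p) <= 8 * M / (r / 2).
  apply: L => z zr.
    by apply/bOm/(sub z zr)/box_center; exact: ltW.
  rewrite -(@ler_pXn2r _ 2) ?nnegrE ?normc_ge0 ?sqrtr_ge0// M2.
  by apply: A2_eval => //; exact: subset_trans (sub z zr) bOm.
have B0 := le_trans (normc_ge0 _) L.
have -> : 2 ^+ 16 / (r ^+ 2 * s ^+ 2) / r ^+ 2 * N h = (8 * M / (r / 2)) ^+ 2.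
  transitivity ((8 / (r / 2)) ^+ 2 * M ^+ 2); last by ring.
  by rewrite M2; field; rewrite !gt_eqF.
by rewrite ler_pXn2r ?nnegrE ?normc_ge0.
Qed.

Lemma cpartial1_le h p r s : 0 < r -> 0 < s -> box p r s `<=` Om -> A2 Om h ->
  normc (cpartial 1 h p) ^+ 2 <= 2 ^+ 16 / (r ^+ 2 * s ^+ 2) / s ^+ 2 * N h.
Proof.
move=> r0 s0 bOm Ah; have [_ hh] := Ah; have N0 := L2_inner_ge0 Ah.
have s2 : 0 < s / 2 by rewrite divr_gt0.
pose M := Num.sqrt (8 / r ^+ 2 * (8 / (s / 2) ^+ 2) * N h).
have M2 : M ^+ 2 = 8 / r ^+ 2 * (8 / (s / 2) ^+ 2) * N h.
  by rewrite sqr_sqrtr// !mulr_ge0// invr_ge0 sqr_ge0.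
have sub z : insq 0 (s / 2) z -> box (p + z *: basis_vector 1) r (s / 2) `<=` box p r s.
  rewrite /insq subr0 => /andP[z1 z2] q; rewrite shift1 /box /= => /andP[q1 q2].
  rewrite q1 /= [s]splitr; apply: insqD q2.
  by rewrite /insq [p.2 + z]addrC addrK z1.
have L := @cpartial_slice_le _ Om 1 h p (s / 2) M s2 hh.
have {}L : normc (cpartial 1 h p) <= 8 * M / (s / 2).
  apply: L => z zr.
    by apply/bOm/(sub z zr)/box_center; exact: ltW.
  rewrite -(@ler_pXn2r _ 2) ?nnegrE ?normc_ge0 ?sqrtr_ge0// M2.
  by apply: A2_eval => //; exact: subset_trans (sub z zr) bOm.
have B0 := le_trans (normc_ge0 _) L.
have -> : 2 ^+ 16 / (r ^+ 2 * s ^+ 2) / s ^+ 2 * N h = (8 * M / (s / 2)) ^+ 2.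
  transitivity ((8 / (s / 2)) ^+ 2 * M ^+ 2); last by ring.
  by rewrite M2; field; rewrite !gt_eqF.
by rewrite ler_pXn2r ?nnegrE ?normc_ge0.
Qed.

Lemma bergman_metric_upper p xi r s : 0 < r -> 0 < s -> box p r s `<=` Om -> 0 < K p ->
  bergman_metric Om p xi <= 2 ^+ 17 / (r ^+ 2 * s ^+ 2) *
    (normc xi.1 ^+ 2 / r ^+ 2 + normc xi.2 ^+ 2 / s ^+ 2) / K p.
Proof.
move=> r0 s0 bOm K0; have Op : Om p by apply/bOm/box_center; exact: ltW.
apply: (le_trans (bergman_metric_le openOm xi Op K0)).
rewrite ler_pM2r ?invr_gt0//; have [Ax Hx] := repr_dxiP openOm xi Op.
have r2 : 0 < r ^+ 2 by rewrite exprn_gt0.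
have s2 : 0 < s ^+ 2 by rewrite exprn_gt0.
apply: (repr_bound openOm Ax Hx) => [h Ah|]; last first.
  apply: mulr_ge0; first by rewrite divr_ge0// mulr_ge0// ltW.
  by rewrite addr_ge0// divr_ge0 ?sqr_ge0// ltW.
apply: (le_trans (normc_sqrD _ _)); rewrite !normcM !exprMn.
have L0 := ler_wpM2l (sqr_ge0 (normc xi.1)) (cpartial0_le r0 s0 bOm Ah).
have L1 := ler_wpM2l (sqr_ge0 (normc xi.2)) (cpartial1_le r0 s0 bOm Ah).
have two : 0 <= 2 :> R by [].
apply: (le_trans (lerD (ler_wpM2l two L0) (ler_wpM2l two L1))).
rewrite le_eqVlt; apply/orP; left; apply/eqP.
by field; rewrite !gt_eqF.
Qed.

(** Evaluation of [h0] bounds the kernel on the diagonal from below and so the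
    metric from above; the derivatives of [h1] and [h2], which vanish at [p], bound
    the metric from below. *)
Lemma bergman_metric_bounds p r s (a0 a1 a2 n0 n1 n2 : R) h0 (h1 h2 : V) :
  0 < r -> 0 < s -> box p r s `<=` Om ->
  0 < a0 -> 0 < a1 -> 0 < a2 -> 0 < n0 -> 0 < n1 -> 0 < n2 ->
  A2 Om h0 -> A2 Om h1 -> A2 Om h2 ->
  N h0 <= n0 -> N h1 <= n1 -> N h2 <= n2 ->
  a0 <= normc (h0 p) ^+ 2 -> h1 p = 0 -> h2 p = 0 ->
  (forall xi, a1 * normc xi.1 ^+ 2 <= normc (dxi p xi h1) ^+ 2) ->
  (forall xi, a2 * normc xi.2 ^+ 2 <= normc (dxi p xi h2) ^+ 2) ->
  0 < K p /\ forall xi,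
    (a1 / n1 * normc xi.1 ^+ 2 + a2 / n2 * normc xi.2 ^+ 2) * (r ^+ 2 * s ^+ 2 / 128)
      <= bergman_metric Om p xi /\
    bergman_metric Om p xi <= 2 ^+ 17 / (r ^+ 2 * s ^+ 2) * (n0 / a0) *
    (normc xi.1 ^+ 2 / r ^+ 2 + normc xi.2 ^+ 2 / s ^+ 2).
Proof.
move=> r0 s0 bOm a00 a10 a20 n00 n10 n20 A0 A1 A2' N0 N1 N2 H0 H1 H2 D1 D2.
have Op : Om p by apply/bOm/box_center; exact: ltW.
have Kge : a0 / n0 <= K p.
  rewrite ler_pdivrMr// mulrC; apply: (le_trans H0).
  apply: (le_trans (bergman_diagonal_ge Op A0)); apply: ler_wpM2r N0.
  exact: bergman_diagonal_ge0.
have K0 : 0 < K p by apply: lt_le_trans Kge; rewrite divr_gt0.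
have rs : 0 < r ^+ 2 * s ^+ 2 by rewrite mulr_gt0// exprn_gt0.
have Kle := bergman_diagonal_le r0 s0 bOm.
split=> // xi; set X := bergman_metric Om p xi; split; last first.
  apply: (le_trans (bergman_metric_upper xi r0 s0 bOm K0)).
  rewrite mulrAC; apply: ler_wpM2r.
    by rewrite addr_ge0// divr_ge0 ?sqr_ge0// exprn_ge0// ltW.
  apply: ler_wpM2l; first by rewrite divr_ge0// ltW.
  by rewrite -[n0 / a0]invf_div lef_pV2 ?posrE// divr_gt0.
have lower (h : V) (n a t : R) : 0 < n -> A2 Om h -> N h <= n -> h p = 0 ->
    0 < a -> 0 <= t -> a * t <= normc (dxi p xi h) ^+ 2 ->
    a / n * t * (r ^+ 2 * s ^+ 2 / 64) <= X.
  move=> np Ah Nh hp a0' t0 L.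
  have := le_trans L (bergman_metric_ge openOm xi Op K0 Ah hp); rewrite -/X => {}L.
  have Nh0 := L2_inner_ge0 Ah.
  have X0 : 0 <= X by exact: bergman_metric_ge0.
  have {}L : a * t <= n * (64 / (r ^+ 2 * s ^+ 2) * X).
    apply: (le_trans L); apply: ler_pM => //; first by rewrite mulr_ge0// ltW.
    exact: ler_wpM2r.
  have -> : a / n * t * (r ^+ 2 * s ^+ 2 / 64) = (a * t) * (r ^+ 2 * s ^+ 2 / (64 * n)).
    by field; rewrite gt_eqF.
  have c0 : 0 <= r ^+ 2 * s ^+ 2 / (64 * n) by rewrite divr_ge0 ?mulr_ge0// ltW.
  apply: (le_trans (ler_wpM2r c0 L)); rewrite le_eqVlt; apply/orP; left; apply/eqP.
  by field; rewrite !gt_eqF.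
have := lower h1 n1 a1 _ n10 A1 N1 H1 a10 (sqr_ge0 (normc xi.1)) (D1 xi).
have := lower h2 n2 a2 _ n20 A2' N2 H2 a20 (sqr_ge0 (normc xi.2)) (D2 xi).
have -> : r ^+ 2 * s ^+ 2 / 128 = (r ^+ 2 * s ^+ 2 / 64) / 2 by field.
move: (r ^+ 2 * s ^+ 2 / 64) => c; rewrite mulrA mulrDl mulrDl.
by move: (a1 / n1 * _ * c) (a2 / n2 * _ * c) (X) => u v x; clear; lra.
Qed.

End BergmanBounds.

(** * The domain above the graph of a radial function *)

Lemma sqrD_le2 (R : realType) (a b d : R) : b ^+ 2 <= d -> (a + b) ^+ 2 <= 2 * (a ^+ 2 + d).
Proof. by move=> bd; have := sqr_ge0 (a - b); rewrite !expr2 in bd *; lra. Qed.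

Section ModelDomain.
Context {R : realType} (F : R[i] -> R) (f : R -> R) (c : R).
Hypothesis F_usc : forall (z : R[i]^o) (a : R), F z < a -> \forall y \near z, F y < a.
Hypothesis fE : forall z : R[i], f (normc z) = F z.
Hypothesis f_le : forall a b, 0 <= a -> a <= b -> f a <= f b.
Hypothesis f0 : f 0 = 0.
Hypothesis c0 : 0 < c.
Hypothesis f_log : forall r, 1 <= r -> f 1 + c * ln r <= f r.
Implicit Types (p q xi : C2 R) (w z : R[i]) (r s y : R).

Lemma open_Omega p : Omega F p -> \forall q \near p, Omega F q.
Proof.
move=> Op; pose a := (F p.1 + complex.Im p.2) / 2.
have Fa : F p.1 < a by rewrite /a ltr_pdivlMr// mulr2n mulrDr mulr1 ltrD2l.
have aI : a < complex.Im p.2 by rewrite /a ltr_pdivrMr// mulr2n mulrDr mulr1 ltrD2r.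
have /nbhs_normcP[r r0 Hr] := F_usc Fa.
apply/nbhs_C2P; exists (Num.min r (complex.Im p.2 - a)).
  by rewrite lt_min r0 subr_gt0.
move=> q; rewrite !lt_min => /andP[q1 _] /andP[_ q2].
apply: (lt_trans (Hr _ q1)).
have := le_lt_trans (normc_ge_absIm _) q2.
rewrite (_ : complex.Im (q.2 - p.2) = complex.Im q.2 - complex.Im p.2); last first.
  by case: (q.2) (p.2) => ? ? [].
by rewrite ltr_norml opprB => /andP[]; rewrite ltrBrDr subrK.
Qed.

Lemma F_ge0 z : 0 <= F z.
Proof. by rewrite -fE -f0; apply: f_le (lexx 0) (normc_ge0 z). Qed.

Let t0 : R := 3 / c.

Lemma expRNM_le1 (a b : R) : 0 <= a -> 0 <= b -> expR (- a * b) <= 1.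
Proof.
by move=> a0 b0; rewrite -[leRHS](@expR0 R) ler_expR mulNr oppr_le0; exact: mulr_ge0.
Qed.

(** [f] grows at least like [c ln r], so the exponential decays like a sixth
    power. *)
Lemma exp_decay r : 0 <= r -> (1 + r ^+ 2) ^+ 3 * expR (- (2 * t0) * f r) <= 8.
Proof.
move=> r0; have t00 : 0 < 2 * t0 by rewrite mulr_gt0// divr_gt0.
have fr : 0 <= f r by rewrite -f0; exact: f_le.
have e0 := expR_ge0 (- (2 * t0) * f r).
have [r1|/ltW r1] := leP r 1.
  have e1 : expR (- (2 * t0) * f r) <= 1.
    exact: expRNM_le1 (ltW t00) fr.
  have -> : (8 : R) = 2 ^+ 3 * 1 by ring.
  apply: ler_pM => //; first by rewrite exprn_ge0// addr_ge0// sqr_ge0.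
  rewrite ler_pXn2r ?nnegrE ?addr_ge0 ?sqr_ge0// -[leRHS]/(1 + 1) lerD2l.
  by rewrite expr_le1.
have rp : 0 < r by exact: lt_le_trans r1.
have e1 : expR (- (2 * t0) * f r) <= (r ^+ 6)^-1.
  have -> : (r ^+ 6)^-1 = expR (- (6 * ln r)).
    by rewrite expRN expRM_natl lnK.
  rewrite ler_expR mulNr lerN2.
  have -> : 6 * ln r = 2 * t0 * (c * ln r) by rewrite /t0; field; rewrite gt_eqF.
  rewrite ler_pM2l//; apply: le_trans (f_log r1); rewrite lerDr -f0.
  by apply: f_le.
have r2 : 1 <= r ^+ 2 by rewrite expr_ge1.
apply: (@le_trans _ _ ((2 * r ^+ 2) ^+ 3 * (r ^+ 6)^-1)).
  apply: ler_pM => //; first by rewrite exprn_ge0// addr_ge0// sqr_ge0.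
  rewrite ler_pXn2r ?nnegrE ?addr_ge0 ?mulr_ge0 ?sqr_ge0//.
  by rewrite mulr2n mulrDl mul1r lerD2r.
by rewrite le_eqVlt; apply/orP; left; apply/eqP; field; rewrite gt_eqF.
Qed.

Variables (p : C2 R) (s sigma : R).
Hypothesis s0 : 0 < s.
Hypothesis s1 : s <= 1.
Hypothesis sigma1 : 1 < sigma.
Local Notation y := (complex.Im p.2).
Local Notation u0 := (complex.Re p.2).
Hypothesis y0 : 0 < y.
Hypothesis ys : y <= s ^+ 4.
Hypothesis p1s : normc p.1 <= s.
Hypothesis fss : y <= f (sigma * s) ^+ 2.

(** Where [|z| <= sigma s] the weight is at most a multiple of [1 / y^2] on a
    square of side [2 sigma s].  Elsewhere the doubling hypothesis gives
    [F z >= sqrt y], and the weight is at most [1 / y] times an integrable function;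
    as [y <= s^4], the first part dominates after integration. *)
Lemma weight_le (x1 y1 m A : R) (z := x1 +i* y1) : 0 <= m ->
  (normc z <= sigma * s -> 2 * m / y ^+ 2 <= A) -> 0 <= A -> m <= 2 * (1 + normc z ^+ 2) ->
  2 * m * expR (- (2 * t0) * F z) * (F z + y) ^- 2 <=
  A * (\1_(`[- (sigma * s), sigma * s]%classic) x1 * \1_(`[- (sigma * s), sigma * s]%classic) y1) +
  128 / y * (bump_kernel 0 1 x1 * bump_kernel 0 1 y1).
Proof.
move=> m0 mA A0 mz; have Fz := F_ge0 z.
have Fy : 0 < F z + y by rewrite ltr_wpDl.
have t00 : 0 < 2 * t0 by rewrite mulr_gt0// divr_gt0.
have b0 (x : R) : 0 <= bump_kernel 0 1 x by rewrite ltW// bump_kernel_gt0.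
have y00 := ltW y0.
have y128 : 0 <= 128 / y := divr_ge0 (ler0n R 128) y00.
have bb : 0 <= 128 / y * (bump_kernel 0 1 x1 * bump_kernel 0 1 y1) :=
  mulr_ge0 y128 (mulr_ge0 (b0 x1) (b0 y1)).
have [zs|zs] := leP (normc z) (sigma * s).
  have i1 (x : R) : `|x| <= normc z -> \1_(`[- (sigma * s), sigma * s]%classic) x = 1 :> R.
    by move=> xz; rewrite indicE mem_set//= in_itv /= -ler_norml (le_trans xz).
  rewrite (i1 _ (normc_ge_absRe z)) (i1 _ (normc_ge_absIm z)) !mulr1.
  apply: (@le_trans _ _ A); last by rewrite lerDl.
  apply: (le_trans _ (mA zs)); apply: ler_pM.
  - by rewrite mulr_ge0 ?expR_ge0// mulr_ge0.
  - by rewrite invr_ge0 sqr_ge0.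
  - rewrite -[leRHS]mulr1; apply: ler_wpM2l; first by rewrite mulr_ge0.
    exact: expRNM_le1 (ltW t00) Fz.
  - rewrite lef_pV2 ?posrE ?exprn_gt0// ler_pXn2r ?nnegrE ?y00 ?(ltW Fy)//.
    by rewrite lerDr.
have i0 (x : R) : 0 <= (\1_(`[- (sigma * s), sigma * s]%classic) x : R) by rewrite indicE.
apply: (@le_trans _ _ (128 / y * (bump_kernel 0 1 x1 * bump_kernel 0 1 y1))); last first.
  by rewrite lerDr mulr_ge0// mulr_ge0.
have ss0 : 0 <= sigma * s by rewrite mulr_ge0// ltW// (lt_trans ltr01).
have yF : y <= (F z + y) ^+ 2.
  have fs0 : 0 <= f (sigma * s) by rewrite -f0; exact: f_le.
  have fF : f (sigma * s) <= F z + y.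
    apply: (@le_trans _ _ (F z)); last by rewrite lerDl.
    by rewrite -fE; apply: f_le => //; exact: ltW.
  by apply: (le_trans fss); rewrite ler_pXn2r// nnegrE ltW.
have Z0 : 0 < 1 + normc z ^+ 2 by rewrite ltr_pwDl// sqr_ge0.
have dec : expR (- (2 * t0) * F z) <= 8 / (1 + normc z ^+ 2) ^+ 3.
  rewrite ler_pdivlMr ?exprn_gt0// mulrC -fE; exact: exp_decay (normc_ge0 z).
have qq : (4 * (1 + normc z ^+ 2) ^+ 2)^-1 <= bump_kernel 0 1 x1 * bump_kernel 0 1 y1.
  have q1 (x : R) : `|x| <= normc z -> (2 * (1 + normc z ^+ 2))^-1 <= bump_kernel 0 1 x.
    move=> xz; have d1 : 0 < 2 * (1 + normc z ^+ 2) by rewrite mulr_gt0.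
    have d2 : 0 < (`|x| + 1) ^+ 2 by rewrite exprn_gt0// ltr_wpDl.
    rewrite /bump_kernel subr0 lef_pV2 ?posrE//.
    have x0 := normr_ge0 x; have : `|x| ^+ 2 <= normc z ^+ 2.
      by rewrite ler_pXn2r ?nnegrE ?normc_ge0.
    move=> xz2; rewrite addrC [1 + normc z ^+ 2]addrC.
    by have := @sqrD_le2 R 1 _ _ xz2; rewrite expr1n addrC [1 + _]addrC.
  have -> : (4 * (1 + normc z ^+ 2) ^+ 2)^-1 =
      (2 * (1 + normc z ^+ 2))^-1 * (2 * (1 + normc z ^+ 2))^-1 by field; rewrite gt_eqF.
  have q00 : 0 <= (2 * (1 + normc z ^+ 2))^-1 by rewrite invr_ge0 mulr_ge0// ltW.
  by apply: ler_pM => //; apply: q1; [exact: (normc_ge_absRe z)|exact: (normc_ge_absIm z)].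
apply: (@le_trans _ _ (2 * (2 * (1 + normc z ^+ 2)) * (8 / (1 + normc z ^+ 2) ^+ 3) * y^-1)).
  apply: ler_pM.
  - by rewrite mulr_ge0 ?expR_ge0// mulr_ge0.
  - by rewrite invr_ge0 sqr_ge0.
  - have m20 : 0 <= 2 * m by rewrite mulr_ge0.
    have mZ : 2 * m <= 2 * (2 * (1 + normc z ^+ 2)) by rewrite ler_pM2l.
    exact: (ler_pM m20 (expR_ge0 _) mZ dec).
  - by rewrite lef_pV2 ?posrE ?exprn_gt0.
apply: (le_trans _ (ler_wpM2l y128 qq)); rewrite le_eqVlt; apply/orP; left; apply/eqP.
by field; rewrite !gt_eqF.
Qed.

Definition cauchy_factor w : R[i] := (w - conjc p.2)^-1.
(** [exp (i t0 w) / (w - conj w0)^3]: a power of the Cauchy factor is concentrated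
    at distance [y] of the base point, and the exponential makes the function square
    integrable over the unbounded domain. *)
Definition test_function w : R[i] :=
  cexp t0 w * (cauchy_factor w * cauchy_factor w * cauchy_factor w).

Lemma cauchy_factor_holomorphic w : 0 < complex.Im w -> holomorphic_at cauchy_factor w.
Proof.
move=> w0; apply: holomorphic_inv_sub; apply/eqP => E; move: w0; rewrite E.
by move: y0; case: (p.2) => a b /= b0; rewrite oppr_gt0 ltNge (ltW b0).
Qed.

Lemma test_function_holomorphic w : 0 < complex.Im w -> holomorphic_at test_function w.
Proof.
move=> w0; have J := cauchy_factor_holomorphic w0.
by apply: holomorphicM; [exact: cexp_holomorphic|do 2![apply: holomorphicM => //]].
Qed.

Lemma normc_cauchy_factor w : 
  normc (cauchy_factor w) ^+ 2 = ((complex.Re w - u0) ^+ 2 + (complex.Im w + y) ^+ 2)^-1.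
Proof.
rewrite /cauchy_factor normcV exprVn normc_sqrE.
by case: (w) (p.2) => a b [d e] /=; rewrite opprK.
Qed.

(** Two of the three factors [1 / |w - conj w0|^2] are spent on integrability in
    the real and imaginary parts of [w], the third one on the decay in [z]. *)
Lemma normc_test_function x1 y1 u v (z := x1 +i* y1) : F z < v ->
  normc (test_function (u +i* v)) ^+ 2 <=
  2 * expR (- (2 * t0) * F z) * (F z + y) ^- 2 * (bump_kernel u0 y u * bump_kernel 0 y v).
Proof.
move=> Fv; have Fz := F_ge0 z; have v0 : 0 < v by exact: le_lt_trans Fv.
have t00 : 0 < 2 * t0 by rewrite mulr_gt0// divr_gt0.
have -> : normc (test_function (u +i* v)) ^+ 2 = expR (- t0 * v) ^+ 2 *
  (normc (cauchy_factor (u +i* v)) ^+ 2) ^+ 3.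
  rewrite /test_function normcM normc_cexp /=.
  by rewrite -expr2 -exprSr normcX; ring.
rewrite normc_cauchy_factor /=.
set P := (u - u0) ^+ 2 + (v + y) ^+ 2.
have e1 : expR (- t0 * v) ^+ 2 <= expR (- (2 * t0) * F z).
  rewrite -expRM_natl ler_expR mulrA mulrN ler_nM2l ?oppr_lt0//; exact: ltW.
have vy : 0 < v + y by rewrite addr_gt0.
have P0 : 0 < P by rewrite ltr_wpDl ?sqr_ge0// exprn_gt0.
have b1 : P^-1 <= 2 * bump_kernel u0 y u.
  have uy : 0 < `|u - u0| + y by rewrite ltr_wpDl.
  rewrite /bump_kernel ler_pdivlMr ?exprn_gt0// ler_pdivrMl// mulrC.
  have E : (u - u0) ^+ 2 = `|u - u0| ^+ 2 by rewrite real_normK// num_real.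
  rewrite /P E; apply: sqrD_le2.
  by rewrite ler_pXn2r ?nnegrE ?(ltW y0) ?(ltW vy)// lerDr ltW.
have b2 : P^-1 <= bump_kernel 0 y v.
  rewrite /bump_kernel subr0 gtr0_norm// lef_pV2 ?posrE ?exprn_gt0//.
  by rewrite /P lerDr sqr_ge0.
have b3 : P^-1 <= (F z + y) ^- 2.
  have Fy : 0 < F z + y by rewrite ltr_wpDl.
  rewrite lef_pV2 ?posrE ?exprn_gt0//; apply: (@le_trans _ _ ((v + y) ^+ 2)).
    by rewrite ler_pXn2r ?nnegrE ?(ltW Fy) ?(ltW vy)// lerD2r ltW.
  by rewrite /P lerDr sqr_ge0.
have Pi : 0 <= P^-1 by rewrite invr_ge0 ltW.
have -> : P^-1 ^+ 3 = P^-1 * (P^-1 * P^-1) by rewrite !exprS expr0 mulr1.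
have -> : 2 * expR (- (2 * t0) * F z) * (F z + y) ^- 2 * (bump_kernel u0 y u * bump_kernel 0 y v) =
  expR (- (2 * t0) * F z) * ((F z + y) ^- 2 * ((2 * bump_kernel u0 y u) * bump_kernel 0 y v)).
  by ring.
have PP : 0 <= P^-1 * P^-1 by rewrite mulr_ge0.
exact: (ler_pM (sqr_ge0 _) (mulr_ge0 Pi PP) e1 (ler_pM Pi PP b3 (ler_pM Pi Pi b1 b2))).
Qed.

Local Notation oc := (@of_coordinates R).
Local Notation N h := (complex.Re (L2_inner (Omega F) h h)).

(** Bounds on the [z]-factor [m] of a function comparable with the test function
    turn into a bound of the norm. *)
Lemma test_A2 (h : C2 R -> R[i]^o) (m : C2 R -> R) (A : R) : 0 <= A ->
  holomorphic_on (Omega F) h ->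
  (forall q, 0 <= m q) ->
  (forall q, normc q.1 <= sigma * s -> 2 * m q / y ^+ 2 <= A) ->
  (forall q, m q <= 2 * (1 + normc q.1 ^+ 2)) ->
  (forall q, Omega F q -> normc (h q) ^+ 2 <= m q * normc (test_function q.2) ^+ 2) ->
  A2 (Omega F) h /\ N h <= 16 * (A * (sigma * s) ^+ 2 + 128 / y) / y ^+ 2.
Proof.
move=> A0 hh m0 mA mq hm; have ss0 : 0 < sigma * s by rewrite mulr_gt0// (lt_trans ltr01).
apply: (A2_majorized open_Omega (u0 := u0) ss0 y0 A0 _ hh); first by rewrite divr_ge0// ltW.
move=> [[[x1 y1] u] v] Oq; set q := oc (x1, y1, u, v) in Oq *.
apply: (le_trans (hm q Oq)).
have L := normc_test_function u (Oq : F (x1 +i* y1) < v).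
have -> : majorant (sigma * s) y A (128 / y) u0 (x1, y1, u, v) =
  (A * (\1_(`[- (sigma * s), sigma * s]%classic) x1 * \1_(`[- (sigma * s), sigma * s]%classic) y1) +
  128 / y * (bump_kernel 0 1 x1 * bump_kernel 0 1 y1)) * (bump_kernel u0 y u * bump_kernel 0 y v).
  by rewrite /majorant /tensor4 [RHS]mulrDl !mulrA.
apply: (le_trans (ler_wpM2l (m0 q) L)); rewrite (mulrA (m q)).
apply: ler_wpM2r; first by rewrite mulr_ge0// ltW// bump_kernel_gt0.
apply: le_trans (weight_le (m := m q) (m0 q) (mA q) A0 (mq q)).
by rewrite le_eqVlt; apply/orP; left; apply/eqP; rewrite !mulrA [m q * 2]mulrC.
Qed.

Let t00 : 0 < 2 * t0. Proof. by rewrite mulr_gt0// divr_gt0. Qed.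
Let E0 : R := expR (- (2 * t0)).
Let C0 : R := 16 * (8 * sigma ^+ 4 + 128).

Let sigma0 : 0 < sigma. Proof. exact: lt_trans ltr01 sigma1. Qed.
Let C00 : 0 < C0. Proof. by rewrite mulr_gt0// ltr_wpDl// mulr_ge0// exprn_ge0// ltW. Qed.

Lemma norm_bound_le (X T : R) : X <= 8 * sigma ^+ 4 -> y <= T ->
  16 * (X * T / y ^+ 2 + 128 / y) / y ^+ 2 <= C0 * T / y ^+ 4.
Proof.
move=> XL yT; have y4 : 0 < y ^+ 4 by rewrite exprn_gt0.
have -> : 16 * (X * T / y ^+ 2 + 128 / y) / y ^+ 2 = 16 * (X * T + 128 * y) / y ^+ 4.
  by field; rewrite gt_eqF.
rewrite ler_pM2r ?invr_gt0// /C0 -mulrA ler_pM2l// [leRHS]mulrDl.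
apply: lerD; last by rewrite ler_pM2l.
by apply: ler_wpM2r => //; exact: le_trans (ltW y0) yT.
Qed.

Lemma sigma_pow : 1 <= sigma ^+ 2 /\ 2 * sigma ^+ 2 <= 8 * sigma ^+ 4.
Proof.
have s2 : 1 <= sigma ^+ 2 by rewrite expr_ge1// ltW.
split=> //; have -> : sigma ^+ 4 = sigma ^+ 2 * sigma ^+ 2 by rewrite -exprD.
have : sigma ^+ 2 * 1 <= sigma ^+ 2 * sigma ^+ 2 by rewrite ler_pM2l// exprn_gt0.
by move: (sigma ^+ 2 * sigma ^+ 2) s2 => ? ?; lra.
Qed.

Lemma y_le_s2 : y <= s ^+ 2.
Proof.
apply: (le_trans ys); have -> : s ^+ 4 = s ^+ 2 * s ^+ 2 by rewrite -exprD.
by rewrite ler_piMr ?sqr_ge0// expr_le1// ltW.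
Qed.

Lemma im_gt0 q : Omega F q -> 0 < complex.Im q.2.
Proof. exact: le_lt_trans (F_ge0 q.1). Qed.

Lemma test0 (h := (fun q => test_function q.2) : C2 R -> R[i]^o) :
  A2 (Omega F) h /\ N h <= C0 * s ^+ 2 / y ^+ 4.
Proof.
have [s1' s2] := sigma_pow.
have [|||||q Oq|Ah Nh] := @test_A2 h (fun=> 1) (2 / y ^+ 2).
- by rewrite divr_ge0// exprn_ge0// ltW.
- by move=> q Oq; apply: differentiable_of_snd; apply: test_function_holomorphic; exact: im_gt0.
- by [].
- by move=> q _; rewrite mulr1.
- by move=> q; have := sqr_ge0 (normc q.1); lra.
- by rewrite mul1r.
split=> //; apply: (le_trans Nh); apply: le_trans (norm_bound_le s2 y_le_s2).
by rewrite le_eqVlt; apply/orP; left; apply/eqP; field; rewrite gt_eqF.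
Qed.

Lemma normc_sqrB (z w : R[i]) : normc (z - w) ^+ 2 <= 2 * normc z ^+ 2 + 2 * normc w ^+ 2.
Proof. by have := normc_sqrD z (- w); rewrite normcN. Qed.

Lemma p1_sqr : normc p.1 ^+ 2 <= s ^+ 2.
Proof. by rewrite ler_pXn2r ?nnegrE ?normc_ge0// ltW. Qed.

Lemma test1 (h := (fun q => (q.1 - p.1) * test_function q.2) : C2 R -> R[i]^o) :
  A2 (Omega F) h /\ N h <= C0 * s ^+ 4 / y ^+ 4.
Proof.
have [s1' s2] := sigma_pow; have pp := p1_sqr.
have s21 : s ^+ 2 <= 1 by rewrite expr_le1// ltW.
have [|||q qs|q|q Oq|Ah Nh] := @test_A2 h (fun q => normc (q.1 - p.1) ^+ 2) (8 * sigma ^+ 2 * s ^+ 2 / y ^+ 2).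
- by rewrite divr_ge0 ?sqr_ge0// mulr_ge0 ?sqr_ge0// mulr_ge0// sqr_ge0.
- move=> q Oq; apply: (@differentiableM _ _ (fun q : C2 R => q.1 - p.1 : R[i]^o) (fun q : C2 R => test_function q.2 : R[i]^o)).
    apply: (@differentiableB _ _ _ (fun q : C2 R => q.1 : R[i]^o)); first exact: differentiable_fst.
    exact: differentiable_cst.
  by apply: differentiable_of_snd; apply: test_function_holomorphic; exact: im_gt0.
- by move=> q; exact: sqr_ge0.
- rewrite ler_pM2r ?invr_gt0 ?exprn_gt0//.
  have : normc q.1 ^+ 2 <= (sigma * s) ^+ 2.
    by rewrite ler_pXn2r ?nnegrE ?normc_ge0 ?mulr_ge0// ltW.
  rewrite exprMn => q2; have := normc_sqrB q.1 p.1.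
  have : 1 * s ^+ 2 <= sigma ^+ 2 * s ^+ 2 by rewrite ler_wpM2r// sqr_ge0.
  rewrite mul1r -mulrA; move: (sigma ^+ 2 * s ^+ 2) q2 pp => ? ? ?; lra.
- by have := normc_sqrB q.1 p.1; move: pp s21; lra.
- by rewrite normcM exprMn.
split=> //; apply: (le_trans Nh); apply: le_trans (norm_bound_le (lexx _) ys).
by rewrite le_eqVlt; apply/orP; left; apply/eqP; field; rewrite gt_eqF.
Qed.

(** The additional factor [(w - w0) / (w - conj w0)] has modulus at most 1 in the
    upper half plane. *)
Lemma test2 (h := (fun q => (q.2 - p.2) * (test_function q.2 * cauchy_factor q.2)) : C2 R -> R[i]^o) :
  A2 (Omega F) h /\ N h <= C0 * s ^+ 2 / y ^+ 4.
Proof.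
have [s1' s2] := sigma_pow.
have [|||||q Oq|Ah Nh] := @test_A2 h (fun=> 1) (2 / y ^+ 2).
- by rewrite divr_ge0// exprn_ge0// ltW.
- move=> q Oq; have q0 := im_gt0 Oq.
  apply: (@differentiable_of_snd _ (fun w => (w - p.2) * (test_function w * cauchy_factor w))).
  apply: holomorphicM.
    by apply: holomorphicB; [exact: holomorphic_id|exact: holomorphic_cst].
  by apply: holomorphicM; [exact: test_function_holomorphic|exact: cauchy_factor_holomorphic].
- by [].
- by move=> q _; rewrite mulr1.
- by move=> q; have := sqr_ge0 (normc q.1); lra.
- have -> : normc (h q) ^+ 2 = normc (test_function q.2) ^+ 2 *
      (normc (q.2 - p.2) ^+ 2 * normc (cauchy_factor q.2) ^+ 2).
    by rewrite /h normcM (normcM (test_function _)); ring.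
  rewrite mul1r; apply: ler_piMr; first exact: sqr_ge0.
  have q0 := im_gt0 Oq.
  have d0 : 0 < (complex.Re q.2 - u0) ^+ 2 + (complex.Im q.2 + y) ^+ 2.
    by rewrite ltr_wpDl ?sqr_ge0// exprn_gt0// addr_gt0.
  rewrite normc_cauchy_factor ler_pdivrMr// mul1r normc_sqrE.
  have -> : complex.Re (q.2 - p.2) = complex.Re q.2 - u0 by case: (q.2) (p.2) => ? ? [].
  have -> : complex.Im (q.2 - p.2) = complex.Im q.2 - y by case: (q.2) (p.2) => ? ? [].
  rewrite lerD2l; have := mulr_gt0 q0 y0; rewrite !expr2.
  by move: (complex.Im q.2) => ?; lra.
split=> //; apply: (le_trans Nh); apply: le_trans (norm_bound_le s2 y_le_s2).
by rewrite le_eqVlt; apply/orP; left; apply/eqP; field; rewrite gt_eqF.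
Qed.

Hypothesis y4 : y <= 4^-1.
Hypothesis fs : f (s / sigma) <= y ^+ 2.
Hypothesis p1ss : normc p.1 <= s / (2 * sigma).

(** On the box [F] is at most [f (s / sigma) <= y^2], far below the height
    [y / 2]. *)
Lemma box_Omega : box p (s / (4 * sigma)) (y / 2) `<=` Omega F.
Proof.
move=> q /andP[/andP[q1 q2] /andP[_ q3]].
have qn : normc q.1 <= s / sigma.
  have -> : q.1 = p.1 + (q.1 - p.1) by rewrite addrC subrK.
  apply: (le_trans (le_normcD _ _)).
  have -> : s / sigma = s / (2 * sigma) + (s / (4 * sigma) + s / (4 * sigma)).
    by field; rewrite gt_eqF.
  apply: lerD => //; apply: (le_trans (normc_le_ReIm _)); exact: lerD.
have F1 : F q.1 <= y ^+ 2.
  by rewrite -fE; apply: le_trans fs; apply: f_le => //; exact: normc_ge0.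
apply: (le_lt_trans F1).
have -> : complex.Im q.2 = y + complex.Im (q.2 - p.2).
  by case: (q.2) (p.2) => ? b [? d] /=; ring.
move: q3; rewrite ler_norml => /andP[q3 _].
have : y * y <= y * 4^-1 by rewrite ler_pM2l.
by rewrite expr2; move: q3 y0; lra.
Qed.

Lemma test_function_p : E0 / (64 * y ^+ 6) <= normc (test_function p.2) ^+ 2.
Proof.
have -> : normc (test_function p.2) ^+ 2 = expR (- t0 * y) ^+ 2 *
  (normc (cauchy_factor p.2) ^+ 2) ^+ 3.
  by rewrite /test_function normcM normc_cexp /= -expr2 -exprSr normcX; ring.
rewrite normc_cauchy_factor subrr expr0n /= add0r.
have -> : y + y = 2 * y by ring.
have -> : ((2 * y) ^+ 2)^-1 ^+ 3 = (64 * y ^+ 6)^-1 by field; rewrite gt_eqF.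
apply: ler_wpM2r; first by rewrite invr_ge0 mulr_ge0// exprn_ge0// ltW.
rewrite /E0 -expRM_natl ler_expR.
have -> : 2 * (- t0 * y) = - (2 * t0 * y) by ring.
rewrite lerN2; apply: ler_piMr; first exact: ltW.
by apply: (le_trans y4); rewrite invf_le1// ler1n.
Qed.

Lemma model_bounds : 0 < bergman_diagonal (Omega F) p /\ forall xi,
  E0 / (2 ^+ 21 * C0 * sigma ^+ 2) * (normc xi.1 ^+ 2 / s ^+ 2 + normc xi.2 ^+ 2 / y ^+ 2)
    <= bergman_metric (Omega F) p xi /\
  bergman_metric (Omega F) p xi <=
    2 ^+ 33 * sigma ^+ 4 * C0 / E0 * (normc xi.1 ^+ 2 / s ^+ 2 + normc xi.2 ^+ 2 / y ^+ 2).
Proof.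
have [A0 N0] := test0; have [A1 N1] := test1; have [A2' N2] := test2.
have E00 : 0 < E0 by exact: expR_gt0.
have tp := test_function_p.
have yn n : 0 < y ^+ n by exact: exprn_gt0.
have sn n : 0 < s ^+ n by exact: exprn_gt0.
have q0 : 0 < C0 * s ^+ 2 / y ^+ 4 by rewrite divr_gt0// mulr_gt0.
have q1 : 0 < C0 * s ^+ 4 / y ^+ 4 by rewrite divr_gt0// mulr_gt0.
have a00 : 0 < E0 / (64 * y ^+ 6) by rewrite divr_gt0// mulr_gt0.
have a10 : 0 < E0 / (256 * y ^+ 6) by rewrite divr_gt0// mulr_gt0.
(* At the base point [w - conj w0 = 2 i y], whence the powers of 2 and of [y];
   [a1] is diminished by a factor 4 so that both coefficients agree. *)
have a20 : 0 < E0 / (256 * y ^+ 8) by rewrite divr_gt0// mulr_gt0.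
have hp := test_function_holomorphic y0.
have jp := cauchy_factor_holomorphic y0.
have d1 xi : E0 / (256 * y ^+ 6) * normc xi.1 ^+ 2 <=
    normc (dxi p xi (fun q => (q.1 - p.1) * test_function q.2)) ^+ 2.
  rewrite (dxi_test1 xi hp) normcM exprMn mulrC.
  apply: ler_wpM2l; first exact: sqr_ge0.
  apply: le_trans tp; rewrite ler_pM2l// lef_pV2 ?posrE ?mulr_gt0//.
  by rewrite ler_pM2r// ler_nat.
have d2 xi : E0 / (256 * y ^+ 8) * normc xi.2 ^+ 2 <=
    normc (dxi p xi (fun q => (q.2 - p.2) * (test_function q.2 * cauchy_factor q.2))) ^+ 2.
  rewrite (dxi_test2 xi (holomorphicM hp jp)) normcM exprMn mulrC.
  apply: ler_wpM2l; first exact: sqr_ge0.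
  rewrite normcM exprMn normc_cauchy_factor subrr expr0n /= add0r.
  have -> : y + y = 2 * y by ring.
  have -> : E0 / (256 * y ^+ 8) = E0 / (64 * y ^+ 6) * ((2 * y) ^+ 2)^-1 by field; rewrite gt_eqF.
  by apply: ler_wpM2r => //; rewrite invr_ge0 sqr_ge0.
have r0 : 0 < s / (4 * sigma) by rewrite divr_gt0// mulr_gt0.
have y2 : 0 < y / 2 by rewrite divr_gt0.
have z1 : (p.1 - p.1) * test_function p.2 = 0 by rewrite subrr mul0r.
have z2 : (p.2 - p.2) * (test_function p.2 * cauchy_factor p.2) = 0 by rewrite subrr mul0r.
have [K0 H] := bergman_metric_bounds open_Omega r0 y2 box_Omega a00 a10 a20 q0 q1 q0
  A0 A1 A2' N0 N1 N2 tp z1 z2 d1 d2.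
split=> // xi; have [L U] := H xi; split.
  apply: le_trans L; rewrite le_eqVlt; apply/orP; left; apply/eqP.
  by field; rewrite !gt_eqF.
apply: (le_trans U).
have -> : 2 ^+ 17 / ((s / (4 * sigma)) ^+ 2 * (y / 2) ^+ 2) *
   (C0 * s ^+ 2 / y ^+ 4 / (E0 / (64 * y ^+ 6))) *
   (normc xi.1 ^+ 2 / (s / (4 * sigma)) ^+ 2 + normc xi.2 ^+ 2 / (y / 2) ^+ 2) =
  2 ^+ 29 * sigma ^+ 2 * C0 / E0 * (16 * sigma ^+ 2 * (normc xi.1 ^+ 2 / s ^+ 2) +
    4 * (normc xi.2 ^+ 2 / y ^+ 2)) by field; rewrite !gt_eqF.
have -> : 2 ^+ 33 * sigma ^+ 4 * C0 / E0 * (normc xi.1 ^+ 2 / s ^+ 2 + normc xi.2 ^+ 2 / y ^+ 2) =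
  2 ^+ 29 * sigma ^+ 2 * C0 / E0 * (16 * sigma ^+ 2 * (normc xi.1 ^+ 2 / s ^+ 2) +
    16 * sigma ^+ 2 * (normc xi.2 ^+ 2 / y ^+ 2)) by field; rewrite !gt_eqF.
apply: ler_wpM2l.
  by rewrite divr_ge0 ?(ltW E00)// mulr_ge0 ?(ltW C00)// mulr_ge0 ?sqr_ge0// exprn_ge0.
rewrite lerD2l; apply: ler_wpM2r; first by rewrite divr_ge0 ?sqr_ge0.
have [s2 _] := sigma_pow; move: s2; lra.
Qed.

End ModelDomain.

(** * The approach region and the metric estimate *)

(** Flatness at 0 in the form in which it makes [y] small compared with powers of
    [s]. *)
Lemma flat_small (R : realType) (f : R -> R) (n : nat) (e : R) :
  f x / x ^+ n @[x --> 0^'+] --> (0 : R) -> 0 < e ->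
  exists2 d, 0 < d & forall x, 0 < x -> x < d -> f x <= e * x ^+ n.
Proof.
move=> /cvgrPdist_le H e0; have := H e e0; rewrite /at_right near_withinE.
move=> /nbhs_ballP[d d0 Hd]; exists d => // x x0 xd.
have := Hd x; rewrite /ball /= !sub0r !normrN gtr0_norm// => /(_ xd x0).
by move=> /(le_trans (ler_norm _)); rewrite ler_pdivrMr// exprn_gt0.
Qed.

(** The opening [alpha] and the order [N] of the region are absorbed by the
    flatness of [f], through the hypothesis on the height. *)
Lemma approach_small (R : realType) (F : R[i] -> R) (alpha b : R) (N : nat) (p : C2 R) :
  0 < alpha -> (0 < N)%N -> 0 <= b -> 0 <= complex.Im p.2 ->
  complex.Im p.2 <= (b / alpha) ^+ N -> approach_region F alpha N p -> normc p.1 <= b.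
Proof.
move=> a0 N0 b0 y0 yb [_ ap]; have ba : 0 <= b / alpha by rewrite divr_ge0// ltW.
have N00 : 0 < N%:R :> R by rewrite ltr0n.
have L : complex.Im p.2 `^ N%:R^-1 <= b / alpha.
  have -> : b / alpha = ((b / alpha) ^+ N) `^ N%:R^-1.
    by rewrite -powR_mulrn// -powRrM mulfV ?gt_eqF// powRr1.
  by apply: ge0_ler_powR => //; rewrite ?nnegrE ?invr_ge0 ?exprn_ge0 ?(ltW N00).
have M : normc p.1 <= Num.sqrt (normc p.1 ^+ 2 + `|complex.Re p.2| ^+ 2).
  have -> : normc p.1 = Num.sqrt (normc p.1 ^+ 2) :> R.
    by rewrite sqrtr_sqr ger0_norm// normc_ge0.
  rewrite sqr_sqrtr ?sqr_ge0//; apply: ler_wsqrtr.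
  by rewrite lerDl sqr_ge0.
apply: (le_trans M); apply/ltW/(lt_le_trans ap).
by rewrite mulrC -ler_pdivlMr.
Qed.

Theorem theorem1p3 (R : realType) (F : R[i] -> R) (f : R -> R)
  (F_smooth : smooth F)
  (F_subharmonic : subharmonic F)
  (F_radial : radial F)
  (fE : forall z : R[i], f (normc z) = F z)
  (F_flat : vanishes_to_infinite_order f)
  (not_levi_flat : ~ levi_flat_around (Omega F) (defining_function F) (0, 0))
  (Lambda_doubling : exists r : R,
     [/\ 0 < r, r < halfline_inverse f 1 & doubling r (Lambda f)]) :
  exists2 C : R, 0 < C &
    forall (alpha : R) (N : nat), 0 < alpha -> (0 < N)%N ->
      exists2 tau : R, 0 < tau &
        forall p : C2 R,
          approach_region F alpha N p -> complex.Im p.2 < tau ->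
          0 < bergman_diagonal (Omega F) p /\
          forall xi : C2 R,
            C^-1 * model_metric f p xi <= bergman_metric (Omega F) p xi /\
            bergman_metric (Omega F) p xi <= C * model_metric f p xi.
Proof.
have [f1 [f2 [df df1 f0 f10 fl]]] := flat_derivatives F_flat.
have lap := laplacian_ge0 F_subharmonic fE df df1.
have slope x : 0 < x -> 0 < f1 x.
  move=> x0; rewrite lt_def (slope_ge0 df1 f10 lap x0) andbT; apply/eqP => fx.
  apply: not_levi_flat; apply: (levi_flat_of_zero x0) => z zx.
  by rewrite -fE (zero_slope df df1 f0 f10 lap x0 fx)// normc_ge0 ltW.
have f_le := profile_le df slope.
have f_lt := profile_ltE df slope.
have f_log := profile_log df df1 lap.
have c0 := slope 1 ltr01.
have f_inv := halfline_inverseK df slope.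
have f_surj := profile_surj df df1 f0 lap slope.
have [F_usc _] := F_subharmonic.
have [r [r0 r1 dbl]] := Lambda_doubling.
have [sigma sigma1 dsq] := doubling_sqr df df1 f0 lap slope r0 r1 dbl.
have sigma0 : 0 < sigma by exact: lt_trans sigma1.
have C00 : 0 < 16 * (8 * sigma ^+ 4 + 128) by rewrite mulr_gt0// ltr_wpDl// mulr_ge0// exprn_ge0// ltW.
set C0 := 16 * _ in C00.
set E0 := expR (- (2 * (3 / f1 1))); have E00 : 0 < E0 by exact: expR_gt0.
have c10 : 0 < E0 / (2 ^+ 21 * C0 * sigma ^+ 2).
  by rewrite divr_gt0// mulr_gt0 ?exprn_gt0// mulr_gt0// exprn_gt0.
have c20 : 0 < 2 ^+ 33 * sigma ^+ 4 * C0 / E0.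
  by rewrite divr_gt0// mulr_gt0// mulr_gt0// exprn_gt0.
set c1 := E0 / _ in c10; set c2 := _ / E0 in c20.
have C10 : 0 < c2 + c1^-1 by rewrite addr_gt0// invr_gt0.
exists (c2 + c1^-1) => // alpha N a0 N0.
have [d1 d10 H1] := flat_small (fl 4) ltr01.
have e0 : 0 < (2 * sigma * alpha)^-1 ^+ N by rewrite exprn_gt0// invr_gt0 !mulr_gt0.
have [d2 d20 H2] := flat_small (fl N) e0.
(* Only [d2], hence the height below which the estimate holds, depends on [alpha]
   and [N]. *)
pose d := Num.min (Num.min 1 (r / sigma)) (Num.min d1 d2).
have d0 : 0 < d by rewrite !lt_min ltr01 divr_gt0//= d10.
have fd0 : 0 < f d by rewrite -f0 f_lt// ltW.
exists (Num.min (f d) 4^-1); first by rewrite lt_min fd0 invr_gt0 ltr0n.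
move=> p ap; rewrite lt_min => /andP[yd y4].
have Op : Omega F p by case: ap.
have Fp : 0 <= F p.1 by exact: (F_ge0 fE f_le f0).
have y0 : 0 < complex.Im p.2 by exact: le_lt_trans Op.
have [s s0' fs] := f_surj _ (ltW y0).
have s0 : 0 < s by rewrite -(f_lt _ _ (lexx 0) s0') f0 fs.
have : s < d by rewrite -(f_lt _ _ s0' (ltW d0)) fs.
rewrite !lt_min => /andP[/andP[/ltW s1 /ltW sr] /andP[sd1 sd2]].
have ys : complex.Im p.2 <= s ^+ 4 by have := H1 s s0 sd1; rewrite mul1r fs.
have fss : complex.Im p.2 <= f (sigma * s) ^+ 2 by have := dsq s s0 sr; rewrite fs.
have fsd : f (s / sigma) <= complex.Im p.2 ^+ 2.
  have ss : s / sigma <= r / sigma.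
    apply: le_trans sr; rewrite ler_pdivrMr// ler_peMr ?(ltW s0)//; exact: ltW.
  by have := dsq _ (divr_gt0 s0 sigma0) ss; rewrite [sigma * _]mulrC divfK ?gt_eqF// fs.
have s2 : 0 <= s / (2 * sigma) by rewrite divr_ge0 ?mulr_ge0// ltW.
have p1 : normc p.1 <= s / (2 * sigma).
  apply: (approach_small a0 N0 s2 (ltW y0) _ ap); rewrite -fs.
  have -> : s / (2 * sigma) / alpha = (2 * sigma * alpha)^-1 * s by field; rewrite !gt_eqF.
  by rewrite exprMn; exact: H2.
have p1s : normc p.1 <= s.
  apply: (le_trans p1); rewrite ler_pdivrMr ?mulr_gt0// ler_peMr ?(ltW s0)//.
  by move: sigma1; lra.
have [K0 H] := model_bounds F_usc fE f_le f0 c0 f_log s0 s1 sigma1 y0 ys p1s fss (ltW y4) fsd p1.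
split=> // xi; have [L U] := H xi.
have -> : model_metric f p xi = normc xi.1 ^+ 2 / s ^+ 2 + normc xi.2 ^+ 2 / complex.Im p.2 ^+ 2.
  by rewrite /model_metric -fs f_inv// fs gtr0_norm// mulrC [X in _ + X]mulrC.
have M0 : 0 <= normc xi.1 ^+ 2 / s ^+ 2 + normc xi.2 ^+ 2 / complex.Im p.2 ^+ 2.
  by rewrite addr_ge0// divr_ge0 ?sqr_ge0.
split.
  apply: le_trans L; apply: ler_wpM2r => //; rewrite -[leRHS]invrK lef_pV2 ?posrE ?invr_gt0//.
  by rewrite lerDr ltW.
by apply: (le_trans U); apply: ler_wpM2r => //; rewrite lerDl invr_ge0 ltW.
Qed.
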